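(* Let $\mathcal{S}$ and $\mathcal{T}$ be operator systems. If $\mathcal{S}$ and $\mathcal{T}$ are $\Delta$-equivalent then there is a unital complete order isomorphism $\mathcal{Z}(\overline{\mathcal{S}})\simeq\mathcal{Z}(\overline{\mathcal{T}})$. Consequently, an operator system $\mathcal{S}$ is $\Delta$-equivalent to a function system if and only if $\overline{\mathcal{S}}$ is $\Delta$-equivalent to $\mathcal{Z}(\overline{\mathcal{S}})$.
   Context: An operator system is a (not necessarily closed) selfadjoint subspace of some $\mathcal{B}(H)$ containing $I_H$; an overline denotes norm closure (completion). With $\iota_{\rm env}:\mathcal{S}\to\mathrm{C}^*_{\rm env}(\mathcal{S})$ the canonical embedding into the C*-envelope, the centre of $\mathcal{S}$ is $\mathcal{Z}(\mathcal{S})=\{x\in\mathcal{S}:\iota_{\rm env}(x)y=y\,\iota_{\rm env}(x)\text{ for all }y\in\mathrm{C}^*_{\rm env}(\mathcal{S})\}$. A function system is an operator subsystem of $\mathrm{C}(X)$, $X$ compact Hausdorff, that separates the points of $X$. $[\,\cdot\,]$ is norm-closed linear span. A TRO is a linear subspace $\mathcal{M}\subseteq\mathcal{B}(H,K)$ with $\mathcal{M}\mathcal{M}^*\mathcal{M}\subseteq\mathcal{M}$; it is non-degenerate if $I_H\in[\mathcal{M}^*\mathcal{M}]$ and $I_K\in[\mathcal{M}\mathcal{M}^*]$. Concrete operator systems $\mathcal{S}\subseteq\mathcal{B}(H)$, $\mathcal{T}\subseteq\mathcal{B}(K)$ are TRO-equivalent if there is a non-degenerate TRO $\mathcal{M}\subseteq\mathcal{B}(H,K)$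 with $\mathcal{M}^*\mathcal{T}\mathcal{M}\subseteq\overline{\mathcal{S}}$ and $\mathcal{M}\mathcal{S}\mathcal{M}^*\subseteq\overline{\mathcal{T}}$. Operator systems are $\Delta$-equivalent if they have unital complete order embeddings with TRO-equivalent images. *)

(* Defs.v *)
(* MathComp / MathComp-Analysis.  Scalars are R[i] for an arbitrary realType R. *)
From mathcomp Require Import all_boot all_order all_algebra.
From mathcomp Require Import complex.
From mathcomp Require Import all_classical all_reals all_analysis.
Import Order.TTheory GRing.Theory Num.Theory numFieldNormedType.Exports.
Set Implicit Arguments.
Unset Strict Implicit.
Unset Printing Implicit Defensive.
Local Open Scope classical_set_scope.
Local Open Scope ring_scope.
Local Open Scope complex_scope.

(* The form is linear in its first argument and conjugate-linear in the second;
   the zero space is allowed. *)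
Record hilbert (R : realType) := Hilbert {
  hilbert_sort :> completeNormedModType R[i];
  hdot : {dot hilbert_sort for @Num.conj R[i]};
  hdot_norm : forall x : hilbert_sort, hdot x x = `|x| ^+ 2 }.

(* Operators are plain functions, so that H -> K carries the library's pointwise
   lmodType structure; B(H, K) is the set [bounded_op H K]. *)
Definition bounded_op (R : realType) (H K : hilbert R) : set (H -> K) :=
  [set A | linear A /\ exists k : R[i], forall x, `|A x| <= k * `|x|].
Arguments bounded_op {R} H K.

Definition is_adjoint (R : realType) (H K : hilbert R) (A : H -> K) (B : K -> H)
  := forall x y, hdot K (A x) y = hdot H x (B y).

Definition adjset (R : realType) (H K : hilbert R) (M : set (H -> K)) :
    set (K -> H) := [set B | exists2 A, M A & is_adjoint A B].

Definition opmul (T1 T2 T3 : Type) (M : set (T2 -> T3)) (N : set (T1 -> T2)) :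
    set (T1 -> T3) := [set a \o b | a in M & b in N].

Definition subspace (F : pzRingType) (V : lmodType F) (S : set V) :=
  S 0 /\ forall (a : F) u v, S u -> S v -> S (a *: u + v).

(* Closure for the operator norm: `|T - A| <= e is spelled out pointwise. *)
Definition opclosure (R : realType) (H K : hilbert R) (S : set (H -> K)) :
    set (H -> K) :=
  [set T | bounded_op H K T /\ forall e : R[i], 0 < e ->
     exists2 A, S A & forall x, `|T x - A x| <= e * `|x|].

Definition clspan (R : realType) (H K : hilbert R) (S : set (H -> K)) :
    set (H -> K) := opclosure (smallest (@subspace _ (H -> K)) S).

(* The data of B(H) or C(X) relevant to operator systems: an ambient vector
   space, the set of its elements that belong to the algebra, the unit, the
   adjoint relation, and the positive cones of the matrix algebras. *)
Record mospace (R : realType) := MOSpace {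
  mo_sort :> lmodType R[i];
  mo_dom : set mo_sort;
  mo_unit : mo_sort;
  mo_adj : mo_sort -> mo_sort -> Prop;
  mo_pos : forall n : nat, set 'M[mo_sort]_n }.
Arguments mo_dom {R} m _.

(* Recall that 0 <= z in R[i] means that z is real and nonnegative. *)
Definition opspace (R : realType) (H : hilbert R) : mospace R :=
  @MOSpace R (H -> H) (bounded_op H H) idfun (@is_adjoint R H H)
    (fun n => [set A | forall xi : 'I_n -> H,
       0 <= \sum_i \sum_j hdot H (A i j (xi j)) (xi i)]).

(* M_n(C(X)) is C(X, M_n): a matrix of functions is positive iff it is positive
   semidefinite at every point. *)
Definition funspace (R : realType) (X : topologicalType) : mospace R :=
  @MOSpace R (X -> R[i]^o) [set f | continuous f] (fun=> 1)
    (fun f g => forall x, g x = Num.conj (f x : R[i]))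
    (fun n => [set A | forall (x : X) (z : 'I_n -> R[i]),
       0 <= \sum_i \sum_j (A i j x : R[i]) * z j * Num.conj (z i)]).

(* Operator subsystem of A; an operator system in B(H) is the case
   A = opspace H. *)
Definition operator_system (R : realType) (A : mospace R) (S : set A) :=
  [/\ S `<=` mo_dom A, subspace S, S (mo_unit A) &
      forall x y, S x -> mo_adj x y -> S y].

Definition function_system (R : realType) (X : topologicalType)
    (S : set (funspace R X)) :=
  [/\ compact [set: X], hausdorff_space X, operator_system S &
      forall x y : X, x <> y -> exists2 f, S f & f x <> f y].

(* Unital complete order embedding of S; only the values of phi on S matter. *)
Definition ucoe (R : realType) (A B : mospace R) (S : set A) (phi : A -> B) :=
  [/\ forall x, S x -> mo_dom B (phi x),
      forall (a : R[i]) x y, S x -> S y -> phi (a *: x + y) = a *: phi x + phi y,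
      phi (mo_unit A) = mo_unit B &
      forall n (M : 'M[A]_n), (forall i j, S (M i j)) ->
        (mo_pos M <-> mo_pos (map_mx phi M))].

Definition uco_isomorphic (R : realType) (A B : mospace R)
    (S : set A) (T : set B) :=
  exists2 phi : A -> B, ucoe S phi & phi @` S = T.

Definition TRO (R : realType) (H K : hilbert R) (M : set (H -> K)) :=
  [/\ M `<=` bounded_op H K, @subspace _ (H -> K) M &
      opmul (opmul M (adjset M)) M `<=` M].

Definition nondegenerate (R : realType) (H K : hilbert R) (M : set (H -> K)) :=
  clspan (opmul (adjset M) M) idfun /\ clspan (opmul M (adjset M)) idfun.

Definition TRO_equivalent (R : realType) (H K : hilbert R)
    (S : set (opspace H)) (T : set (opspace K)) :=
  exists M : set (H -> K), [/\ TRO M, nondegenerate M,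
    opmul (opmul (adjset M) T) M `<=` opclosure S &
    opmul (opmul M S) (adjset M) `<=` opclosure T].

Definition delta_equivalent (R : realType) (A B : mospace R)
    (S : set A) (T : set B) :=
  exists (H K : hilbert R) (phi : A -> opspace H) (psi : B -> opspace K),
    [/\ ucoe S phi, ucoe T psi & TRO_equivalent (phi @` S) (psi @` T)].

(* Norm-closed unital *-subalgebras of B(H), and the one generated by a set. *)
Definition cstar_subalgebra (R : realType) (H : hilbert R) (A : set (H -> H)) :=
  [/\ operator_system (A : set (opspace H)), opmul A A `<=` A &
      opclosure A `<=` A].

Definition cstar_gen (R : realType) (H : hilbert R) (S : set (opspace H)) :
    set (opspace H) := smallest (@cstar_subalgebra R H) S.

Definition star_hom (R : realType) (H K : hilbert R)
    (A : set (opspace H)) (B : set (opspace K)) (pi : opspace H -> opspace K) :=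
  [/\ forall x, A x -> B (pi x),
      forall (a : R[i]) x y, A x -> A y -> pi (a *: x + y) = a *: pi x + pi y,
      forall x y : H -> H, A x -> A y -> pi (x \o y) = pi x \o pi y &
      forall x y : H -> H, A x -> is_adjoint x y -> is_adjoint (pi x) (pi y)].

(* C*-algebras are represented faithfully on Hilbert spaces: a unital complete
   order embedding j of S in some B(L) stands for the C*-cover (C*(j(S)), j).
   The C*-envelope is the C*-cover that is a quotient of all the others. *)
Record cstar_envelope (R : realType) (H : hilbert R) (S : set (opspace H)) :=
  CstarEnvelope {
    env_space : hilbert R;
    env_map : opspace H -> opspace env_space;
    env_ucoe : ucoe S env_map;
    env_univ : forall (L : hilbert R) (j : opspace H -> opspace L), ucoe S j ->
      exists2 pi : opspace L -> opspace env_space,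
        star_hom (cstar_gen (j @` S)) (cstar_gen (env_map @` S)) pi &
        forall x, S x -> pi (j x) = env_map x }.

Arguments env_map {R H S} c _.

Definition env_algebra (R : realType) (H : hilbert R) (S : set (opspace H))
    (E : cstar_envelope S) : set (opspace (env_space E)) :=
  cstar_gen (env_map E @` S).
Arguments env_algebra {R H S} E _.

Definition centre (R : realType) (H : hilbert R) (S : set (opspace H))
    (E : cstar_envelope S) : set (opspace H) :=
  [set x | S x /\ forall y : env_space E -> env_space E,
     env_algebra E y -> (env_map E x : _ -> _) \o y = y \o env_map E x].

(* Main.v *)
From HB Require Import structures.
Require Import Defs.
From mathcomp Require Import all_boot all_order all_algebra.
From mathcomp Require Import complex.
From mathcomp Require Import all_classical all_reals all_analysis.
From mathcomp Require Import ring lra.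
Import Order.TTheory GRing.Theory Num.Theory numFieldNormedType.Exports.
Set Implicit Arguments.
Unset Strict Implicit.
Unset Printing Implicit Defensive.
Local Open Scope classical_set_scope.
Local Open Scope ring_scope.
Local Open Scope complex_scope.

(* A TRO M implementing the equivalence links z in S and w in T when w a = a z and
   z a^* = a^* w for all a in M.  Links are unique and preserve matrix positivity.
   Centrality is not visible inside S, but it has a criterion without envelopes: if S
   is represented faithfully by positive kernels on which z acts compatibly, then z is
   a multiplier of a C*-cover, hence commutes with S in the envelope.  Inducing the
   envelope representation of S along M gives such kernels for T, so the centres are
   linked.

   If T is the closure of a function system, matrix positivity in T is tested by
   scalar compressions; transposes of positive matrices are then positive, and this
   forces multipliers of T, in particular the a b^* with a and b in M, to commute with
   T.  States of T that are multiplicative on multipliers, obtained from maximal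
   cones by Zorn's lemma, separate T and give kernels showing that all of T is linked
   to the centre.  Conversely the centre consists of commuting normal operators of the
   envelope, so its matrix order is tested by scalar compressions, and it is a function
   system on its state space. *)

(** The envelope is given only by its universal property, so no computation can take place inside
    it. The way out is that *-homomorphisms preserve commutation: it suffices to see z commute with
    S in a single C*-cover, which then maps to the envelope. Describing covers by kernels yields
    both the induced space N (x) L and the direct sum of one-dimensional spaces over states by
    merely writing down inner products. Transposes enter because the compressions sum c_j conj(c_i)
    t_ij of a matrix and of its transpose form the same family, so an order tested by them cannot
    tell the two apart. Commutation of multipliers with T has to come before the states: the cones
    are modules over positive multipliers, and d t must be selfadjoint, and positive when t is.
    Continuous functional calculus is replaced throughout by elementary devices: Neumann series for
    inverses, the iteration b - b^2 for square roots, Cayley transforms for unitaries, Schur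
    complements for matrices over a commutative algebra. *)

(** * Complex numbers and Hilbert spaces *)

Section ComplexNumbers.
Variable R : realType.
Implicit Types (a b c r : R) (z w s : R[i]).

Definition re z : R := complex.Re z.
Definition im z : R := complex.Im z.
Definition cn z : R := re `|z|.

Lemma reD z w : re (z + w) = re z + re w. Proof. by case: z; case: w. Qed.
Lemma imD z w : im (z + w) = im z + im w. Proof. by case: z; case: w. Qed.
Lemma reN z : re (- z) = - re z. Proof. by case: z. Qed.
Lemma imN z : im (- z) = - im z. Proof. by case: z. Qed.
Lemma reM z w : re (z * w) = re z * re w - im z * im w.
Proof. by case: z; case: w. Qed.
Lemma imM z w : im (z * w) = re z * im w + im z * re w.
Proof. by case: z => ? ?; case: w => ? ?; rewrite /im /= [RHS]addrC addrC. Qed.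
Lemma reJ z : re (Num.conj z) = re z. Proof. by case: z. Qed.
Lemma imJ z : im (Num.conj z) = - im z. Proof. by case: z. Qed.
Lemma reC r : re r%:C = r. Proof. by []. Qed.
Lemma imC r : im r%:C = 0. Proof. by []. Qed.
Lemma re0 : re 0 = 0. Proof. by []. Qed.
Lemma im0 : im 0 = 0. Proof. by []. Qed.
Lemma re1 : re 1 = 1. Proof. by []. Qed.
Lemma im1 : im 1 = 0. Proof. by []. Qed.
Lemma reI : re 'i%C = 0. Proof. by []. Qed.
Lemma imI : im 'i%C = 1. Proof. by []. Qed.
Lemma re_sum I (s : seq I) P (F : I -> R[i]) :
  re (\sum_(i <- s | P i) F i) = \sum_(i <- s | P i) re (F i).
Proof. exact: (big_morph re reD re0). Qed.

Lemma ceqP z w : re z = re w -> im z = im w -> z = w.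
Proof. by case: z; case: w => /= a b c d; rewrite /re /im /= => -> ->. Qed.

Lemma realC_inj a b : a%:C = b%:C -> a = b. Proof. by case. Qed.

Definition cE := (reD, imD, reN, imN, reM, imM, reJ, imJ, reC, imC, re0, im0,
  re1, im1, reI, imI).

Lemma conjC_real r : Num.conj (r%:C : R[i]) = r%:C.
Proof. by apply: ceqP; rewrite !cE ?oppr0. Qed.

Lemma ge0cP z : (0 <= z) <-> (im z = 0 /\ 0 <= re z).
Proof. by rewrite lecE; split=> [/andP[/eqP]|[/eqP->]]. Qed.

Lemma ge0_re z : 0 <= z -> 0 <= re z. Proof. by move/ge0cP=> []. Qed.
Lemma ge0_im z : 0 <= z -> im z = 0. Proof. by move/ge0cP=> []. Qed.

Lemma cnE z : `|z| = (cn z)%:C.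
Proof. by rewrite /cn RRe_real // normr_real. Qed.
Lemma cn_ge0 z : 0 <= cn z.
Proof. by have := normr_ge0 z; rewrite cnE ler0c. Qed.
Lemma cnM z w : cn (z * w) = cn z * cn w.
Proof. by have := normrM z w; rewrite !cnE -rmorphM => /realC_inj. Qed.
Lemma cnD z w : cn (z + w) <= cn z + cn w.
Proof. by have := ler_normD z w; rewrite !cnE -rmorphD lecR. Qed.
Lemma cnN z : cn (- z) = cn z.
Proof. by rewrite /cn normrN. Qed.
Lemma cn0 : cn 0 = 0. Proof. by rewrite /cn normr0. Qed.
Lemma cn_sq z : cn z ^+ 2 = re z ^+ 2 + im z ^+ 2.
Proof.
by have := add_Re2_Im2 z; rewrite cnE -rmorphXn => /realC_inj.
Qed.
Lemma cn_le z r : 0 <= r -> re z ^+ 2 + im z ^+ 2 <= r ^+ 2 -> cn z <= r.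
Proof. by rewrite -cn_sq => r0; rewrite ler_pXn2r // nnegrE cn_ge0. Qed.
Lemma cnJ z : cn (Num.conj z) = cn z.
Proof.
by apply/eqP; rewrite -(@eqrXn2 _ 2) ?cn_ge0 // !cn_sq !cE sqrrN.
Qed.
Lemma normr_re_le z : `|re z| <= cn z.
Proof.
rewrite -(@ler_pXn2r _ 2) ?nnegrE ?cn_ge0 ?normr_ge0 // cn_sq.
by rewrite real_normK ?num_real // lerDl sqr_ge0.
Qed.
Lemma normr_im_le z : `|im z| <= cn z.
Proof.
rewrite -(@ler_pXn2r _ 2) ?nnegrE ?cn_ge0 ?normr_ge0 // cn_sq.
by rewrite real_normK ?num_real // lerDr sqr_ge0.
Qed.
Lemma re_le_cn z : re z <= cn z.
Proof. exact: le_trans (ler_norm _) (normr_re_le z). Qed.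
Lemma re_geN_cn z : - cn z <= re z.
Proof. by have := normr_re_le z; rewrite ler_norml => /andP[]. Qed.
Lemma cn_real r : cn r%:C = `|r|.
Proof.
apply/eqP; rewrite -(@eqrXn2 _ 2) ?cn_ge0 //.
by rewrite cn_sq reC imC expr0n addr0 real_normK // num_real.
Qed.
Lemma cn_le_reim z : cn z <= `|re z| + `|im z|.
Proof.
apply: cn_le; first by rewrite addr_ge0.
rewrite sqrrD !real_normK ?num_real //.
have := mulr_ge0 (normr_ge0 (re z)) (normr_ge0 (im z)); lra.
Qed.
Lemma cn_eq0 z : cn z = 0 -> z = 0.
Proof. by move=> h; apply/eqP; rewrite -normr_eq0 cnE h. Qed.
Lemma cn_sum I (s : seq I) P (F : I -> R[i]) :
  cn (\sum_(i <- s | P i) F i) <= \sum_(i <- s | P i) cn (F i).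
Proof.
elim/big_ind2: _ => [|x1 x2 y1 y2 h1 h2|//]; first by rewrite cn0.
exact: le_trans (cnD _ _) (lerD h1 h2).
Qed.
Lemma mulJ z : z * Num.conj z = (cn z ^+ 2)%:C.
Proof. by apply: ceqP; rewrite !cE ?cn_sq; ring. Qed.

(* The discriminant argument behind the Cauchy-Schwarz inequalities. *)
Lemma discriminant a b z : 0 <= b ->
  (forall s, 0 <= a + re (s * z) *+ 2 + cn s ^+ 2 * b) -> cn z ^+ 2 <= a * b.
Proof.
move=> b0 h.
have e t : a - t * cn z ^+ 2 *+ 2 + t ^+ 2 * cn z ^+ 2 * b >= 0.
  have := h (- (t%:C * Num.conj z)).
  rewrite cnN cnM cnJ cn_real exprMn real_normK ?num_real //.
  by rewrite !cE cn_sq; congr (_ <= _); ring.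
have [b_eq0|b_neq0] := eqVneq b 0.
  rewrite b_eq0 mulr0; rewrite leNgt; apply/negP => zgt.
  have := e ((a + 1) / (cn z ^+ 2)); rewrite b_eq0 mulr0 addr0 divfK ?gt_eqF //.
  by have := h 0; rewrite mul0r re0 cn0 b_eq0; lra.
have bgt : 0 < b by rewrite lt_def b_neq0.
(* The value t = 1/b minimises the quadratic a - 2 t X + t^2 X b. *)
have := e (b^-1); set X := cn z ^+ 2.
have -> : a - b^-1 * X *+ 2 + b^-1 ^+ 2 * X * b = a - X / b by field.
by rewrite subr_ge0 ler_pdivrMr.
Qed.

(** The error has the form [e * k] because estimates on quadratic forms come multiplied by norms of
    fixed vectors; the sign of [k] is left open, whence [|k| + 1] in the proof. *)
Lemma ge0c_closed z k :
  (forall e : R, 0 < e -> exists2 w, 0 <= w & cn (z - w) <= e * k) -> 0 <= z.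
Proof.
move=> h; apply/ge0cP; split.
  apply/eqP; rewrite -normr_le0; apply/ler_addgt0Pr => e e0.
  have k1 : 0 < `|k| + 1 by rewrite ltr_wpDl.
  have [w w0 hw] := h (e / (`|k| + 1)) (divr_gt0 e0 k1).
  have := le_trans (normr_im_le _) hw; rewrite imD imN (ge0_im w0) oppr0 addr0 => H.
  rewrite add0r; apply: (le_trans H); rewrite mulrAC ler_pdivrMr //.
  by rewrite ler_wpM2l ?(ltW e0) // (le_trans (ler_norm _)) // lerDl.
apply/ler_addgt0Pr => e e0.
have k1 : 0 < `|k| + 1 by rewrite ltr_wpDl.
have [w w0 hw] := h (e / (`|k| + 1)) (divr_gt0 e0 k1).
have H : re w - re z <= e.
  have := le_trans (normr_re_le _) hw; rewrite reD reN distrC => {}hw.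
  apply: (le_trans (le_trans (ler_norm _) hw)); rewrite mulrAC ler_pdivrMr //.
  by rewrite ler_wpM2l ?(ltW e0) // (le_trans (ler_norm _)) // lerDl.
have := ge0_re w0; lra.
Qed.
End ComplexNumbers.

Section Hilbert.
Variables (R : realType) (H : hilbert R).
Implicit Types (x y z : H) (a : R[i]).

Definition nr x : R := re `|x|.
Local Notation dot := (hdot H).

Lemma nrE x : `|x| = (nr x)%:C.
Proof. by rewrite /nr /re RRe_real // normr_real. Qed.
Lemma nr_ge0 x : 0 <= nr x. Proof. by have := normr_ge0 x; rewrite nrE ler0c. Qed.
Lemma nrZ a x : nr (a *: x) = cn a * nr x.
Proof. by have := normrZ a x; rewrite !nrE cnE -rmorphM => /realC_inj. Qed.
Lemma nrD x y : nr (x + y) <= nr x + nr y.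
Proof. by have := ler_normD x y; rewrite !nrE -rmorphD lecR. Qed.
Lemma nrN x : nr (- x) = nr x. Proof. by rewrite /nr normrN. Qed.
Lemma nrB x y : nr (x - y) = nr (y - x). Proof. by rewrite -nrN opprB. Qed.
Lemma nr_tri z x y : nr (x - y) <= nr (x - z) + nr (z - y).
Proof. by rewrite -[x - y](subrKA z) nrD. Qed.
Lemma nr0 : nr (0 : H) = 0. Proof. by rewrite /nr normr0. Qed.
Lemma nr_eq0 x : nr x = 0 -> x = 0.
Proof. by move=> h; apply/eqP; rewrite -normr_eq0 nrE h. Qed.

Lemma dotDl x y z : dot (x + y) z = dot x z + dot y z.
Proof. exact: linearDl. Qed.
Lemma dotDr x y z : dot z (x + y) = dot z x + dot z y.
Proof. exact: linearDr. Qed.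
Lemma dotZl a x y : dot (a *: x) y = a * dot x y.
Proof. exact: linearZl_LR. Qed.
Lemma dotZr a x y : dot y (a *: x) = Num.conj a * dot y x.
Proof. exact: linearZr_LR. Qed.
Lemma dotNl x y : dot (- x) y = - dot x y. Proof. exact: linearNl. Qed.
Lemma dotNr x y : dot y (- x) = - dot y x. Proof. exact: linearNr. Qed.
Lemma dotBl x y z : dot (x - y) z = dot x z - dot y z.
Proof. by rewrite dotDl dotNl. Qed.
Lemma dot0l y : dot 0 y = 0. Proof. exact: linear0l. Qed.
Lemma dot0r y : dot y 0 = 0. Proof. exact: linear0r. Qed.
Lemma dotC x y : dot x y = Num.conj (dot y x).
Proof. by rewrite (hermC (hdot H)) expr0 mul1r. Qed.
Lemma dot_suml I (s : seq I) P (F : I -> H) y :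
  dot (\sum_(i <- s | P i) F i) y = \sum_(i <- s | P i) dot (F i) y.
Proof. by elim/big_rec2: _ => [|i a b _ <-]; rewrite ?dot0l ?dotDl. Qed.
Lemma dot_sumr I (s : seq I) P (F : I -> H) y :
  dot y (\sum_(i <- s | P i) F i) = \sum_(i <- s | P i) dot y (F i).
Proof. by elim/big_rec2: _ => [|i a b _ <-]; rewrite ?dot0r ?dotDr. Qed.
Lemma dotxx x : dot x x = (nr x ^+ 2)%:C.
Proof. by rewrite hdot_norm nrE rmorphXn. Qed.
Lemma dotxx_ge0 x : 0 <= dot x x.
Proof. by rewrite dotxx ler0c sqr_ge0. Qed.
Lemma nr_sqD x y : nr (x + y) ^+ 2 = nr x ^+ 2 + re (dot x y) *+ 2 + nr y ^+ 2.
Proof.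
apply: realC_inj; rewrite -dotxx dotDl !dotDr !dotxx (dotC y x).
by apply: ceqP; rewrite !cE; ring.
Qed.
Lemma parallelogram x y :
  nr (x + y) ^+ 2 + nr (x - y) ^+ 2 = nr x ^+ 2 *+ 2 + nr y ^+ 2 *+ 2.
Proof. by rewrite !nr_sqD nrN dotNr reN; ring. Qed.
Lemma cauchy_schwarz x y : cn (dot x y) <= nr x * nr y.
Proof.
rewrite -(@ler_pXn2r _ 2) ?nnegrE ?cn_ge0 ?mulr_ge0 ?nr_ge0 //.
rewrite exprMn -mulrC mulrC mulrC; apply: discriminant; first exact: sqr_ge0.
move=> s; have := sqr_ge0 (nr (s *: x + y)).
by rewrite nr_sqD dotZl nrZ exprMn; congr (_ <= _); ring.
Qed.
Lemma dot_eq0 x : (forall y, dot x y = 0) -> x = 0.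
Proof.
move=> /(_ x); rewrite dotxx => /realC_inj/eqP.
by rewrite expf_eq0 /= => /eqP/nr_eq0.
Qed.
Lemma dot_inj x y : (forall z, dot x z = dot y z) -> x = y.
Proof.
move=> h; apply/eqP; rewrite -subr_eq0; apply/eqP/dot_eq0 => z.
by rewrite dotBl h subrr.
Qed.

Lemma hilbert_cauchy (u : nat -> H) :
  (forall e : R, 0 < e ->
     exists N, forall m n, (N <= m)%N -> (N <= n)%N -> nr (u m - u n) <= e) ->
  exists l, forall e : R, 0 < e ->
     exists N, forall n, (N <= n)%N -> nr (u n - l) <= e.
Proof.
move=> hu; have : cauchy (u @ \oo).
  apply/cauchy_exP => e e0.
  have eE : e = (re e)%:C.
    by apply: ceqP; rewrite ?cE // (ge0_im (ltW e0)).
  have re0 : 0 < re e / 2 by rewrite divr_gt0 // -ltcR -eE.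
  have [N hN] := hu _ re0; exists (u N); exists N => // n Nn /=.
  rewrite -ball_normE /= nrE eE ltcR.
  by apply: (le_lt_trans (hN _ _ (leqnn N) Nn)); lra.
move=> /cauchy_cvg/cvg_ex[l /= ul]; exists l => e e0.
have : \forall n \near \oo, ball l (e%:C : R[i]) (u n).
  by apply: (cvg_ball ul); rewrite ltcR.
case=> N _ hN; exists N => n Nn; have := hN n Nn.
by rewrite -ball_normE /= nrE ltcR nrB => /ltW.
Qed.
End Hilbert.
(** * Bounded operators *)

Section BoundedOperators.
Variable R : realType.
Implicit Types (H K L : hilbert R).

(** The bound in [bounded_op] is a complex number, and on the zero space it may be any complex
    number; its modulus serves in every case. *)
Lemma bopP H K (A : H -> K) : bounded_op H K A <->
  linear A /\ exists2 c : R, 0 <= c & forall x, nr (A x) <= c * nr x.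
Proof.
split; last by move=> [lA [c _ hc]]; split=> //; exists c%:C => x; rewrite !nrE -rmorphM lecR hc.
move=> [lA [c hc]]; split=> //.
  exists (cn c); first exact: cn_ge0.
  move=> x; have := hc x; rewrite !nrE => h.
  have {}h : 0 <= c * (nr x)%:C - (nr (A x))%:C by rewrite subr_ge0.
  have := ge0_re h; rewrite !cE mulr0 subr0 subr_ge0 => /le_trans; apply.
  by rewrite ler_wpM2r ?nr_ge0 ?re_le_cn.
Qed.

Lemma op_addE H K (A B : H -> K) x : (A + B) x = A x + B x. Proof. by []. Qed.
Lemma op_oppE H K (A : H -> K) x : (- A) x = - A x. Proof. by []. Qed.
Lemma op_scaleE H K a (A : H -> K) x : (a *: A) x = a *: A x. Proof. by []. Qed.
Lemma op_zeroE H K x : (0 : H -> K) x = 0. Proof. by []. Qed.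
Lemma sumopE H K I (s : seq I) (P : pred I) (F : I -> H -> K) x :
  (\sum_(i <- s | P i) F i) x = \sum_(i <- s | P i) F i x.
Proof. by elim/big_rec2: _ => [//|i a b _ <-]. Qed.
Definition opE := (op_addE, op_oppE, op_scaleE, op_zeroE, sumopE).

Section OneOp.
Variables (H K : hilbert R) (A : H -> K).
Hypothesis bA : bounded_op H K A.
Lemma opD x y : A (x + y) = A x + A y.
Proof. by have [lA _] := bA; rewrite -[x]scale1r lA !scale1r. Qed.
Lemma op0 : A 0 = 0.
Proof. by have := opD 0 0; rewrite addr0 => /esym/eqP; rewrite -subr_eq0 addrK => /eqP. Qed.
Lemma opZ a x : A (a *: x) = a *: A x.
Proof. by have [lA _] := bA; rewrite -[a *: x]addr0 lA op0 addr0. Qed.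
Lemma opN x : A (- x) = - A x. Proof. by rewrite -scaleN1r opZ scaleN1r. Qed.
Lemma opB x y : A (x - y) = A x - A y. Proof. by rewrite opD opN. Qed.
Lemma op_sum I (s : seq I) P (F : I -> H) :
  A (\sum_(i <- s | P i) F i) = \sum_(i <- s | P i) A (F i).
Proof. by elim/big_rec2: _ => [|i a b _ <-]; rewrite ?op0 ?opD. Qed.
Lemma op_bound : exists2 c : R, 0 < c & forall x, nr (A x) <= c * nr x.
Proof.
have /bopP[_ [c c0 hc]] := bA; exists (c + 1); first lra.
by move=> x; apply: (le_trans (hc x)); rewrite ler_wpM2r ?nr_ge0 // lerDl.
Qed.
End OneOp.

Lemma bop_lim H K (A : H -> K) (B : nat -> H -> K) :
  (forall n, bounded_op H K (B n)) ->
  (forall e : R, 0 < e -> exists n, forall x, nr (A x - B n x) <= e * nr x) ->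
  bounded_op H K A.
Proof.
move=> bB h; apply/bopP; split.
  move=> a x y; apply/eqP; rewrite -subr_eq0; apply/eqP/nr_eq0/eqP.
  rewrite -normr_le0; apply/ler_addgt0Pr => e e0; rewrite add0r ger0_norm ?nr_ge0 //.
  set M := nr (a *: x + y) + cn a * nr x + nr y + 1.
  have M0 : 0 < M.
    have := cn_ge0 a; have := nr_ge0 x; have := nr_ge0 y.
    by have := nr_ge0 (a *: x + y); rewrite /M; nra.
  have [n hn] := h (e / M) (divr_gt0 e0 M0).
  apply: (le_trans (nr_tri (B n (a *: x + y)) _ _)).
  have -> : B n (a *: x + y) - (a *: A x + A y) = a *: (B n x - A x) + (B n y - A y).
    by rewrite (opD (bB n)) (opZ (bB n)) scalerBr opprD addrACA.
  apply: (le_trans (lerD (hn _) (nrD _ _))); rewrite nrZ (nrB (B n x)) (nrB (B n y)).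
  have e5 := hn y.
  have e1 := hn (a *: x + y).
  have e2 : cn a * nr (A x - B n x) <= cn a * (e / M * nr x).
    by rewrite ler_wpM2l ?cn_ge0.
  have e3 : e / M * M = e by rewrite divfK ?gt_eqF.
  have e4 : 0 < e / M by rewrite divr_gt0.
  by rewrite {1 2}/M in e3; nra.
have [n hn] := h 1 ltr01; have [c c0 hc] := op_bound (bB n).
exists (c + 1); first lra.
move=> x; have := le_trans (nr_tri 0 (A x) 0) (lerD (lexx _) (lexx _)).
rewrite !subr0 nr0 addr0 => _.
have := nrD (A x - B n x) (B n x); rewrite subrK; have := hn x; have := hc x.
lra.
Qed.

Lemma bop0 H K : bounded_op H K (0 : H -> K).
Proof.
apply/bopP; split=> [a x y|]; first by rewrite !opE scaler0 addr0.
by exists 0 => // x; rewrite !opE nr0 mul0r.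
Qed.
Lemma bop_id H : bounded_op H H idfun.
Proof. by apply/bopP; split=> //; exists 1 => // x; rewrite mul1r. Qed.
Lemma bopD H K (A B : H -> K) :
  bounded_op H K A -> bounded_op H K B -> bounded_op H K (A + B).
Proof.
move=> bA bB; apply/bopP; split=> [a x y|].
  by rewrite !opE (opD bA) (opD bB) (opZ bA) (opZ bB) scalerDr addrACA.
have [c c0 hc] := op_bound bA; have [d d0 hd] := op_bound bB.
exists (c + d); first lra.
by move=> x; rewrite opE mulrDl (le_trans (nrD _ _)) // lerD.
Qed.
Lemma bopZ H K (a : R[i]) (A : H -> K) :
  bounded_op H K A -> bounded_op H K (a *: A).
Proof.
move=> bA; apply/bopP; split=> [b x y|].
  by rewrite /= !opE (opD bA) (opZ bA) scalerDr !scalerA mulrC.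
have [c c0 hc] := op_bound bA; exists (cn a * c); first by rewrite mulr_ge0 ?cn_ge0 ?ltW.
by move=> x; rewrite opE nrZ -mulrA ler_wpM2l ?cn_ge0 ?hc.
Qed.
Lemma bopN H K (A : H -> K) : bounded_op H K A -> bounded_op H K (- A).
Proof. by rewrite -scaleN1r; exact: bopZ. Qed.
Lemma bopB H K (A B : H -> K) :
  bounded_op H K A -> bounded_op H K B -> bounded_op H K (A - B).
Proof. by move=> bA bB; apply: bopD => //; exact: bopN. Qed.
Lemma bop_comp H K L (A : K -> L) (B : H -> K) :
  bounded_op K L A -> bounded_op H K B -> bounded_op H L (A \o B).
Proof.
move=> bA bB; apply/bopP; split=> [a x y|]; first by rewrite /= (opD bB) (opZ bB) (opD bA) (opZ bA).
have [c c0 hc] := op_bound bA; have [d d0 hd] := op_bound bB.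
exists (c * d); first by rewrite mulr_ge0 ?ltW.
by move=> x /=; apply: (le_trans (hc _)); rewrite -mulrA ler_wpM2l ?hd ?ltW.
Qed.
Lemma bop_sum H K I (s : seq I) (P : pred I) (F : I -> H -> K) :
  (forall i, P i -> bounded_op H K (F i)) ->
  bounded_op H K (\sum_(i <- s | P i) F i).
Proof.
by move=> h; apply: (big_ind (bounded_op H K)) => //; [exact: bop0|exact: bopD].
Qed.

Lemma op_ext H K (A B : H -> K) :
  (forall x y, hdot K (A x) y = hdot K (B x) y) -> A = B.
Proof. by move=> h; apply/funext => x; apply: dot_inj => y. Qed.

Lemma small_invS (e : R) : 0 < e ->
  exists N, forall n, (N <= n)%N -> n.+1%:R^-1 <= e.
Proof.
move=> e0; have [N _ hN] := near_infty_natSinv_lt (PosNum e0).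
by exists N => n Nn; apply: ltW; exact: hN.
Qed.

(** A vector [l] of least norm on the affine hyperplane g = 1 is orthogonal to the kernel of g, and
    every x differs from g(x) l by an element of that kernel. *)
Lemma riesz H (g : H -> R[i]) (c : R) :
  (forall a x y, g (a *: x + y) = a * g x + g y) ->
  (forall x, cn (g x) <= c * nr x) ->
  exists y, forall x, g x = hdot H x y.
Proof.
move=> lg bg.
have g0 : g 0 = 0.
  by apply: cn_eq0; apply/eqP; rewrite eq_le cn_ge0 andbT (le_trans (bg _)) // nr0 mulr0.
have gZ a x : g (a *: x) = a * g x by rewrite -[a *: x]addr0 lg g0 addr0.
have gD x y : g (x + y) = g x + g y by rewrite -[x]scale1r lg scale1r mul1r.
have gB x y : g (x - y) = g x - g y by rewrite gD -scaleN1r gZ mulN1r.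
have [[x0 gx0]|allg0] := pselect (exists x0, g x0 != 0); last first.
  exists 0 => x; rewrite dot0r; apply: contrapT => gx.
  by apply: allg0; exists x; apply/eqP.
set S := [set nr x | x in [set x | g x = 1]].
have S0 : S !=set0.
  by exists (nr ((g x0)^-1 *: x0)), ((g x0)^-1 *: x0) => //=; rewrite gZ mulVf.
have lbS : has_inf S by split=> //; exists 0 => _ [x _ <-]; exact: nr_ge0.
set d := inf S.
have dle x : g x = 1 -> d <= nr x.
  by move=> gx; apply: ge_inf; [case: lbS|exists x].
have d0 : 0 <= d by apply: lb_le_inf => // _ [x _ <-]; exact: nr_ge0.
have /choice[u hu] : forall n : nat, exists x, g x = 1 /\ nr x <= d + n.+1%:R^-1.
  move=> n; have n0 : (0 : R) < n.+1%:R^-1 by rewrite invr_gt0.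
  have [_ [x gx <-] hx] := inf_adherent n0 lbS.
  by exists x; split=> //; exact: ltW.
have cauu e : 0 < e -> exists N, forall m n, (N <= m)%N -> (N <= n)%N -> nr (u m - u n) <= e.
  (* The parallelogram law gives |u_m - u_n|^2 <= 4 (d + eta)^2 - 4 d^2, which is at most eta (8 d +
     4) once eta <= 1. *)
  move=> e0; set eta := Num.min 1 (e ^+ 2 / (8 * d + 4)).
  have den : 0 < 8 * d + 4 by lra.
  have eta0 : 0 < eta by rewrite lt_min ltr01 divr_gt0 // exprn_gt0.
  have eta1 : eta <= 1 by rewrite ge_min lexx.
  have eta2 : eta * (8 * d + 4) <= e ^+ 2 by rewrite -ler_pdivlMr // ge_min lexx orbT.
  have [N hN] := small_invS eta0.
  have small n : (N <= n)%N -> nr (u n) <= d + eta.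
    by move=> Nn; apply: (le_trans (hu n).2); rewrite lerD2l hN.
  exists N => m n /small hm /small hn.
  rewrite -(@ler_pXn2r _ 2) ?nnegrE ?nr_ge0 ?(ltW e0) //.
  have h2 := parallelogram (u m) (u n).
  have h1 : d + d <= nr (u m + u n).
    have : d <= nr ((2^-1 : R)%:C *: (u m + u n)).
      apply: dle; rewrite gZ gD (hu m).1 (hu n).1.
      by apply: ceqP; rewrite !cE; field.
    by rewrite nrZ cn_real ger0_norm ?invr_ge0 //; lra.
  have h3 : (d + d) ^+ 2 <= nr (u m + u n) ^+ 2.
    by rewrite ler_pXn2r ?nnegrE ?nr_ge0 ?addr_ge0.
  have h4 : nr (u m) ^+ 2 <= (d + eta) ^+ 2.
    by rewrite ler_pXn2r ?nnegrE ?nr_ge0 // addr_ge0 // ltW.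
  have h5 : nr (u n) ^+ 2 <= (d + eta) ^+ 2.
    by rewrite ler_pXn2r ?nnegrE ?nr_ge0 // addr_ge0 // ltW.
  have h6 : eta ^+ 2 <= eta by rewrite expr2 ler_piMl // ltW.
  move: h2 h3 h4 h5 h6 eta2; rewrite !(mulr2n, expr2).
  by clear; move: (nr (u m + u n)) (nr (u m - u n)) (nr (u m)) (nr (u n)) => *; lra.
have [l hl] := hilbert_cauchy cauu.
have gl : g l = 1.
  apply/eqP; rewrite -subr_eq0; apply/eqP/cn_eq0/eqP.
  rewrite -normr_le0; apply/ler_addgt0Pr => e e0; rewrite add0r ger0_norm ?cn_ge0 //.
  have c1 : 0 < `|c| + 1 by rewrite ltr_wpDl.
  have [N hN] := hl (e / (`|c| + 1)) (divr_gt0 e0 c1).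
  rewrite -(hu N).1 -gB; apply: (le_trans (bg _)); rewrite nrB.
  have := hN N (leqnn N); rewrite ler_pdivlMr // => {}hN.
  apply: le_trans hN; rewrite mulrC ler_wpM2l ?nr_ge0 //.
  by rewrite (le_trans (ler_norm _)) // lerDl.
have nl : nr l <= d.
  apply/ler_addgt0Pr => e e0; have e2 : 0 < e / 2 by lra.
  have [N hN] := hl _ e2.
  have [M hM] := small_invS e2.
  set n := maxn N M; have := hN n (leq_maxl _ _); have := (hu n).2.
  have := hM n (leq_maxr _ _).
  have := nrD (l - u n) (u n); rewrite subrK nrB.
  by move: (n.+1%:R^-1 : R) => k; lra.
(* Minimality of |l| along l + s z for all complex s is a discriminant condition with vanishing
   constant term. *)
have orth z : g z = 0 -> hdot H z l = 0.
  move=> gz; apply: cn_eq0; apply/eqP; rewrite -sqrf_eq0 -normr_le0 ger0_norm ?sqr_ge0 //.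
  rewrite -(mul0r (nr z ^+ 2)); apply: discriminant; first exact: sqr_ge0.
  move=> s; have : d <= nr (s *: z + l) by apply: dle; rewrite lg gz mulr0 add0r.
  move=> h; have : nr l ^+ 2 <= nr (s *: z + l) ^+ 2.
    by rewrite ler_pXn2r ?nnegrE ?nr_ge0 // (le_trans nl).
  by rewrite nr_sqD dotZl nrZ exprMn; lra.
have l0 : nr l != 0.
  by apply/eqP => /nr_eq0 E; move: gl; rewrite E g0 => /eqP; rewrite eq_sym oner_eq0.
exists ((nr l ^- 2)%:C *: l) => x.
have := orth (x - g x *: l); rewrite gB gZ gl mulr1 subrr => /(_ erefl).
rewrite dotBl dotZl dotxx => /eqP; rewrite subr_eq0 dotZr conjC_real => /eqP->.
rewrite mulrCA -rmorphM mulVf ?expf_eq0 ?mulr1 //=.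
Qed.

Lemma adjoint_ex H K (A : H -> K) : bounded_op H K A ->
  exists B : K -> H, is_adjoint A B.
Proof.
move=> bA; have [c c0 hc] := op_bound bA.
have /choice[B hB] : forall y, exists z, forall x, hdot K (A x) y = hdot H x z.
  move=> y; apply: (@riesz H _ (c * nr y)) => [a x1 x2|x].
    by rewrite (opD bA) (opZ bA) dotDl dotZl.
  apply: (le_trans (cauchy_schwarz _ _)).
  by rewrite mulrAC ler_wpM2r ?nr_ge0.
by exists B => x y; rewrite hB.
Qed.

Lemma adjoint_sym H K (A : H -> K) B : is_adjoint A B -> is_adjoint B A.
Proof. by move=> h x y; rewrite dotC -h -dotC. Qed.

Lemma adjoint_uniq H K (A : H -> K) B C : is_adjoint A B -> is_adjoint A C -> B = C.
Proof.
move=> h1 h2; apply/funext => y; apply: dot_inj => z.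
by rewrite dotC -h1 h2 -dotC.
Qed.

Lemma adjoint_bop H K (A : H -> K) B :
  bounded_op H K A -> is_adjoint A B -> bounded_op K H B.
Proof.
move=> bA AB; have [c c0 hc] := op_bound bA; apply/bopP; split=> [a x y|].
  apply: dot_inj => z; rewrite dotDl dotZl.
  by rewrite !(adjoint_sym AB) dotDl dotZl.
exists c; first exact: ltW.
move=> y; have [->|/eqP n0] := eqVneq (nr (B y)) 0; first by rewrite mulr_ge0 ?nr_ge0 ?ltW.
have n1 : 0 < nr (B y) by rewrite lt_def nr_ge0 andbT; apply/eqP.
rewrite -(ler_pM2r n1) -expr2.
have -> : nr (B y) ^+ 2 = re (hdot H (B y) (B y)) by rewrite dotxx reC.
rewrite (adjoint_sym AB); apply: (le_trans (re_le_cn _)).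
apply: (le_trans (cauchy_schwarz _ _)).
by have := hc (B y); have := nr_ge0 y; nra.
Qed.

(** The adjoint is made total by choice, so that it can be written in formulas; it is meaningful for
    bounded operators, which have exactly one. *)
Definition adj H K (A : H -> K) : K -> H := xget 0 [set B | is_adjoint A B].

Lemma adjP H K (A : H -> K) : bounded_op H K A -> is_adjoint A (adj A).
Proof. by move=> /adjoint_ex[B AB]; exact: (xgetI 0 AB). Qed.
Lemma adj_bop H K (A : H -> K) : bounded_op H K A -> bounded_op K H (adj A).
Proof. by move=> bA; apply: (adjoint_bop bA); exact: adjP. Qed.
Lemma adjE H K (A : H -> K) B : bounded_op H K A -> is_adjoint A B -> adj A = B.
Proof. by move=> /adjP h1 h2; exact: adjoint_uniq h1 h2. Qed.
Lemma adjK H K (A : H -> K) : bounded_op H K A -> adj (adj A) = A.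
Proof. by move=> bA; apply: adjE; [exact: adj_bop|exact/adjoint_sym/adjP]. Qed.
Lemma dot_adjr H K (A : H -> K) : bounded_op H K A ->
  forall x y, hdot H x (adj A y) = hdot K (A x) y.
Proof. by move=> /adjP h x y; rewrite h. Qed.
Lemma dot_adjl H K (A : H -> K) : bounded_op H K A ->
  forall x y, hdot H (adj A y) x = hdot K y (A x).
Proof. by move=> bA x y; rewrite dotC dot_adjr // -dotC. Qed.

Lemma is_adjoint_comp H K L (A : K -> L) (B : H -> K) A' B' :
  is_adjoint A A' -> is_adjoint B B' -> is_adjoint (A \o B) (B' \o A').
Proof. by move=> hA hB x y /=; rewrite hA hB. Qed.
Lemma is_adjoint_lin H K (a : R[i]) (A B : H -> K) A' B' :
  is_adjoint A A' -> is_adjoint B B' ->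
  is_adjoint (a *: A + B) (Num.conj a *: A' + B').
Proof.
move=> hA hB x y; rewrite !opE dotDl dotDr dotZl dotZr hA hB.
by rewrite conjCK.
Qed.
Lemma is_adjointD H K (A B : H -> K) A' B' :
  is_adjoint A A' -> is_adjoint B B' -> is_adjoint (A + B) (A' + B').
Proof. by move=> hA hB x y; rewrite !opE dotDl dotDr hA hB. Qed.
Lemma is_adjointN H K (A : H -> K) A' : is_adjoint A A' -> is_adjoint (- A) (- A').
Proof. by move=> hA x y; rewrite !opE dotNl dotNr hA. Qed.
Lemma is_adjointB H K (A B : H -> K) A' B' :
  is_adjoint A A' -> is_adjoint B B' -> is_adjoint (A - B) (A' - B').
Proof. by move=> hA hB; apply: is_adjointD => //; exact: is_adjointN. Qed.
Lemma is_adjointZ H K (a : R[i]) (A : H -> K) A' :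
  is_adjoint A A' -> is_adjoint (a *: A) (Num.conj a *: A').
Proof. by move=> hA x y; rewrite !opE dotZl dotZr hA conjCK. Qed.
Lemma is_adjoint_id H : is_adjoint (idfun : H -> H) idfun.
Proof. by []. Qed.
Lemma is_adjoint0 H K : is_adjoint (0 : H -> K) 0.
Proof. by move=> x y; rewrite !opE dot0l dot0r. Qed.
End BoundedOperators.

(** * Norm closures of sets of operators and Neumann series *)

Section OperatorClosure.
Variable R : realType.
Implicit Types (H K L : hilbert R).

Lemma opclosureP H K (S : set (H -> K)) T : opclosure S T <->
  bounded_op H K T /\ forall e : R, 0 < e ->
    exists2 A, S A & forall x, nr (T x - A x) <= e * nr x.
Proof.
split=> -[bT h]; split=> // e e0.
  have e0' : 0 < (e%:C : R[i]) by rewrite ltcR.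
  have [A SA hA] := h _ e0'; exists A => // x; have := hA x.
  by rewrite !nrE -rmorphM lecR.
have eE : e = (re e)%:C by apply: ceqP; rewrite ?cE // (ge0_im (ltW e0)).
have re0 : 0 < re e by rewrite -ltcR -eE.
have [A SA hA] := h _ re0; exists A => // x.
by rewrite eE !nrE -rmorphM lecR.
Qed.

Lemma sub_opclosure H K (S : set (H -> K)) : S `<=` bounded_op H K -> S `<=` opclosure S.
Proof.
move=> hS A SA; apply/opclosureP; split; first exact: hS.
by move=> e e0; exists A => // x; rewrite subrr nr0 mulr_ge0 ?nr_ge0 ?ltW.
Qed.

Lemma opclosure_bop H K (S : set (H -> K)) : opclosure S `<=` bounded_op H K.
Proof. by move=> A []. Qed.

Lemma opclosureS H K (S S' : set (H -> K)) : S `<=` S' -> opclosure S `<=` opclosure S'.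
Proof.
move=> SS' A /opclosureP[bA h]; apply/opclosureP; split=> // e /h[B SB hB].
by exists B => //; exact: SS'.
Qed.

Lemma opclosureK H K (S : set (H -> K)) : opclosure (opclosure S) `<=` opclosure S.
Proof.
move=> A /opclosureP[bA h]; apply/opclosureP; split=> // e e0.
have e2 : 0 < e / 2 by lra.
have [B /opclosureP[_ hB] AB] := h _ e2; have [C SC BC] := hB _ e2.
exists C => // x; apply: (le_trans (nr_tri (B x) _ _)).
by apply: (le_trans (lerD (AB x) (BC x))); rewrite -mulrDl -splitr.
Qed.

Lemma opclosure_idem H K (S : set (H -> K)) : opclosure (opclosure S) = opclosure S.
Proof.
apply/seteqP; split; first exact: opclosureK.
by apply: sub_opclosure; exact: opclosure_bop.
Qed.

Lemma subspace0 H K (S : set (H -> K)) : @Defs.subspace _ (H -> K) S -> S 0.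
Proof. by case. Qed.
Lemma subspaceD H K (S : set (H -> K)) : @Defs.subspace _ (H -> K) S ->
  forall A B, S A -> S B -> S (A + B).
Proof. by move=> [_ h] A B SA SB; rewrite -[A]scale1r; exact: h. Qed.
Lemma subspaceZ H K (S : set (H -> K)) : @Defs.subspace _ (H -> K) S ->
  forall a A, S A -> S (a *: A).
Proof. by move=> [S0 h] a A SA; rewrite -[_ *: _]addr0; exact: h. Qed.
Lemma subspaceN H K (S : set (H -> K)) : @Defs.subspace _ (H -> K) S ->
  forall A, S A -> S (- A).
Proof. by move=> h A SA; rewrite -scaleN1r; exact: subspaceZ. Qed.
Lemma subspaceB H K (S : set (H -> K)) : @Defs.subspace _ (H -> K) S ->
  forall A B, S A -> S B -> S (A - B).
Proof. by move=> h A B SA SB; apply: subspaceD => //; exact: subspaceN. Qed.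
Lemma subspace_sum H K (S : set (H -> K)) : @Defs.subspace _ (H -> K) S ->
  forall I (s : seq I) (P : pred I) F, (forall i, P i -> S (F i)) ->
  S (\sum_(i <- s | P i) F i).
Proof.
move=> h I s P F hF; apply: (big_ind S) => //; first exact: subspace0.
exact: subspaceD.
Qed.

Lemma opclosure_subspace H K (S : set (H -> K)) :
  @Defs.subspace _ (H -> K) S -> @Defs.subspace _ (H -> K) (opclosure S).
Proof.
move=> sS; split.
  apply/opclosureP; split; first exact: bop0.
  move=> e e0; exists 0; first exact: subspace0.
  by move=> x; rewrite subrr nr0 mulr_ge0 ?nr_ge0 ?ltW.
move=> a A B /opclosureP[bA hA] /opclosureP[bB hB].
apply/opclosureP; split; first by apply: bopD => //; exact: bopZ.
move=> e e0; have c1 : 0 < cn a + 1 by have := cn_ge0 a; lra.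
have ed : e / (cn a + 1) * (cn a + 1) = e by rewrite divfK ?gt_eqF.
have d0 := divr_gt0 e0 c1; move: (e / _) d0 ed => d d0 ed.
have [A' SA' hA'] := hA d d0; have [B' SB' hB'] := hB d d0.
exists (a *: A' + B'); first exact: sS.2.
move=> x; rewrite !opE opprD addrACA -scalerBr.
apply: (le_trans (nrD _ _)); rewrite nrZ.
have h1 : cn a * nr (A x - A' x) <= cn a * (d * nr x) by rewrite ler_wpM2l ?cn_ge0.
apply: (le_trans (lerD h1 (hB' x))); rewrite -ed.
by rewrite mulrA [cn a * d]mulrC -mulrDl mulrDr mulr1.
Qed.

Lemma opclosure_compl H K L (C : K -> L) (S : set (H -> K)) (S' : set (H -> L)) :
  bounded_op K L C -> (forall A, S A -> opclosure S' (C \o A)) ->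
  forall A, opclosure S A -> opclosure S' (C \o A).
Proof.
move=> bC h A /opclosureP[bA hA]; apply: opclosureK; apply/opclosureP.
split; first exact: bop_comp.
have [c c0 hc] := op_bound bC.
move=> e e0; have [B SB hB] := hA _ (divr_gt0 e0 c0).
exists (C \o B); first exact: h.
move=> x /=; rewrite -(opB bC); apply: (le_trans (hc _)).
apply: (le_trans (ler_wpM2l (ltW c0) (hB x))).
by rewrite mulrA mulrCA divff ?gt_eqF ?mulr1.
Qed.

Lemma opclosure_compr H K L (C : H -> K) (S : set (K -> L)) (S' : set (H -> L)) :
  bounded_op H K C -> (forall A, S A -> opclosure S' (A \o C)) ->
  forall A, opclosure S A -> opclosure S' (A \o C).
Proof.
move=> bC h A /opclosureP[bA hA]; apply: opclosureK; apply/opclosureP.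
split; first exact: bop_comp.
have [c c0 hc] := op_bound bC.
move=> e e0; have [B SB hB] := hA _ (divr_gt0 e0 c0).
exists (B \o C); first exact: h.
move=> x /=; apply: (le_trans (hB _)).
apply: (le_trans (ler_wpM2l _ (hc x))); first by rewrite divr_ge0 ?ltW.
by rewrite mulrA divfK ?gt_eqF.
Qed.

(** Passing to adjoints does not increase the operator norm: with z = (A - B)^* y, |z|^2 = <y, (A -
    B) z>. *)
Lemma opclosure_adj H K (S : set (H -> K)) (S' : set (K -> H)) :
  S `<=` bounded_op H K ->
  (forall A, S A -> opclosure S' (adj A)) ->
  forall A, opclosure S A -> opclosure S' (adj A).
Proof.
move=> bS h A /opclosureP[bA hA]; apply: opclosureK; apply/opclosureP.
split; first exact: adj_bop.
move=> e e0; have [B SB hB] := hA _ e0; exists (adj B); first exact: h.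
move=> y; have bB := bS _ SB; have bD := bopB bA bB.
have -> : adj A y - adj B y = adj (A - B) y.
  rewrite (@adjE _ _ _ (A - B) (adj A - adj B)) //.
  by apply: is_adjointB; exact: adjP.
set z := adj (A - B) y.
have [->|/eqP n0] := eqVneq (nr z) 0; first by rewrite mulr_ge0 ?nr_ge0 ?ltW.
have n1 : 0 < nr z by rewrite lt_def nr_ge0 andbT; apply/eqP.
rewrite -(ler_pM2r n1) -expr2.
have -> : nr z ^+ 2 = re (hdot H z z) by rewrite dotxx reC.
rewrite {1}/z dot_adjl //; apply: (le_trans (re_le_cn _)).
apply: (le_trans (cauchy_schwarz _ _)); rewrite mulrAC mulrC.
by rewrite ler_wpM2r ?nr_ge0 // opE; exact: hB.
Qed.

Definition opclosed H K (S : set (H -> K)) := opclosure S `<=` S.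

Lemma op_cauchy H K (B : nat -> H -> K) :
  (forall n, bounded_op H K (B n)) ->
  (forall e : R, 0 < e -> exists N, forall m n, (N <= m)%N -> (N <= n)%N ->
     forall x, nr (B m x - B n x) <= e * nr x) ->
  exists2 A, bounded_op H K A & forall e : R, 0 < e -> exists N, forall n, (N <= n)%N ->
     forall x, nr (B n x - A x) <= e * nr x.
Proof.
move=> bB cB.
have /choice[A hA] : forall x, exists l, forall e : R, 0 < e ->
    exists N, forall n, (N <= n)%N -> nr (B n x - l) <= e.
  move=> x; apply: hilbert_cauchy => e e0.
  have x1 : 0 < nr x + 1 by have := nr_ge0 x; lra.
  have [N hN] := cB _ (divr_gt0 e0 x1); exists N => m n Nm Nn.
  apply: (le_trans (hN _ _ Nm Nn x)); rewrite mulrAC ler_pdivrMr //.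
  by rewrite ler_wpM2l ?(ltW e0) // lerDl.
have key (e : R) : 0 < e -> exists N, forall n, (N <= n)%N ->
    forall x, nr (B n x - A x) <= e * nr x.
  move=> e0; have [N hN] := cB _ e0; exists N => n Nn x.
  apply/ler_addgt0Pr => d d0; have [M hM] := hA x _ d0.
  set m := maxn N M; apply: (le_trans (nr_tri (B m x) _ _)).
  by rewrite lerD ?hN ?hM ?leq_maxl ?leq_maxr.
exists A => //; apply: (bop_lim bB) => e /key[N hN]; exists N => x.
by rewrite nrB hN.
Qed.

Lemma expr_small (q e : R) : 0 <= q -> q < 1 -> 0 < e ->
  exists N, forall n, (N <= n)%N -> q ^+ n <= e.
Proof.
move=> q0 q1 e0; have hq : `|q| < 1 by rewrite ger0_norm.
have /cvgrPdist_le/(_ e e0)[N _ hN] := cvg_expr hq.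
exists N => n Nn; have := hN n Nn; rewrite sub0r normrN ger0_norm //.
exact: exprn_ge0.
Qed.

Section Neumann.
Variables (H : hilbert R) (c : H -> H) (q : R).
Hypotheses (bc : bounded_op H H c) (q0 : 0 <= q) (q1 : q < 1).
Hypothesis cq : forall x, nr (c x) <= q * nr x.

Let g n : H -> H := iter n (fun a => idfun + (c \o a)) 0.
Let cpow n : H -> H := iter n (fun a => c \o a) idfun.

Let bg n : bounded_op H H (g n).
Proof.
elim: n => [|n ih]; first exact: bop0.
by rewrite /g iterS; apply: (bopD (@bop_id _ H)); exact: bop_comp.
Qed.
Let cpow_le n x : nr (cpow n x) <= q ^+ n * nr x.
Proof.
elim: n => [|n ih]; first by rewrite expr0 mul1r.
by rewrite /=; apply: (le_trans (cq _)); rewrite exprS -mulrA ler_wpM2l.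
Qed.
Let gS n x : g n.+1 x = x + c (g n x). Proof. by []. Qed.
Let gdiff n x : g n.+1 x - g n x = cpow n x.
Proof.
elim: n => [|n ih]; first by rewrite gS /= opE subr0 (op0 bc) addr0.
by rewrite gS (gS n) opprD addrACA subrr add0r -(opB bc) ih.
Qed.
Let gdist n k x : nr (g (n + k) x - g n x) <= q ^+ n / (1 - q) * nr x.
Proof.
have q2 : 0 < 1 - q by rewrite subr_gt0.
suff h : nr (g (n + k) x - g n x) <= q ^+ n * ((1 - q ^+ k) / (1 - q)) * nr x.
  apply: (le_trans h); rewrite ler_wpM2r ?nr_ge0 // ler_wpM2l ?exprn_ge0 //.
  by rewrite ler_pdivrMr // mulVf ?gt_eqF // gerBl exprn_ge0.
elim: k => [|k ih]; first by rewrite addn0 subrr nr0 expr0 subrr mul0r mulr0 mul0r.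
rewrite addnS; apply: (le_trans (nr_tri (g (n + k) x) _ _)).
rewrite gdiff; apply: (le_trans (lerD (cpow_le _ _) ih)).
rewrite -mulrDl ler_wpM2r ?nr_ge0 // exprD -mulrDr ler_wpM2l ?exprn_ge0 //.
rewrite -(ler_pM2r q2) mulrDl !divfK ?gt_eqF // exprS.
by move: (q ^+ k) => t; lra.
Qed.

(** The partial sums satisfy g_(n+1) = 1 + c g_n. A closed set [W] stable under this one operation
    contains the whole series, so the inverse is located in spaces such as the multipliers of T
    without further argument. *)
Lemma neumann (W : set (H -> H)) :
  W 0 -> (forall a, W a -> W (idfun + (c \o a))) -> opclosed W ->
  exists g : H -> H, [/\ bounded_op H H g, W g, forall x, g x - c (g x) = x &
    forall x, g (x - c x) = x].
Proof.
move=> W0 Wc Wcl; have q2 : 0 < 1 - q by rewrite subr_gt0.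
have [|A bA hA] := @op_cauchy H H g bg.
  move=> e e0; have e1 : 0 < e * (1 - q) by rewrite mulr_gt0.
  have [N hN] := expr_small q0 q1 e1; exists N.
  have key m n : (N <= n)%N -> (n <= m)%N -> forall x, nr (g m x - g n x) <= e * nr x.
    move=> Nn nm x; rewrite -(subnKC nm); apply: (le_trans (gdist _ _ _)).
    by rewrite ler_wpM2r ?nr_ge0 // ler_pdivrMr // hN.
  move=> m n Nm Nn x; have [mn|/ltnW nm] := leqP m n; last exact: key.
  by rewrite nrB key.
have Wg n : W (g n) by elim: n => [//|n ih]; exact: Wc.
exists A; split=> //.
- apply: Wcl; apply/opclosureP; split=> // e /hA[N hN].
  by exists (g N) => // x; rewrite nrB hN.
- move=> x; apply/eqP; rewrite -subr_eq0; apply/eqP/nr_eq0/eqP.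
  rewrite -normr_le0; apply/ler_addgt0Pr => e e0; rewrite add0r ger0_norm ?nr_ge0 //.
  have x1 : 0 < 2 * nr x + 1 by have := nr_ge0 x; lra.
  have ed : e / (2 * nr x + 1) * (2 * nr x + 1) = e by rewrite divfK ?gt_eqF.
  have d0 := divr_gt0 e0 x1; move: (e / _) d0 ed => d d0 ed.
  have [N hN] := hA _ d0.
  have h1 := hN _ (leqnSn N) x; have h2 := hN _ (leqnn N) x.
  have -> : A x - c (A x) - x = (A x - g N.+1 x) + c (g N x - A x).
    by rewrite gS (opB bc) opprD !addrA subrK addrAC.
  apply: (le_trans (nrD _ _)); rewrite nrB.
  apply: (le_trans (lerD h1 (cq _))).
  have : q * nr (g N x - A x) <= nr (g N x - A x) by rewrite ler_piMl ?nr_ge0 ?ltW.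
  have h3 := nr_ge0 x; lra.
- move=> x.
  have gc n y : g n (y - c y) = y - cpow n y.
    elim: n => [|n ih]; first by rewrite /= opE subrr.
    by rewrite gS ih (opB bc) addrA subrK.
  apply/eqP; rewrite -subr_eq0; apply/eqP/nr_eq0/eqP.
  rewrite -normr_le0; apply/ler_addgt0Pr => e e0; rewrite add0r ger0_norm ?nr_ge0 //.
  set y := x - c x; have y1 : 0 < nr y + nr x + 1 by have := nr_ge0 x; have := nr_ge0 y; lra.
  have ed : e / (nr y + nr x + 1) * (nr y + nr x + 1) = e by rewrite divfK ?gt_eqF.
  have e1 := divr_gt0 e0 y1; move: (e / _) e1 ed => d e1 ed.
  have [N hN] := hA _ e1; have [M hM] := expr_small q0 q1 e1.
  set n := maxn N M; have h1 := hN n (leq_maxl _ _) y.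
  have h2 := le_trans (cpow_le n x) (ler_wpM2r (nr_ge0 x) (hM n (leq_maxr _ _))).
  apply: (le_trans (nr_tri (g n y) _ _)); rewrite nrB.
  have -> : g n y - x = - cpow n x by rewrite /y gc addrAC subrr add0r.
  rewrite nrN.
  apply: (le_trans (lerD h1 h2)).
  lra.
Qed.
End Neumann.
End OperatorClosure.
(** * Positive operator matrices *)

Section Positivity.
Variable R : realType.
Implicit Types (H K L : hilbert R).

Definition posop H (A : H -> H) := forall x, 0 <= hdot H (A x) x.

(** At [I = 'I_n] this is the positive cone of [opspace]; other finite index types are needed for
    matrices indexed by pairs or by positions in lists. *)
Definition mpos H (I : finType) (A : I -> I -> H -> H) :=
  forall xi : I -> H, 0 <= \sum_i \sum_j hdot H (A i j (xi j)) (xi i).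

(** Polarisation: reality at x + y compares the imaginary parts of <A x, y> and <x, A y>, and
    replacing x by i x compares the real parts. *)
Lemma real_form_adjoint H (A : H -> H) : bounded_op H H A ->
  (forall x, im (hdot H (A x) x) = 0) -> is_adjoint A A.
Proof.
move=> bA h.
have imE x y : im (hdot H (A x) y) = im (hdot H x (A y)).
  have := h (x + y); rewrite (opD bA) dotDl !dotDr !imD !h add0r addr0.
  by rewrite (dotC (A y)) imJ => /eqP; rewrite subr_eq0 => /eqP.
move=> x y; apply: ceqP; last exact: imE.
by have := imE ('i%C *: x) y; rewrite (opZ bA) !dotZl !imM !cE !mul0r !mul1r !add0r.
Qed.

Lemma posop_sa H (A : H -> H) : bounded_op H H A -> posop A -> is_adjoint A A.
Proof. by move=> bA pA; apply: real_form_adjoint => // x; exact: ge0_im. Qed.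

Lemma sa_real H (A : H -> H) : is_adjoint A A -> forall x, im (hdot H (A x) x) = 0.
Proof.
move=> sA x; have := dotC (A x) x; rewrite sA => /(congr1 (@im R)); rewrite imJ.
by rewrite -/(im _); lra.
Qed.

Lemma sa_posP H (A : H -> H) : is_adjoint A A ->
  posop A <-> forall x, 0 <= re (hdot H (A x) x).
Proof.
move=> sA; split=> [h x|h x]; first exact: ge0_re.
by apply/ge0cP; rewrite sa_real.
Qed.

Lemma posop_cs H (A : H -> H) x y : bounded_op H H A -> posop A ->
  cn (hdot H (A x) y) ^+ 2 <= re (hdot H (A x) x) * re (hdot H (A y) y).
Proof.
move=> bA pA; have sA := posop_sa bA pA; rewrite mulrC.
apply: discriminant; first exact/ge0_re/pA.
move=> s; have := ge0_re (pA (s *: x + y)).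
rewrite (opD bA) (opZ bA) !dotDl !dotDr !dotZl !dotZr (sA y x) (dotC y (A x)).
rewrite !cE cn_sq => h; apply: (le_trans h).
by rewrite (ge0_im (pA x)); lra.
Qed.

(** Cauchy-Schwarz for the form of A at the pair (x, A x) gives |A x|^4 <= q |x|^2 q |A x|^2. *)
Lemma posop_norm H (A : H -> H) (q : R) : bounded_op H H A -> posop A -> 0 <= q ->
  (forall x, re (hdot H (A x) x) <= q * nr x ^+ 2) -> forall x, nr (A x) <= q * nr x.
Proof.
move=> bA pA q0 h x; have cs := posop_cs x (A x) bA pA.
have [->|/eqP n0] := eqVneq (nr (A x)) 0; first by rewrite mulr_ge0 ?nr_ge0.
have n1 : 0 < nr (A x) by rewrite lt_def nr_ge0 andbT; apply/eqP.
rewrite -(@ler_pXn2r _ 2) ?nnegrE ?nr_ge0 ?mulr_ge0 ?nr_ge0 //.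
rewrite -(ler_pM2l (exprn_gt0 2 n1)).
move: cs; rewrite dotxx cn_real ger0_norm ?sqr_ge0 // => cs.
have := h x; have := h (A x); have := ge0_re (pA x); have := ge0_re (pA (A x)).
rewrite exprMn => a1 a2 a3 a4.
rewrite -expr2; apply: (le_trans cs); apply: (le_trans (ler_pM a2 a1 a4 a3)).
by rewrite le_eqVlt; apply/orP; left; apply/eqP; ring.
Qed.

Lemma posop_scale H (A : H -> H) (r : R) : 0 <= r -> posop A -> posop (r%:C *: A).
Proof. by move=> r0 pA x; rewrite opE dotZl mulr_ge0 ?ler0c. Qed.

Lemma posopD H (A B : H -> H) : posop A -> posop B -> posop (A + B).
Proof. by move=> pA pB x; rewrite opE dotDl addr_ge0. Qed.

(** If d <= h <= k then 1 - h/k has norm at most 1 - d/k < 1, so a Neumann series inverts h. The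
    last clause places the inverse in any closed subspace that contains 1 and is stable under left
    multiplication by h. *)
Lemma invertible_bounded_below H (h : H -> H) (d : R) :
  bounded_op H H h -> posop h -> 0 < d ->
  (forall x, d * nr x ^+ 2 <= re (hdot H (h x) x)) ->
  exists g : H -> H, [/\ bounded_op H H g, posop g, is_adjoint g g,
    (forall x, g (h x) = x) /\ (forall x, h (g x) = x) &
    forall W : set (H -> H), @Defs.subspace _ (H -> H) W -> opclosed W ->
      W idfun -> (forall a, W a -> W (h \o a)) -> W g].
Proof.
move=> bh ph d0 hd; have sh := posop_sa bh ph.
have [k0 k00 hk0] := op_bound bh.
set k := k0 + d; have kgt : 0 < k by rewrite addr_gt0.
have hk x : re (hdot H (h x) x) <= k * nr x ^+ 2.
  apply: (le_trans (re_le_cn _)); apply: (le_trans (cauchy_schwarz _ _)).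
  rewrite expr2 mulrA ler_wpM2r ?nr_ge0 // (le_trans (hk0 x)) //.
  by rewrite ler_wpM2r ?nr_ge0 // lerDl ltW.
set c := idfun - (k^-1)%:C *: h.
have bc : bounded_op H H c by apply: bopB; [exact: bop_id|exact: bopZ].
have cE' x : hdot H (c x) x = (nr x ^+ 2)%:C - (k^-1)%:C * hdot H (h x) x.
  by rewrite /c !opE dotBl dotZl -dotxx.
have cre x : re (hdot H (c x) x) = nr x ^+ 2 - re (hdot H (h x) x) / k.
  by rewrite cE' !cE mul0r subr0 [_^-1 * _]mulrC.
have pc : posop c.
  move=> x; apply/ge0cP; rewrite cre; split.
    by rewrite cE' !cE (ge0_im (ph x)) !(mulr0, mul0r, addr0, oppr0).
  by rewrite subr_ge0 ler_pdivrMr // mulrC.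
set q := 1 - d / k.
have q1 : q < 1 by rewrite gtrBl divr_gt0.
have q0 : 0 <= q by rewrite subr_ge0 ler_pdivrMr // mul1r lerDr ltW.
have cq : forall x, nr (c x) <= q * nr x.
  apply: posop_norm => // x; rewrite cre mulrBl mul1r lerD2l lerN2 mulrAC.
  by rewrite ler_wpM2r // invr_ge0 ltW.
have ex W : @Defs.subspace _ (H -> H) W -> opclosed W -> W idfun ->
    (forall a, W a -> W (h \o a)) -> W 0 /\ (forall a, W a -> W (idfun + (c \o a))).
  move=> sW clW W1 Wh; split; first exact: subspace0.
  move=> a Wa; apply: (subspaceD sW) => //.
  have -> : c \o a = a - (k^-1)%:C *: (h \o a) by [].
  by apply: (subspaceB sW) => //; apply: (subspaceZ sW); exact: Wh.
(* The inverse is first built with no constraint, since [W] is quantified inside the conclusion; the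
   series is run again for a given [W], and the two results agree because inverses are unique. *)
have [g [bg _ g1 g2]] := @neumann _ H c q bc q0 q1 cq setT I (fun _ _ => I) (fun _ _ => I).
have khk x : k%:C *: (x - c x) = h x.
  by rewrite /c !opE opprB addrCA subrr addr0 scalerA -rmorphM divff ?gt_eqF // scale1r.
have hE x : x - c x = (k^-1)%:C *: h x by rewrite /c !opE opprB addrCA subrr addr0.
set g' := (k^-1)%:C *: g.
have bg' : bounded_op H H g' by exact: bopZ.
have gh x : g' (h x) = x by rewrite /g' opE -(opZ bg) -hE g2.
have hg x : h (g' x) = x by rewrite /g' opE (opZ bh) -hE g1.
have pg : posop g'.
  move=> x; rewrite -{2}(hg x) -{1}(hg x) gh.
  by rewrite dotC -[X in 0 <= X]conjcK conj_ge0 /= conjcK; exact: ph.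
exists g'; split=> //; first exact: posop_sa.
move=> W sW clW W1 Wh; have [W0 Wc] := ex W sW clW W1 Wh.
have [f [bf Wf f1 f2]] := neumann bc q0 q1 cq W0 Wc clW.
suff -> : g' = (k^-1)%:C *: f by exact: (subspaceZ sW).
apply/funext => x; rewrite /g' !opE; congr (_ *: _).
by rewrite -{1}(f1 x) g2.
Qed.
End Positivity.

(** * Products of commuting positive operators, without square roots *)

Section ProductOfPositives.
Variables (R : realType) (H : hilbert R) (I : finType) (A : I -> I -> H -> H).
Hypotheses (bA : forall i j, bounded_op H H (A i j)) (pA : mpos A).

Let Q (b : H -> H) (xi : I -> H) :=
  \sum_i \sum_j hdot H (A i j (b (xi j))) (xi i).

Section Contraction.
Variable b : H -> H.
Hypotheses (bb : bounded_op H H b) (pb : posop b).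
Hypothesis b1 : forall x, re (hdot H (b x) x) <= nr x ^+ 2.
Hypothesis cb : forall i j x, A i j (b x) = b (A i j x).

Let bs n : H -> H := iter n (fun a => a - (a \o a)) b.

Let bsP n : [/\ bounded_op H H (bs n), is_adjoint (bs n) (bs n), posop (bs n),
  (forall x, re (hdot H (bs n x) x) <= nr x ^+ 2) &
  (forall i j x, A i j (bs n x) = bs n (A i j x))].
Proof.
elim: n => [|n [h1 h2 h3 h4 h5]]; first by split=> //; exact: posop_sa.
have bS : bounded_op H H (bs n.+1) by apply: bopB => //; exact: bop_comp.
have sS : is_adjoint (bs n.+1) (bs n.+1).
  by apply: is_adjointB => //; exact: is_adjoint_comp.
have E x : bs n.+1 x = bs n x - bs n (bs n x) by [].
have dE x y : hdot H (bs n (bs n x)) y = hdot H (bs n x) (bs n y) by rewrite h2.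
split=> //.
(* With b = [bs n], the identity b - b^2 = (1 - b) b (1 - b) + b (1 - b) b writes the next iterate
   as a sum of two positive operators. *)
- apply/(sa_posP sS) => x; set y := bs n x; set z := x - y.
  have yz : bs n z = bs n.+1 x by rewrite /z (opB h1).
  have -> : hdot H (bs n.+1 x) x = hdot H (bs n z) z + hdot H (y - bs n y) y.
    rewrite -[X in hdot H _ X](subrK y x) dotDr -/z yz; congr (_ + _); by [].
  rewrite reD addr_ge0 //; first exact/ge0_re/h3.
  rewrite dotBl reD reN dotxx reC subr_ge0.
  exact: h4.
- move=> x; apply: le_trans (h4 x); rewrite E dotBl dE dotxx reD reN reC.
  by rewrite gerDl oppr_le0 sqr_ge0.
- by move=> i j x; rewrite !E (opB (bA i j)) !h5.
Qed.

Let bs_sum n x :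
  \sum_(m < n) nr (bs m x) ^+ 2 = re (hdot H (b x) x) - re (hdot H (bs n x) x).
Proof.
elim: n => [|n ih]; first by rewrite big_ord0 subrr.
have [h1 h2 _ _ _] := bsP n.
have E : hdot H (bs n.+1 x) x = hdot H (bs n x) x - (nr (bs n x) ^+ 2)%:C.
  by rewrite -dotxx -h2 -dotBl.
rewrite big_ord_recr ih E reD reN reC /=.
by rewrite opprB; ring.
Qed.

Let Q_split n xi : Q b xi = \sum_(m < n) Q (bs m \o bs m) xi + Q (bs n) xi.
Proof.
elim: n => [|n ih]; first by rewrite big_ord0 add0r.
rewrite big_ord_recr /= ih -addrA; congr (_ + _).
rewrite /Q -big_split; apply: eq_bigr => i _ /=.
rewrite -big_split; apply: eq_bigr => j _ /=.
by rewrite (opB (bA i j)) dotBl addrC subrK.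
Qed.

(** Since b_n is selfadjoint and commutes with the entries, one factor b_n moves to the other side,
    leaving the positive form of A at the vectors b_n xi. *)
Let Q_sq n xi : 0 <= Q (bs n \o bs n) xi.
Proof.
have [h1 h2 _ _ h5] := bsP n.
suff -> : Q (bs n \o bs n) xi =
    \sum_i \sum_j hdot H (A i j (bs n (xi j))) (bs n (xi i)) by exact: pA.
apply: eq_bigr => i _; apply: eq_bigr => j _ /=.
by rewrite h5 h2.
Qed.

(** The telescoping sum bounds sum_m |b_m x|^2 by |x|^2; if every n had an index i with |b_n xi_i| >
    e, then n e^2 would stay below the fixed number sum_i |xi_i|^2. *)
Let bs_small xi e : 0 < e -> exists n, forall i : I, nr (bs n (xi i)) <= e.
Proof.
move=> e0; apply: contrapT => hn.
have big n : e ^+ 2 <= \sum_i nr (bs n (xi i)) ^+ 2.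
  have [i hi] : exists i, e < nr (bs n (xi i)).
    apply: contrapT => h; apply: hn; exists n => i; rewrite leNgt; apply/negP => h'.
    by apply: h; exists i.
  rewrite (bigD1 i) //= ler_wpDr ?sumr_ge0 // => [j _|]; first exact: sqr_ge0.
  by rewrite ler_pXn2r ?nnegrE ?nr_ge0 ?ltW.
set S := \sum_i nr (xi i) ^+ 2.
have bound n : n%:R * e ^+ 2 <= S.
  have : \sum_(m < n) e ^+ 2 <= \sum_(m < n) \sum_i nr (bs m (xi i)) ^+ 2.
    by apply: ler_sum => m _; exact: big.
  rewrite sumr_const card_ord exchange_big /= mulr_natl => /le_trans; apply.
  apply: ler_sum => i _; rewrite bs_sum; apply: le_trans (b1 _).
  by rewrite gerBl; have [_ _ p _ _] := bsP n; exact: ge0_re (p _).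
have e2 : 0 < e ^+ 2 by rewrite exprn_gt0.
have S0 : 0 <= S by apply: sumr_ge0 => i _; exact: sqr_ge0.
have := bound (Num.truncn (S / e ^+ 2)).+1; rewrite -ler_pdivlMr // leNgt.
by rewrite truncnS_gt.
Qed.

Lemma mpos_mul_contraction : mpos (fun i j => A i j \o b).
Proof.
move=> xi; rewrite -/(Q b xi).
set C := \sum_i \sum_j nr (A i j (xi j)).
apply: (@ge0c_closed _ _ C) => e e0; have [n hn] := bs_small xi e0.
have [h1 h2 _ _ h5] := bsP n.
exists (\sum_(m < n) Q (bs m \o bs m) xi); first by apply: sumr_ge0 => m _; exact: Q_sq.
rewrite (Q_split n) addrC addKr /C mulr_sumr.
apply: (le_trans (cn_sum _ _ _)); apply: ler_sum => i _.
rewrite mulr_sumr; apply: (le_trans (cn_sum _ _ _)); apply: ler_sum => j _.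
rewrite h5 h2; apply: (le_trans (cauchy_schwarz _ _)).
by rewrite mulrC ler_wpM2r ?nr_ge0.
Qed.
End Contraction.

(* b = sum_m b_m^2 + b_n with b_(m+1) = b_m - b_m^2, and b_n tends to 0 strongly. *)
Lemma mpos_mul (b : H -> H) : bounded_op H H b -> posop b ->
  (forall i j x, A i j (b x) = b (A i j x)) -> mpos (fun i j => A i j \o b).
Proof.
move=> bb pb cb; have [k k0 hk] := op_bound bb.
have k1 : 0 < k^-1 by rewrite invr_gt0.
have h := @mpos_mul_contraction ((k^-1)%:C *: b) (bopZ _ bb) (posop_scale (ltW k1) pb).
have {}h : mpos (fun i j => A i j \o ((k^-1)%:C *: b)).
  apply: h => [x|i j x]; last by rewrite !opE (opZ (bA i j)) cb.
  rewrite opE dotZl reM imC mul0r subr0 reC mulrC ler_pdivrMr //.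
  apply: (le_trans (re_le_cn _)); apply: (le_trans (cauchy_schwarz _ _)).
  apply: (le_trans (ler_wpM2r (nr_ge0 x) (hk x))).
  by rewrite le_eqVlt; apply/orP; left; apply/eqP; ring.
move=> xi; have := h xi.
have -> : \sum_i \sum_j hdot H ((A i j \o ((k^-1)%:C *: b)) (xi j)) (xi i) =
    (k^-1)%:C * \sum_i \sum_j hdot H ((A i j \o b) (xi j)) (xi i).
  rewrite mulr_sumr; apply: eq_bigr => i _; rewrite mulr_sumr; apply: eq_bigr => j _.
  by rewrite /= opE (opZ (bA i j)) dotZl.
by rewrite pmulr_rge0 // ltcR.
Qed.
End ProductOfPositives.

Lemma posop_mul (R : realType) (H : hilbert R) (a b : H -> H) :
  bounded_op H H a -> posop a -> bounded_op H H b -> posop b ->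
  (forall x, a (b x) = b (a x)) -> posop (a \o b).
Proof.
move=> ba pa bb pb ab x.
have p1 : mpos (fun _ _ : 'I_1 => a) by move=> xi; rewrite !big_ord1; exact: pa.
have := @mpos_mul R H 'I_1 (fun _ _ => a) (fun _ _ => ba) p1 b bb pb (fun _ _ => ab).
by move=> /(_ (fun=> x)); rewrite !big_ord1.
Qed.

(** * Perturbation of positive matrices, and the norm read from 2 x 2 matrices *)

Section MatrixPositivity.
Variables (R : realType) (H : hilbert R).

Definition odist (K : hilbert R) (A B : H -> K) (e : R) : Prop :=
  forall x, nr (A x - B x) <= e * nr x.

Lemma odist_sym (K : hilbert R) (A B : H -> K) e : odist A B e -> odist B A e.
Proof. by move=> h x; rewrite nrB. Qed.

Lemma odist_tri (K : hilbert R) (A B C : H -> K) e f : odist A B e -> odist B C f -> odist A C (e + f).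
Proof. by move=> h1 h2 x; apply: (le_trans (nr_tri (B x) _ _)); rewrite mulrDl lerD. Qed.

Lemma odist_le (K : hilbert R) (A B : H -> K) e f : e <= f -> odist A B e -> odist A B f.
Proof. by move=> ef h x; apply: (le_trans (h x)); rewrite ler_wpM2r ?nr_ge0. Qed.

Lemma odist_eq (K : hilbert R) (A B : H -> K) : (forall e, 0 < e -> odist A B e) -> A = B.
Proof.
move=> h; apply/funext => x; apply/eqP; rewrite -subr_eq0; apply/eqP/nr_eq0/eqP.
rewrite -normr_le0; apply/ler_addgt0Pr => e e0; rewrite add0r ger0_norm ?nr_ge0 //.
have x1 : 0 < nr x + 1 by have := nr_ge0 x; lra.
apply: (le_trans (h _ (divr_gt0 e0 x1) x)); rewrite mulrAC ler_pdivrMr //.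
by rewrite ler_wpM2l ?(ltW e0) // lerDl.
Qed.

Lemma odist_adj (A B A' B' : H -> H) e : bounded_op H H A -> bounded_op H H B ->
  is_adjoint A A' -> is_adjoint B B' -> 0 <= e -> odist A B e -> odist A' B' e.
Proof.
move=> bA bB hA hB e0 AB y; have bD := bopB bA bB.
have hD := is_adjointB hA hB; set z := A' y - B' y.
have zE : z = (A' - B') y by [].
have [->|/eqP n0] := eqVneq (nr z) 0; first by rewrite mulr_ge0 ?nr_ge0.
have n1 : 0 < nr z by rewrite lt_def nr_ge0 andbT; apply/eqP.
rewrite -(ler_pM2r n1) -expr2.
have -> : nr z ^+ 2 = re (hdot H z z) by rewrite dotxx reC.
rewrite {2}zE -hD; apply: (le_trans (re_le_cn _)).
apply: (le_trans (cauchy_schwarz _ _)); rewrite mulrAC.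
by rewrite ler_wpM2r ?nr_ge0 // opE; exact: AB.
Qed.

Lemma sum_delta (I : finType) (V : zmodType) (F : I -> V) j :
  (forall l, l != j -> F l = 0) -> \sum_l F l = F j.
Proof. by move=> h; rewrite (bigD1 j) //= big1 ?addr0. Qed.

Lemma mpos_hermitian (I : finType) (A : I -> I -> H -> H) :
  (forall i j, bounded_op H H (A i j)) -> mpos A ->
  forall i j, is_adjoint (A i j) (A j i).
Proof.
move=> bA pA.
pose B (xi eta : I -> H) := \sum_i \sum_j hdot H (A i j (xi j)) (eta i).
have BD1 x y z : B (fun i => x i + y i) z = B x z + B y z.
  rewrite /B -big_split; apply: eq_bigr => i _ /=; rewrite -big_split.
  by apply: eq_bigr => j _ /=; rewrite (opD (bA i j)) dotDl.
have BD2 x y z : B z (fun i => x i + y i) = B z x + B z y.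
  rewrite /B -big_split; apply: eq_bigr => i _ /=; rewrite -big_split.
  by apply: eq_bigr => j _ /=; rewrite dotDr.
have BZ1 a x z : B (fun i => a *: x i) z = a * B x z.
  rewrite /B mulr_sumr; apply: eq_bigr => i _ /=; rewrite mulr_sumr.
  by apply: eq_bigr => j _ /=; rewrite (opZ (bA i j)) dotZl.
have BZ2 a x z : B z (fun i => a *: x i) = Num.conj a * B z x.
  rewrite /B mulr_sumr; apply: eq_bigr => i _ /=; rewrite mulr_sumr.
  by apply: eq_bigr => j _ /=; rewrite dotZr.
have im0 x : im (B x x) = 0 by exact/ge0_im/pA.
have imE x y : im (B x y) = - im (B y x).
  have := im0 (fun i => x i + y i); rewrite BD1 !BD2 !imD !im0 add0r addr0.
  by move=> h; lra.
have reE x y : re (B x y) = re (B y x).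
  have := imE (fun i => 'i%C *: x i) y; rewrite BZ1 BZ2 !imM !cE.
  by rewrite !mul0r !mul1r !add0r mulN1r opprK.
have key i j x y : B (fun l => if l == j then x else 0) (fun k => if k == i then y else 0)
    = hdot H (A i j x) y.
  rewrite /B (@sum_delta _ _ _ i) ?eqxx; last first.
    by move=> k /negPf ->; rewrite big1 // => l _; rewrite dot0r.
  rewrite (@sum_delta _ _ _ j) ?eqxx // => l /negPf ->.
  by rewrite (op0 (bA i l)) dot0l.
move=> i j x y; rewrite -key (dotC x) -key.
by apply: ceqP; rewrite !cE; [exact: reE|exact: imE].
Qed.

(** Moving every entry by e changes the form by at most e sum_ij |xi_i| |xi_j| <= e n sum_i
    |xi_i|^2, with n the number of indices; adding e n on the diagonal repairs this. A single family
    [xi] is fixed because for minimal orders positivity is known only at families c_i x. *)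
Lemma form_perturb (I : finType) (A B : I -> I -> H -> H) (e : R) (xi : I -> H) :
  (forall i j, is_adjoint (A i j) (A j i)) -> (forall i j, is_adjoint (B i j) (B j i)) ->
  0 <= e -> (forall i j, odist (A i j) (B i j) e) ->
  0 <= \sum_i \sum_j hdot H (A i j (xi j)) (xi i) ->
  0 <= \sum_i \sum_j
     hdot H ((B i j + (if i == j then e * #|I|%:R else 0)%:C *: idfun) (xi j)) (xi i).
Proof.
move=> hA hB e0 AB pA.
set S := \sum_i nr (xi i) ^+ 2.
have -> : \sum_i \sum_j
   hdot H ((B i j + (if i == j then e * #|I|%:R else 0)%:C *: idfun) (xi j)) (xi i) =
   \sum_i \sum_j hdot H (A i j (xi j)) (xi i)
   + (\sum_i \sum_j hdot H (B i j (xi j) - A i j (xi j)) (xi i) + (e * #|I|%:R * S)%:C).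
  rewrite /S mulr_sumr rmorph_sum -!big_split; apply: eq_bigr => i _ /=.
  rewrite addrA -big_split /=.
  transitivity (\sum_j hdot H (B i j (xi j)) (xi i) +
     \sum_j hdot H ((if i == j then e * #|I|%:R else 0)%:C *: xi j) (xi i)).
    by rewrite -big_split; apply: eq_bigr => j _; rewrite !opE dotDl.
  congr (_ + _).
    by apply: eq_bigr => j _ /=; rewrite dotBl addrC subrK.
  rewrite (@sum_delta _ _ _ i) ?eqxx; last first.
    by move=> l; rewrite eq_sym => /negPf ->; rewrite scale0r dot0l.
  by rewrite dotZl dotxx -rmorphM.
apply: addr_ge0 => //.
set T := \sum_i _; have Treal : im T = 0.
  have : T = Num.conj T.
    rewrite /T rmorph_sum exchange_big /=; apply: eq_bigr => j _.
    rewrite rmorph_sum; apply: eq_bigr => i _ /=; rewrite -dotC.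
    have := is_adjointB (hB i j) (hA i j) (xi j) (xi i); rewrite !opE => ->.
    by [].
  by move=> /(congr1 (@im R)); rewrite imJ => h; lra.
apply/ge0cP; split; first by rewrite imD Treal imC addr0.
have TS : cn T <= e * #|I|%:R * S.
  have sq (x y : R) : x * y <= (x ^+ 2 + y ^+ 2) / 2.
    by have := sqr_ge0 (x - y); rewrite sqrrB; lra.
  apply: (le_trans (cn_sum _ _ _)).
  apply: (@le_trans _ _ (\sum_i \sum_j e * ((nr (xi j) ^+ 2 + nr (xi i) ^+ 2) / 2))).
    apply: ler_sum => i _; apply: (le_trans (cn_sum _ _ _)); apply: ler_sum => j _.
    apply: (le_trans (cauchy_schwarz _ _)).
    apply: (@le_trans _ _ (e * (nr (xi j) * nr (xi i)))); last by rewrite ler_wpM2l.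
    by rewrite mulrA ler_wpM2r ?nr_ge0 // nrB; exact: AB.
  have -> : \sum_(i : I) \sum_(j : I) e * ((nr (xi j) ^+ 2 + nr (xi i) ^+ 2) / 2) =
      \sum_(i : I) \sum_(j : I) (e / 2 * nr (xi j) ^+ 2) + \sum_(i : I) \sum_(j : I) (e / 2 * nr (xi i) ^+ 2).
    rewrite -big_split; apply: eq_bigr => i _; rewrite -big_split.
    by apply: eq_bigr => j _ /=; field.
  rewrite [X in _ + X]exchange_big /=.
  have -> : \sum_(i : I) \sum_(j : I) (e / 2 * nr (xi j) ^+ 2) = \sum_(i : I) (e / 2 * S).
    by apply: eq_bigr => i _; rewrite mulr_sumr.
  rewrite sumr_const -(mulr_natl (e / 2 * S)) le_eqVlt; apply/orP; left; apply/eqP.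
  by field.
have := re_geN_cn T; rewrite reD reC; lra.
Qed.

Lemma mpos_perturb (I : finType) (A B : I -> I -> H -> H) (e : R) :
  (forall i j, bounded_op H H (A i j)) -> mpos A ->
  (forall i j, is_adjoint (B i j) (B j i)) -> 0 <= e ->
  (forall i j, odist (A i j) (B i j) e) ->
  mpos (fun i j => B i j + (if i == j then e * #|I|%:R else 0)%:C *: idfun).
Proof. by move=> bA pA hB e0 AB xi; apply: form_perturb (pA xi) => //; exact: mpos_hermitian. Qed.

Lemma mpos_limit (I : finType) (A : I -> I -> H -> H) :
  (forall e, 0 < e -> exists2 B, mpos B & forall i j, odist (A i j) (B i j) e) -> mpos A.
Proof.
move=> h xi; apply: (@ge0c_closed _ _ (\sum_i \sum_j nr (xi j) * nr (xi i))) => e e0.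
have [B pB AB] := h e e0; exists (\sum_i \sum_j hdot H (B i j (xi j)) (xi i)).
  exact: pB.
rewrite -sumrB mulr_sumr; apply: (le_trans (cn_sum _ _ _)); apply: ler_sum => i _.
rewrite -sumrB mulr_sumr; apply: (le_trans (cn_sum _ _ _)); apply: ler_sum => j _.
rewrite -dotBl; apply: (le_trans (cauchy_schwarz _ _)).
by rewrite mulrA ler_wpM2r ?nr_ge0 //; exact: AB.
Qed.

(** The matrix with diagonal k and off-diagonal entries a, adj a is positive when |a| <= k. Together
    with the converse below, this makes adjoints and norms visible to the matrix order, hence
    preserved by complete order embeddings. *)
Lemma block2_form (a b : H -> H) (k : R) : is_adjoint a b ->
  (forall x, nr (a x) <= k * nr x) ->
  forall x y, 0 <= k%:C * hdot H x x + hdot H (a y) x + (hdot H (b x) y + k%:C * hdot H y y).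
Proof.
move=> ab hk x y; rewrite (adjoint_sym ab) (dotC x (a y)) !dotxx -!rmorphM.
have h : - cn (hdot H (a y) x) <= re (hdot H (a y) x) := re_geN_cn _.
have h1 := cauchy_schwarz (a y) x.
have h2 := ler_wpM2r (nr_ge0 x) (hk y).
apply/ge0cP; rewrite !cE; split; first by lra.
have := sqr_ge0 (nr x - nr y); have := nr_ge0 x; have := nr_ge0 y.
(* A negative bound k is possible only on the zero space, where x = y = 0. *)
have [k0|k0] := leP 0 k; first by have := mulr_ge0 k0 (sqr_ge0 (nr x - nr y)); rewrite sqrrB; nra.
have x0 : nr x = 0 by have := nr_ge0 (a x); have := nr_ge0 x; have := hk x; nra.
have y0 : nr y = 0 by have := nr_ge0 (a y); have := nr_ge0 y; have := hk y; nra.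
by move: h h1 h2; rewrite x0 y0; nra.
Qed.

Lemma block2_adjoint (a b : H -> H) (k : R) : bounded_op H H a -> bounded_op H H b ->
  (forall x y, 0 <= k%:C * hdot H x x + hdot H (a y) x + (hdot H (b x) y + k%:C * hdot H y y)) ->
  is_adjoint a b.
Proof.
move=> ba bb h.
have imE x y : im (hdot H (a y) x) = - im (hdot H (b x) y).
  have := ge0_im (h x y); rewrite !dotxx -!rmorphM !cE; lra.
have reE x y : re (hdot H (a y) x) = re (hdot H (b x) y).
  have := imE x ('i%C *: y); rewrite (opZ ba) dotZl dotZr !imM !cE.
  by rewrite !mul0r !mul1r !add0r mulN1r opprK.
by move=> y x; rewrite (dotC y); apply: ceqP; rewrite !cE.
Qed.

(** Positivity along (x, s y) for all complex s is a discriminant condition; it is used at x = a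
    y. *)
Lemma block2_norm (a b : H -> H) (k : R) : bounded_op H H a -> bounded_op H H b ->
  0 <= k ->
  (forall x y, 0 <= k%:C * hdot H x x + hdot H (a y) x + (hdot H (b x) y + k%:C * hdot H y y)) ->
  forall y, nr (a y) <= k * nr y.
Proof.
move=> ba bb k0 h y; have ab := block2_adjoint ba bb h.
have cs x : cn (hdot H (a y) x) ^+ 2 <= (k * nr x ^+ 2) * (k * nr y ^+ 2).
  apply: discriminant; first by rewrite mulr_ge0 ?sqr_ge0.
  move=> s; have := ge0_re (h x (s *: y)).
  rewrite (adjoint_sym ab) (dotC x (a (s *: y))) (opZ ba) !dotZl dotZr !dotxx !cE.
  move=> H0; apply: (le_trans H0); rewrite le_eqVlt; apply/orP; left; apply/eqP.
  by rewrite cn_sq; ring.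
have := cs (a y); rewrite dotxx cn_real ger0_norm ?sqr_ge0 // => {}cs.
have [->|/eqP n0] := eqVneq (nr (a y)) 0; first by rewrite mulr_ge0 ?nr_ge0.
have n1 : 0 < nr (a y) by rewrite lt_def nr_ge0 andbT; apply/eqP.
rewrite -(@ler_pXn2r _ 2) ?nnegrE ?nr_ge0 ?mulr_ge0 ?nr_ge0 //.
rewrite -(ler_pM2l (exprn_gt0 2 n1)) -expr2; apply: (le_trans cs).
by rewrite le_eqVlt; apply/orP; left; apply/eqP; ring.
Qed.
End MatrixPositivity.
(** * Unital complete order embeddings *)

Section Ucoe.
Variable R : realType.
Implicit Types (A B C : mospace R) (H K L : hilbert R).

Lemma ucoe_comp A B C (S : set A) (phi : A -> B) (psi : B -> C) :
  ucoe S phi -> ucoe (phi @` S) psi -> ucoe S (psi \o phi).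
Proof.
move=> [d1 l1 u1 p1] [d2 l2 u2 p2]; split=> /=.
- by move=> x Sx; apply: d2; exists x.
- by move=> a x y Sx Sy; rewrite l1 // l2 //.
- by rewrite u1 u2.
- move=> n M SM; rewrite map_mx_comp; apply: (iff_trans (p1 n M SM)); apply: p2.
  by move=> i j; rewrite mxE; exists (M i j).
Qed.

Lemma ucoe_sub A B (S S' : set A) (phi : A -> B) : S' `<=` S -> ucoe S phi -> ucoe S' phi.
Proof.
move=> SS [d1 l1 u1 p1]; split=> //; first by move=> x /SS; exact: d1.
- by move=> a x y /SS Sx /SS Sy; exact: l1.
- by move=> n M SM; apply: p1 => i j; exact/SS.
Qed.

Section Linear.
Variables (A B : mospace R) (S : set A) (phi : A -> B).
Hypotheses (sS : @Defs.subspace _ A S) (uphi : ucoe S phi).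
Lemma ucoe0 : phi 0 = 0.
Proof.
have [_ l _ _] := uphi; have := l 1 0 0 sS.1 sS.1.
rewrite !scale1r addr0 => /eqP; rewrite -subr_eq0 opprD addrA subrr add0r.
by rewrite oppr_eq0 => /eqP.
Qed.
Lemma ucoeZ a x : S x -> phi (a *: x) = a *: phi x.
Proof.
move=> Sx; have [_ l _ _] := uphi; have := l a x 0 Sx sS.1.
by rewrite addr0 ucoe0 addr0.
Qed.
Lemma ucoeD x y : S x -> S y -> phi (x + y) = phi x + phi y.
Proof.
by move=> Sx Sy; have [_ l _ _] := uphi; have := l 1 x y Sx Sy; rewrite !scale1r.
Qed.
Lemma sub_scale a x : S x -> S (a *: x).
Proof. by move=> Sx; rewrite -[_ *: x]addr0; apply: sS.2 => //; exact: sS.1. Qed.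
Lemma ucoeB x y : S x -> S y -> phi (x - y) = phi x - phi y.
Proof.
move=> Sx Sy; rewrite ucoeD //; last by rewrite -scaleN1r; exact: sub_scale.
by rewrite -scaleN1r ucoeZ // scaleN1r.
Qed.
End Linear.

Definition block2 (V : Type) (a b c d : V) : 'M[V]_2 :=
  \matrix_(i, j) if i == ord0 then (if j == ord0 then a else b)
                 else (if j == ord0 then c else d).

Lemma map_block2 (V W : Type) (f : V -> W) a b c d :
  map_mx f (block2 a b c d) = block2 (f a) (f b) (f c) (f d).
Proof. by apply/matrixP => i j; rewrite !mxE; case: ifP; case: ifP. Qed.

Lemma block2_in (V : Type) (S : set V) a b c d : S a -> S b -> S c -> S d ->
  forall i j, S ((block2 a b c d) i j).
Proof. by move=> *; rewrite mxE; case: ifP; case: ifP. Qed.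

Lemma block2_posE H (a b c d : opspace H) : mo_pos (block2 a b c d) <->
  forall x y, 0 <= hdot H (a x) x + hdot H (b y) x + (hdot H (c x) y + hdot H (d y) y).
Proof.
split=> h.
  move=> x y; have := h (fun i => if i == ord0 then x else y).
  by rewrite !big_ord_recl !big_ord0 !addr0 !mxE.
move=> xi; have := h (xi ord0) (xi (lift ord0 ord0)).
by rewrite !big_ord_recl !big_ord0 !addr0 !mxE.
Qed.

(* Every element has a norm bound that the matrix order can see. *)
Definition order_bounded A (S : set A) := forall x, S x -> exists y (k : R),
  [/\ S y, mo_adj x y, 0 <= k &
      mo_pos (block2 (k%:C *: mo_unit A) x y (k%:C *: mo_unit A))].

Lemma opsys_adj H (S : set (opspace H)) : operator_system S ->
  forall x, S x -> S (adj x).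
Proof.
move=> [Sb sS S1 Sadj] x Sx; apply: (Sadj x) => //; apply: adjP; exact: Sb.
Qed.

Lemma opspace_order_bounded H (S : set (opspace H)) :
  operator_system S -> order_bounded S.
Proof.
move=> oS x Sx; have [Sb sS S1 Sadj] := oS; have bx := Sb _ Sx.
have [k k0 hk] := op_bound bx.
exists (adj x), k; split; [exact: opsys_adj|exact: adjP|exact: ltW|].
apply/block2_posE => u v; rewrite !opE !dotZl.
by apply: block2_form => //; exact: adjP.
Qed.

Section Target.
Variables (A : mospace R) (K : hilbert R) (S : set A) (phi : A -> opspace K).
Hypotheses (oS : operator_system S) (obS : order_bounded S) (uphi : ucoe S phi).

Lemma ucoe_bop x : S x -> bounded_op K K (phi x).
Proof. by have [d _ _ _] := uphi; exact: d. Qed.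

Lemma ucoe_block x y k : S x -> S y ->
  mo_pos (block2 (k%:C *: mo_unit A) x y (k%:C *: mo_unit A)) <->
  forall u v, 0 <= k%:C * hdot K u u + hdot K (phi x v) u +
    (hdot K (phi y u) v + k%:C * hdot K v v).
Proof.
move=> Sx Sy; have [_ sS S1 _] := oS; have [_ _ p1 pp] := uphi.
have Sk : S (k%:C *: mo_unit A) by exact: sub_scale.
apply: (iff_trans (pp 2%N _ (block2_in Sk Sx Sy Sk))).
rewrite map_block2 (ucoeZ sS uphi) // p1; apply: (iff_trans (block2_posE _ _ _ _)).
by split=> h u v; have := h u v; rewrite !opE !dotZl.
Qed.

(** The 2 x 2 matrix of [order_bounded] stays positive under [phi], and its positivity forces the
    off-diagonal entries to be adjoint to each other. *)
Lemma ucoe_adj_ex x : S x -> exists y, [/\ S y, mo_adj x y & is_adjoint (phi x) (phi y)].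
Proof.
move=> Sx; have [y [k [Sy xy k0 p]]] := obS Sx; exists y; split=> //.
apply: (@block2_adjoint _ _ _ _ k); [exact: ucoe_bop|exact: ucoe_bop|].
exact/ucoe_block.
Qed.

Lemma ucoe_image_opsys : operator_system (phi @` S).
Proof.
have [_ sS S1 Sadj] := oS; have [d l p1 pp] := uphi; split.
- by move=> _ [x Sx <-]; exact: d.
- split; first by exists 0; [exact: sS.1|exact: (ucoe0 sS uphi)].
  by move=> a _ _ [x Sx <-] [y Sy <-]; exists (a *: x + y); [exact: sS.2|exact: l].
- by exists (mo_unit A).
- move=> _ z [x Sx <-] xz; have [y [Sy _ xy]] := ucoe_adj_ex Sx.
  by exists y => //; exact: adjoint_uniq xy xz.
Qed.
End Target.

Section Operators.
Variables (H K : hilbert R) (S : set (opspace H)) (phi : opspace H -> opspace K).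
Hypotheses (oS : operator_system S) (uphi : ucoe S phi).
Let obS := opspace_order_bounded oS.
Let sS : @Defs.subspace _ (opspace H) S. Proof. by case: oS. Qed.
Let Sb : forall x, S x -> bounded_op H H x. Proof. by case: oS. Qed.

Lemma ucoe_adj x y : S x -> is_adjoint x y -> is_adjoint (phi x) (phi y).
Proof.
move=> Sx xy; have [z [Sz xz h]] := ucoe_adj_ex oS obS uphi Sx.
by rewrite (adjoint_uniq xy xz).
Qed.

Lemma ucoe_norm (x : H -> H) (k : R) : S x -> 0 <= k ->
  (forall u, nr (x u) <= k * nr u) <-> (forall u, nr (phi x u) <= k * nr u).
Proof.
move=> Sx k0; have Sy := opsys_adj oS Sx; have bx := Sb Sx; have bp := ucoe_bop uphi Sx.
have P := @ucoe_block _ _ _ _ oS uphi x (adj x) k Sx Sy.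
have adx := adjP bx; have adp := ucoe_adj Sx adx.
split=> h.
  apply: (@block2_norm _ _ _ (phi (adj x))) => //; first exact: (adjoint_bop bp adp).
  apply/P/block2_posE => u v; rewrite !opE !dotZl.
  exact: block2_form.
apply: (@block2_norm _ _ _ (adj x)) => //; first exact: adj_bop.
have /P/block2_posE h' : forall u v, 0 <= k%:C * hdot K u u + hdot K (phi x v) u +
    (hdot K (phi (adj x) u) v + k%:C * hdot K v v) by exact: block2_form.
by move=> u v; have := h' u v; rewrite !opE !dotZl.
Qed.

Lemma ucoe_odist (x y : H -> H) (e : R) : S x -> S y -> 0 <= e ->
  odist x y e <-> odist (phi x : K -> K) (phi y) e.
Proof.
move=> Sx Sy e0; have Sxy : S (x - y) by exact: (subspaceB sS).
by have := @ucoe_norm (x - y) e Sxy e0; rewrite (ucoeB sS uphi).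
Qed.

Lemma ucoe_inj (x y : H -> H) : S x -> S y -> phi x = phi y -> x = y.
Proof.
move=> Sx Sy e; apply: odist_eq => d d0; apply/(ucoe_odist Sx Sy (ltW d0)).
by rewrite e => u; rewrite subrr nr0 mulr_ge0 ?nr_ge0 ?ltW.
Qed.

Lemma ucoe_mpos n (x : 'I_n -> 'I_n -> H -> H) : (forall i j, S (x i j)) ->
  mpos x <-> mpos (fun i j => phi (x i j) : K -> K).
Proof.
move=> Sx; have [_ _ _ pp] := uphi.
have [P1 P2] := pp n (\matrix_(i, j) (x i j : opspace H))
  (fun i j => eq_ind_r S (Sx i j) (mxE _ _ i j)).
have e1 : (fun i j => (\matrix_(i, j) (x i j : opspace H)) i j) = x.
  by apply/funext => i; apply/funext => j; rewrite mxE.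
have e2 : (fun i j => (map_mx phi (\matrix_(i, j) (x i j : opspace H))) i j) =
    (fun i j => phi (x i j)).
  by apply/funext => i; apply/funext => j; rewrite !mxE.
split=> h.
  have : mpos (fun i j => (map_mx phi (\matrix_(i, j) (x i j : opspace H))) i j : K -> K).
    by apply: P1; rewrite -e1 in h; exact: h.
  by rewrite e2.
rewrite -e1; apply: P2.
have : mpos (fun i j => phi (x i j) : K -> K) by [].
by rewrite -e2.
Qed.

End Operators.
End Ucoe.

(** * Extension of complete order embeddings to norm closures *)

Section OperatorSystems.
Variable R : realType.
Implicit Types (H K L : hilbert R).

Lemma opsys_closure H (S : set (opspace H)) :
  operator_system S -> operator_system (opclosure S : set (opspace H)).
Proof.
move=> oS; have [Sb sS S1 Sadj] := oS; split.
- exact: opclosure_bop.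
- exact: opclosure_subspace.
- exact: (sub_opclosure Sb).
- move=> x y Sx xy; rewrite -(adjE (opclosure_bop Sx) xy).
  apply: (opclosure_adj Sb _ Sx) => a Sa; apply: (sub_opclosure Sb).
  exact: opsys_adj.
Qed.

(** Averaging an approximation of x_ij with the adjoint of one of x_ji keeps the error and restores
    hermitian symmetry, without which the perturbed matrix could not be positive. *)
Lemma opsys_hermitian_approx H (S : set (opspace H)) (I : finType)
    (x : I -> I -> H -> H) (d : R) : operator_system S ->
  (forall i j, opclosure S (x i j)) -> (forall i j, is_adjoint (x i j) (x j i)) -> 0 < d ->
  exists a : I -> I -> H -> H, [/\ forall i j, S (a i j),
    forall i j, is_adjoint (a i j) (a j i) & forall i j, odist (x i j) (a i j) d].
Proof.
move=> oS Sx hx d0; have [Sb sS S1 Sadj] := oS.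
have /choice[b hb] : forall p : I * I, exists a, S a /\ odist (x p.1 p.2) a d.
  by move=> p; have /opclosureP[_ /(_ d d0)[a Sa ha]] := Sx p.1 p.2; exists a.
pose h : R[i] := (2^-1 : R)%:C.
pose a i j : H -> H := h *: (b (i, j) + adj (b (j, i))).
have Sbb p : S (b p) by have [] := hb p.
exists a; split.
- move=> i j; apply: (subspaceZ sS); apply: (subspaceD sS) => //.
  exact: opsys_adj.
- move=> i j; have hJ : Num.conj h = h := conjC_real _.
  rewrite /a -{2}hJ addrC.
  apply: is_adjointZ; apply: is_adjointD; last exact/adjP/Sb.
  exact/adjoint_sym/adjP/Sb.
- move=> i j; have d1 := (hb (i, j)).2; have d2 := (hb (j, i)).2; move: d1 d2 => /= d1 d2.
  have d3 : odist (x i j) (adj (b (j, i))) d.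
    apply: (odist_adj (opclosure_bop (Sx j i)) (Sb _ (Sbb (j, i))) (hx j i) _ (ltW d0) d2).
    exact/adjP/Sb.
  move=> u; rewrite /a !opE.
  have -> : x i j u - h *: (b (i, j) u + adj (b (j, i)) u) =
      h *: ((x i j u - b (i, j) u) + (x i j u - adj (b (j, i)) u)).
    rewrite -opprB addrACA -opprD opprB scalerBr; congr (_ - _).
    rewrite -mulr2n -scaler_nat scalerA /h.
    have -> : (2^-1 : R)%:C * (2%:R : R[i]) = 1.
      by apply: ceqP; rewrite -(rmorph_nat (real_complex R)) !cE; field.
    by rewrite scale1r.
  rewrite nrZ /h cn_real ger0_norm ?invr_ge0 //.
  have := nrD (x i j u - b (i, j) u) (x i j u - adj (b (j, i)) u).
  have := d1 u; have := d3 u; lra.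
Qed.

Section Inverse.
Variables (H K : hilbert R) (S : set (opspace H)) (phi : opspace H -> opspace K).
Hypotheses (oS : operator_system S) (uphi : ucoe S phi).

Lemma ucoe_inverse : exists psi : opspace K -> opspace H,
  ucoe (phi @` S) psi /\ (forall x, S x -> psi (phi x) = x).
Proof.
have [Sb sS S1 Sadj] := oS; have [d l p1 pp] := uphi.
pose psi (y : opspace K) : opspace H := xget 0 [set x | S x /\ phi x = y].
have psiK x : S x -> psi (phi x) = x.
  move=> Sx; have [Sy e] := @xgetI _ 0 [set x0 | S x0 /\ phi x0 = phi x] x (conj Sx erefl).
  exact: (ucoe_inj oS uphi).
exists psi; split=> //; split.
- by move=> _ [x Sx <-]; rewrite psiK //; exact: Sb.
- move=> a _ _ [x Sx <-] [y Sy <-]; rewrite -l // !psiK //; exact: sS.2.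
- by rewrite -p1 psiK.
- move=> n M SM.
  have /choice[N hN] : forall p : 'I_n * 'I_n, exists x, S x /\ phi x = M p.1 p.2.
    by move=> p; have [x Sx e] := SM p.1 p.2; exists x.
  pose N' : 'M[opspace H]_n := \matrix_(i, j) N (i, j).
  have SN i j : S (N' i j) by rewrite mxE; have [] := hN (i, j).
  have NM : map_mx phi N' = M.
    by apply/matrixP => i j; rewrite !mxE; have [_ ->] := hN (i, j).
  have -> : map_mx psi M = N'.
    by rewrite -NM; apply/matrixP => i j; rewrite [LHS]mxE [in LHS]mxE psiK.
  by rewrite -NM; exact: iff_sym (pp n N' SN).
Qed.

(** The graph of the continuous extension of [phi]: x and y are approximated by the same a and
    [phi a]. Being symmetric under exchanging [phi] with its inverse, the relation lets one
    positivity lemma serve both directions. *)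
Definition extends_to (x : H -> H) (y : K -> K) := [/\ bounded_op H H x, bounded_op K K y &
  forall e : R, 0 < e -> exists a : H -> H,
    [/\ S a, odist x a e & odist y (phi a : K -> K) e]].

Lemma extends_pos n (x : 'I_n -> 'I_n -> H -> H) (y : 'I_n -> 'I_n -> K -> K) :
  (forall i j, extends_to (x i j) (y i j)) -> mpos x -> mpos y.
Proof.
move=> xy px; have [Sb sS S1 Sadj] := oS; have [ud l p1 pp] := uphi.
have bx i j : bounded_op H H (x i j) by have [] := xy i j.
have hx := mpos_hermitian bx px.
have Sx i j : opclosure S (x i j).
  apply/opclosureP; split=> // e e0; have [_ _ /(_ e e0)[a [Sa h _]]] := xy i j.
  by exists a.
apply: mpos_limit => e e0.
(* The budget n + 3 consists of one d from y to [phi c], two from [phi c] to [phi a], and n from the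
   diagonal shift. *)
have n3 : 0 < (n%:R + 3 : R) by rewrite ltr_wpDl.
have d0 := divr_gt0 e0 n3; have : e / (n%:R + 3) * (n%:R + 3) = e by rewrite divfK ?gt_eqF.
move: (e / _) d0 => d d0 ed.
have [a [Sa ha xa]] := opsys_hermitian_approx oS Sx hx d0.
have := mpos_perturb bx px ha (ltW d0) xa.
rewrite card_ord; set B := fun i j => _ => pB.
have SB i j : S (B i j).
  by apply: (subspaceD sS) => //; apply: (subspaceZ sS).
exists (fun i j => phi (B i j)); first exact/(ucoe_mpos uphi SB).
move=> i j; have [_ _ /(_ d d0)[c [Sc xc yc]]] := xy i j.
have ca := odist_tri (odist_sym xc) (xa i j).
have pca := (ucoe_odist oS uphi Sc (Sa i j) (addr_ge0 (ltW d0) (ltW d0))).1 ca.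
have yB : odist (phi (a i j) : K -> K) (phi (B i j)) (d * n%:R).
  have dn : 0 <= d * n%:R by rewrite mulr_ge0 ?(ltW d0).
  apply/(ucoe_odist oS uphi (Sa i j) (SB i j) dn).
  move=> u; rewrite /B !opE opprD addrA subrr sub0r nrN nrZ cn_real.
  rewrite ler_wpM2r ?nr_ge0 //; case: ifP => _; first by rewrite ger0_norm.
  by rewrite normr0.
apply: odist_le (odist_tri (odist_tri yc pca) yB).
by rewrite -ed mulrDr; lra.
Qed.
End Inverse.

Section Extension.
Variables (H K : hilbert R) (S : set (opspace H)) (phi : opspace H -> opspace K).
Hypotheses (oS : operator_system S) (uphi : ucoe S phi).

Lemma ucoe_extend : exists phi' : opspace H -> opspace K,
  [/\ ucoe (opclosure S : set (opspace H)) phi', forall x, S x -> phi' x = phi x &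
      phi' @` (opclosure S : set (opspace H)) = opclosure (phi @` S)].
Proof.
have [Sb sS S1 Sadj] := oS; have [ud l p1 pp] := uphi.
have [psi [upsi psiK]] := ucoe_inverse oS uphi.
have oT := ucoe_image_opsys oS (opspace_order_bounded oS) uphi.
have extC x y : extends_to S phi x y -> extends_to (phi @` S) psi y x.
  move=> [bx by_ h]; split=> // e /h[a [Sa h1 h2]]; exists (phi a).
  by split; [exists a|exact: h2|rewrite psiK].
have ext_uniq x y y' : extends_to S phi x y -> extends_to S phi x y' -> y = y'.
  move=> [_ _ h] [_ _ h']; apply: odist_eq => e e0; have e4 : 0 < e / 4 by lra.
  have [a [Sa xa ya]] := h _ e4; have [b [Sb' xb yb]] := h' _ e4.
  have ab := odist_tri (odist_sym xa) xb.
  have pab := (ucoe_odist oS uphi Sa Sb' (addr_ge0 (ltW e4) (ltW e4))).1 ab.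
  by apply: odist_le (odist_tri (odist_tri ya pab) (odist_sym yb)); lra.
have ext_ex x : opclosure S x -> exists y, extends_to S phi x y.
  move=> /opclosureP[bx hx].
  have /choice[a ha] : forall n : nat, exists a, S a /\ odist x a n.+1%:R^-1.
    move=> n; have n0 : (0 : R) < n.+1%:R^-1 by rewrite invr_gt0.
    by have [a Sa h] := hx _ n0; exists a.
  have [||y by_ hy] := @op_cauchy _ K K (fun n => phi (a n)).
  - by move=> n; apply: ud; have [] := ha n.
  - move=> e e0; have e2 : 0 < e / 2 by lra.
    have [N hN] := small_invS e2; exists N => m n Nm Nn.
    apply/(ucoe_odist oS uphi (ha m).1 (ha n).1 (ltW e0)).
    have := odist_tri (odist_sym (odist_le (hN m Nm) (ha m).2)) (odist_le (hN n Nn) (ha n).2).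
    by apply: odist_le; lra.
  - exists y; split=> // e e0; have [N1 hN1] := small_invS e0; have [N2 hN2] := hy _ e0.
    exists (a (maxn N1 N2)); split; first by have [] := ha (maxn N1 N2).
      exact: (odist_le (hN1 _ (leq_maxl _ _)) (ha _).2).
    exact: (odist_sym (hN2 _ (leq_maxr _ _))).
pose phi' (x : opspace H) : opspace K := xget 0 [set y | extends_to S phi x y].
have phi'P x : opclosure S x -> extends_to S phi x (phi' x).
  by move=> /ext_ex[y hy]; exact: (@xgetI _ 0 [set y | extends_to S phi x y] y hy).
have phi'E x y : extends_to S phi x y -> phi' x = y.
  by move=> h; apply: (ext_uniq x) => //; exact: (@xgetI _ 0 [set y | extends_to S phi x y] y h).
have oSc := opsys_closure oS; have [Scb sSc _ _] := oSc.
have phi'S x : S x -> phi' x = phi x.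
  move=> Sx; apply: phi'E; split; [exact: Sb|exact: ud|].
  by move=> e e0; exists x; split=> // u; rewrite subrr nr0 mulr_ge0 ?nr_ge0 ?ltW.
exists phi'; split=> //.
- split.
  + by move=> x /phi'P[].
  + move=> a x y cx cy; apply: phi'E.
    have [bx bpx hx] := phi'P _ cx; have [by_ bpy hy] := phi'P _ cy.
    split; [by apply: bopD => //; exact: bopZ|by apply: bopD => //; exact: bopZ|].
    move=> e e0; have c1 : 0 < cn a + 1 by have := cn_ge0 a; lra.
    have d0 := divr_gt0 e0 c1.
    have : e / (cn a + 1) * (cn a + 1) = e by rewrite divfK ?gt_eqF.
    move: (e / _) d0 => d d0 ed.
    have [x' [Sx xx px]] := hx _ d0; have [y' [Sy yy py]] := hy _ d0.
    have odZ (L : hilbert R) (A A' B B' : L -> L) :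
        odist A A' d -> odist B B' d -> odist (a *: A + B) (a *: A' + B') e.
      move=> hA hB u; rewrite !opE opprD addrACA -scalerBr.
      apply: (le_trans (nrD _ _)); rewrite nrZ -ed mulrDr mulr1 mulrDl.
      by apply: lerD => //; rewrite [d * _]mulrC -mulrA ler_wpM2l ?cn_ge0.
    exists (a *: x' + y'); split; [exact: sS.2|exact: odZ|].
    by rewrite l //; exact: odZ.
  + by rewrite phi'S.
  + move=> n M SM; split=> h.
      have := @extends_pos _ _ _ _ oS uphi n (fun i j => M i j) (fun i j => phi' (M i j))
        (fun i j => phi'P _ (SM i j)) h.
      suff <- : (fun i j => (map_mx phi' M) i j) = (fun i j => phi' (M i j)) by [].
      by apply/funext => i; apply/funext => j; rewrite mxE.
    apply: (@extends_pos _ _ _ _ oT upsi n (fun i j => phi' (M i j)) (fun i j => M i j)).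
      by move=> i j; apply: extC; exact: phi'P.
    suff <- : (fun i j => (map_mx phi' M) i j) = (fun i j => phi' (M i j)) by [].
    by apply/funext => i; apply/funext => j; rewrite mxE.
- apply/seteqP; split.
    move=> _ [x cx <-]; have [bx bp h] := phi'P _ cx; apply/opclosureP; split=> // e /h.
    by move=> [a [Sa _ pa]]; exists (phi a) => //; exists a.
  move=> y /opclosureP[by_ hy].
  have hy' : forall e : R, 0 < e -> exists2 a : H -> H, S a & odist y (phi a : K -> K) e.
    by move=> e /hy[_ [a Sa <-] h]; exists a.
  have /choice[a ha] : forall n : nat, exists a : H -> H, S a /\ odist y (phi a : K -> K) n.+1%:R^-1.
    move=> n; have n0 : (0 : R) < n.+1%:R^-1 by rewrite invr_gt0.
    by have [a Sa h] := hy' _ n0; exists a.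
  have [||x bx hx] := @op_cauchy _ H H a.
  - by move=> n; apply: Sb; have [] := ha n.
  - move=> e e0; have e2 : 0 < e / 2 by lra.
    have [N hN] := small_invS e2; exists N => m n Nm Nn.
    apply/(ucoe_odist oS uphi (ha m).1 (ha n).1 (ltW e0)).
    have := odist_tri (odist_sym (odist_le (hN m Nm) (ha m).2)) (odist_le (hN n Nn) (ha n).2).
    by apply: odist_le; lra.
  - have ext : extends_to S phi x y.
      split=> // e e0; have [N1 hN1] := small_invS e0; have [N2 hN2] := hx _ e0.
      exists (a (maxn N1 N2)); split; first by have [] := ha (maxn N1 N2).
        exact: (odist_sym (hN2 _ (leq_maxr _ _))).
      exact: (odist_le (hN1 _ (leq_maxl _ _)) (ha _).2).
    exists x; last exact: phi'E.
    apply/opclosureP; split=> // e e0; have [_ _ /(_ e e0)[b [Sb' h _]]] := ext.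
    by exists b.
Qed.
End Extension.

(** The new envelope keeps the space and precomposes the map with the inverse of [phi]; the image of
    the system, hence the generated algebra, does not change. *)
Lemma envelope_transport H K (S : set (opspace H)) (phi : opspace H -> opspace K)
    (E : cstar_envelope S) : operator_system S -> ucoe S phi ->
  exists E' : cstar_envelope (phi @` S), centre E' = phi @` (centre E).
Proof.
move=> oS uphi; have [psi [upsi psiK]] := ucoe_inverse oS uphi.
have im : psi @` (phi @` S) = S.
  apply/seteqP; split; first by move=> _ [_ [x Sx <-] <-]; rewrite psiK.
  by move=> x Sx; exists (phi x); [exists x|exact: psiK].
have uE : ucoe (phi @` S) (env_map E \o psi).
  by apply: ucoe_comp => //; rewrite im; exact: env_ucoe.
have imE : (env_map E \o psi) @` (phi @` S) = env_map E @` S.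
  rewrite image_comp; apply/seteqP; split=> [_ [x Sx <-]|_ [x Sx <-]].
    by exists x; rewrite //= psiK.
  by exists x; rewrite //= psiK.
have univ L (j : opspace K -> opspace L) : ucoe (phi @` S) j ->
    exists2 pi : opspace L -> opspace (env_space E),
      star_hom (cstar_gen (j @` (phi @` S)))
               (cstar_gen ((env_map E \o psi) @` (phi @` S))) pi &
      forall x, (phi @` S) x -> pi (j x) = (env_map E \o psi) x.
  move=> uj; have [pi hpi epi] := env_univ E (ucoe_comp uphi uj).
  exists pi; first by rewrite imE image_comp.
  by move=> _ [x Sx <-] /=; rewrite psiK // -epi.
exists (CstarEnvelope uE univ); apply/seteqP; split.
  move=> y [[x Sx <-] h]; exists x => //; split=> // z Ez.
  move: h; rewrite /env_algebra /= imE => /(_ z Ez); by rewrite psiK.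
move=> _ [x [Sx h] <-]; split; first by exists x.
by move=> z; rewrite /env_algebra /= imE psiK //; exact: h.
Qed.
End OperatorSystems.
(** * Kernel Hilbert spaces *)

Section Sequences.
Variable R : realType.
Implicit Types (r s : nat -> R) (z w : nat -> R[i]).

(** The bound is one-sided, so that applied to r_n - b it also expresses that the upper limit of r_n
    is at most b. *)
Definition nulls r := forall e : R, 0 < e -> exists N, forall n, (N <= n)%N -> r n <= e.
Definition climit z (l : R[i]) := nulls (fun n => cn (z n - l)).

Lemma nullsD r s : nulls r -> nulls s -> nulls (fun n => r n + s n).
Proof.
move=> hr hs e e0; have e2 : 0 < e / 2 by lra.
have [N hN] := hr _ e2; have [M hM] := hs _ e2; exists (maxn N M) => n.
rewrite geq_max => /andP[/hN h1 /hM h2]; lra.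
Qed.
Lemma nulls_le r s : (forall n, r n <= s n) -> nulls s -> nulls r.
Proof. by move=> rs hs e /hs[N hN]; exists N => n /hN; exact: le_trans. Qed.
Lemma nullsM c r : 0 <= c -> (forall n, 0 <= r n) -> nulls r -> nulls (fun n => c * r n).
Proof.
move=> c0 r0 hr e e0; have c1 : 0 < c + 1 by lra.
have [N hN] := hr _ (divr_gt0 e0 c1); exists N => n /hN h.
rewrite ler_pdivlMr // in h; have := r0 n; nra.
Qed.
Lemma nulls0 : nulls (fun=> 0). Proof. by move=> e e0; exists 0%N => n _; exact: ltW. Qed.

Lemma climitD z w l k : climit z l -> climit w k -> climit (fun n => z n + w n) (l + k).
Proof.
move=> hz hw; apply: nulls_le (nullsD hz hw) => n; rewrite opprD addrACA.
exact: cnD.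
Qed.
Lemma climitZ a z l : climit z l -> climit (fun n => a * z n) (a * l).
Proof.
move=> hz; apply: nulls_le (nullsM (cn_ge0 a) _ hz) => n; last exact: cn_ge0.
by rewrite -mulrBr cnM.
Qed.
Lemma climit_const l : climit (fun=> l) l.
Proof. by apply: nulls_le nulls0 => n; rewrite subrr cn0. Qed.
Lemma climit_uniq z l k : climit z l -> climit z k -> l = k.
Proof.
move=> h1 h2; apply/eqP; rewrite -subr_eq0; apply/eqP/cn_eq0/eqP.
rewrite -normr_le0; apply/ler_addgt0Pr => e e0; rewrite add0r ger0_norm ?cn_ge0 //.
have [N hN] := nullsD h1 h2 e0; apply: le_trans (hN N (leqnn N)).
by rewrite -(cnN (z N - l)) opprB; have := cnD (l - z N) (z N - k); rewrite addrA subrK.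
Qed.
Lemma climit_conj z l : climit z l -> climit (fun n => Num.conj (z n)) (Num.conj l).
Proof. by move=> hz; apply: nulls_le hz => n; rewrite -rmorphB cnJ. Qed.
Lemma climit_ge0 z l : (forall n, 0 <= z n) -> climit z l -> 0 <= l.
Proof.
move=> z0 hz; apply: (@ge0c_closed _ _ 1) => e /hz[N hN]; exists (z N) => //.
by rewrite mulr1 -cnN opprB hN.
Qed.
Lemma climit_cn_le z l r b : (forall n, cn (z n) <= r n) -> climit z l ->
  nulls (fun n => r n - b) -> cn l <= b.
Proof.
move=> zr hz hr; apply/ler_addgt0Pr => e e0.
have [N hN] := nullsD hz hr e0; have := hN N (leqnn N); have := zr N.
have := cnD (z N) (l - z N); rewrite addrC subrK -(cnN (l - z N)) opprB; lra.
Qed.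
Lemma climit_shift z w l : climit z l -> nulls (fun n => cn (z n - w n)) -> climit w l.
Proof.
move=> h1 h2; apply: nulls_le (nullsD h1 h2) => n.
rewrite -(cnN (z n - w n)) opprB [leRHS]addrC.
by have := cnD (w n - z n) (z n - l); rewrite addrA subrK.
Qed.

Lemma climit_sum (I : finType) (F : I -> nat -> R[i]) (l : I -> R[i]) :
  (forall i, climit (F i) (l i)) -> climit (fun n => \sum_i F i n) (\sum_i l i).
Proof.
move=> h; have : forall s : seq I,
    climit (fun n => \sum_(i <- s) F i n) (\sum_(i <- s) l i).
  elim=> [|i s ih].
    by apply: nulls_le nulls0 => n; rewrite !big_nil subrr cn0.
  apply: nulls_le (climitD (h i) ih) => n; by rewrite !big_cons.
by move=> /(_ (index_enum I)).
Qed.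

Lemma cauchy_climit z :
  (forall e : R, 0 < e -> exists N, forall m n, (N <= m)%N -> (N <= n)%N ->
     cn (z m - z n) <= e) -> exists l, climit z l.
Proof.
move=> hz.
have real_lim (f : nat -> R) : (forall e : R, 0 < e -> exists N, forall m n,
    (N <= m)%N -> (N <= n)%N -> `|f m - f n| <= e) ->
    exists l, nulls (fun n => `|f n - l|).
  move=> hf; have : cauchy (f @ \oo).
    apply/cauchy_exP => e e0; have e2 : 0 < e / 2 by lra.
    have [N hN] := hf _ e2; exists (f N); exists N => // n Nn /=.
    by rewrite -ball_normE /=; apply: (le_lt_trans (hN _ _ (leqnn N) Nn)); lra.
  move=> /cauchy_cvg/cvg_ex[l /= fl]; exists l => e e0.
  have [N _ hN] : \forall n \near \oo, ball l e (f n) by exact: (cvg_ball fl).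
  by exists N => n /hN; rewrite -ball_normE /= distrC => /ltW.
have [a ha] : exists l, nulls (fun n => `|re (z n) - l|).
  apply: real_lim => e /hz[N hN]; exists N => m n Nm Nn.
  by apply: le_trans (hN m n Nm Nn); rewrite -reN -reD normr_re_le.
have [b hb] : exists l, nulls (fun n => `|im (z n) - l|).
  apply: real_lim => e /hz[N hN]; exists N => m n Nm Nn.
  by apply: le_trans (hN m n Nm Nn); rewrite -imN -imD normr_im_le.
exists (a +i* b); apply: nulls_le (nullsD ha hb) => n.
by apply: (le_trans (cn_le_reim _)); rewrite reD imD reN imN.
Qed.
End Sequences.

Section Kernels.
Variables (R : realType) (G : Type).
Implicit Types (k : G -> G -> R[i]) (l : seq (R[i] * G)).

(** Lists of weighted points stand for formal linear combinations of points of G, and [kform] is the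
    sesquilinear form on them. Different lists may denote the same combination; only their forms are
    ever compared. *)
Definition kform k l l' : R[i] :=
  \sum_(p <- l) \sum_(q <- l') p.1 * Num.conj q.1 * k p.2 q.2.
Definition lscale (a : R[i]) l := [seq (a * p.1, p.2) | p <- l].
Definition lsub l l' := l ++ lscale (-1) l'.

Lemma kform_catl k l1 l2 l' : kform k (l1 ++ l2) l' = kform k l1 l' + kform k l2 l'.
Proof. by rewrite /kform big_cat. Qed.
Lemma kform_catr k l1 l2 l' : kform k l' (l1 ++ l2) = kform k l' l1 + kform k l' l2.
Proof. by rewrite /kform -big_split; apply: eq_bigr => p _; rewrite big_cat. Qed.
Lemma kform_scalel k a l l' : kform k (lscale a l) l' = a * kform k l l'.
Proof.
rewrite /kform big_map mulr_sumr; apply: eq_bigr => p _; rewrite mulr_sumr.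
by apply: eq_bigr => q _; rewrite /= !mulrA.
Qed.
Lemma kform_scaler k a l l' : kform k l (lscale a l') = Num.conj a * kform k l l'.
Proof.
rewrite /kform mulr_sumr; apply: eq_bigr => p _; rewrite big_map mulr_sumr.
by apply: eq_bigr => q _; rewrite /= rmorphM; ring.
Qed.
Lemma kform_subl k l1 l2 l' : kform k (lsub l1 l2) l' = kform k l1 l' - kform k l2 l'.
Proof. by rewrite kform_catl kform_scalel mulN1r. Qed.
Lemma kform_subr k l1 l2 l' : kform k l' (lsub l1 l2) = kform k l' l1 - kform k l' l2.
Proof. by rewrite kform_catr kform_scaler rmorphN rmorph1 mulN1r. Qed.
Lemma kform_1 k a b : kform k [:: (1, a)] [:: (1, b)] = k a b.
Proof. by rewrite /kform !big_seq1 /= rmorph1 !mul1r. Qed.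
Lemma kform_consr k l p l' : kform k l (p :: l') = Num.conj p.1 * kform k l [:: (1, p.2)] + kform k l l'.
Proof.
rewrite /kform mulr_sumr -big_split; apply: eq_bigr => q _ /=.
by rewrite big_cons big_seq1 /= rmorph1; ring.
Qed.
Lemma kform_nilr k l : kform k l [::] = 0.
Proof. by rewrite /kform big1 // => q _; rewrite big_nil. Qed.

Definition kformE := (kform_catl, kform_catr, kform_scalel, kform_scaler).

Definition kernel_psd k := forall l, 0 <= kform k l l.

Section Psd.
Variables (k : G -> G -> R[i]) (psd : kernel_psd k).
Let F := kform k.

Lemma kform_herm l l' : F l l' = Num.conj (F l' l).
Proof.
have im0 m : im (F m m) = 0 by exact: ge0_im.
have imE m m' : im (F m m') = - im (F m' m).
  by have := im0 (m ++ m'); rewrite /F kform_catl !kform_catr !imD -/F !im0 => h; lra.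
apply: ceqP; rewrite !cE; last exact: imE.
have := imE (lscale 'i%C l) l'; rewrite /F kform_scalel kform_scaler !imM !cE -/F.
by rewrite !mul0r !mul1r !add0r mulN1r opprK.
Qed.

Definition sn l : R := Num.sqrt (re (F l l)).
Lemma sn_ge0 l : 0 <= sn l. Proof. exact: sqrtr_ge0. Qed.
Lemma sn_sq l : sn l ^+ 2 = re (F l l).
Proof. by rewrite sqr_sqrtr // ge0_re. Qed.
Lemma kform_cs l l' : cn (F l l') <= sn l * sn l'.
Proof.
rewrite -(@ler_pXn2r _ 2) ?nnegrE ?cn_ge0 ?mulr_ge0 ?sn_ge0 // exprMn !sn_sq mulrC.
apply: discriminant; first exact/ge0_re/psd.
move=> s; have := ge0_re (psd (lscale s l ++ l')).
rewrite kform_catl !kform_catr !kform_scalel !kform_scaler -/F (kform_herm l' l).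
rewrite !cE cn_sq (ge0_im (psd l)) => h; apply: (le_trans h).
by rewrite le_eqVlt; apply/orP; left; apply/eqP; ring.
Qed.
Lemma snD l l' : sn (l ++ l') <= sn l + sn l'.
Proof.
rewrite -(@ler_pXn2r _ 2) ?nnegrE ?sn_ge0 ?addr_ge0 ?sn_ge0 //.
rewrite sn_sq /F kform_catl !kform_catr -/F (kform_herm l' l) sqrrD !sn_sq !cE.
by have := le_trans (re_le_cn _) (kform_cs l l'); lra.
Qed.
Lemma snZ a l : sn (lscale a l) = cn a * sn l.
Proof.
apply/eqP; rewrite -(@eqrXn2 _ 2) ?sn_ge0 ?mulr_ge0 ?cn_ge0 ?sn_ge0 //.
rewrite exprMn !sn_sq /F kform_scalel kform_scaler mulrA mulJ -/F !cE.
by rewrite mul0r subr0.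
Qed.
Lemma sn_sub_le l l' : sn l <= sn l' + sn (lsub l l').
Proof.
have -> : sn l = sn (l' ++ lsub l l'); last exact: snD.
apply/eqP; rewrite -(@eqrXn2 _ 2) ?sn_ge0 // !sn_sq.
rewrite /F /lsub !kformE rmorphN rmorph1.
by apply/eqP; congr re; ring.
Qed.

Implicit Types (u v w : nat -> seq (R[i] * G)) (g h : G -> R[i]).
Definition lcauchy v := forall e : R, 0 < e -> exists N, forall m n,
  (N <= m)%N -> (N <= n)%N -> sn (lsub (v m) (v n)) <= e.
Definition represents v g := lcauchy v /\
  forall b, climit (fun n => F (v n) [:: (1, b)]) (g b).

Lemma lcauchy_bounded v : lcauchy v -> exists2 B, 0 <= B & exists N, forall n, (N <= n)%N -> sn (v n) <= B.
Proof.
move=> /(_ 1 ltr01)[N hN]; exists (sn (v N) + 1); first by rewrite addr_ge0 ?sn_ge0.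
exists N => n Nn; apply: (le_trans (sn_sub_le _ (v N))).
by rewrite lerD2l hN.
Qed.

(** Write |u_n|^2 = <u_n, u_n - u_L> + <u_n, u_L>. The first term is small by the Cauchy property
    and boundedness, the second tends to 0 because u_L is a fixed finite combination of points. *)
Lemma lcauchy_null u : lcauchy u ->
  (forall b, climit (fun n => F (u n) [:: (1, b)]) 0) -> nulls (fun n => sn (u n)).
Proof.
move=> cu hu e e0; have [B B0 [M hM]] := lcauchy_bounded cu.
have lim l : climit (fun n => F (u n) l) 0.
  elim: l => [|p l ih].
    by apply: nulls_le (@nulls0 R) => n; rewrite /F kform_nilr subr0 cn0.
  apply: nulls_le (climitD (climitZ (Num.conj p.1) (hu p.2)) ih) => n.
  by rewrite /F kform_consr mulr0 addr0.
have B1 : 0 < 2 * (B + 1) by lra.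
have e1 : 0 < e ^+ 2 / (2 * (B + 1)) by rewrite divr_gt0 // exprn_gt0.
have [N hN] := cu _ e1; set L := maxn N M.
have e2 : 0 < e ^+ 2 / 2 by rewrite divr_gt0 // exprn_gt0.
have [N' hN'] := lim (u L) _ e2; exists (maxn L N') => n.
rewrite geq_max => /andP[Ln N'n].
have Nn : (N <= n)%N by apply: leq_trans Ln; exact: leq_maxl.
have Mn : (M <= n)%N by apply: leq_trans Ln; exact: leq_maxr.
rewrite -(@ler_pXn2r _ 2) ?nnegrE ?sn_ge0 ?(ltW e0) // sn_sq.
have -> : F (u n) (u n) = F (u n) (lsub (u n) (u L)) + F (u n) (u L).
  by rewrite /F kform_subr subrK.
rewrite reD; have h1 := le_trans (re_le_cn _) (kform_cs (u n) (lsub (u n) (u L))).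
have h2 := le_trans (re_le_cn _) (hN' n N'n); rewrite subr0 in h2.
have h3 := hN n L Nn (leq_maxl _ _); rewrite ler_pdivlMr // in h3.
have h4 := hM n Mn; have := sn_ge0 (u n); have := sn_ge0 (lsub (u n) (u L)).
move: h1 h2 h3 h4; rewrite -/F.
move: (sn (lsub _ _)) (sn _) (re _) (re _) (e ^+ 2) => *; nra.
Qed.

(** This makes the completion well defined: a function on G determines its Cauchy sequence up to a
    null sequence. *)
Lemma represents_diff v v' g : represents v g -> represents v' g ->
  nulls (fun n => sn (lsub (v n) (v' n))).
Proof.
move=> [cv hv] [cv' hv']; apply: (@lcauchy_null (fun n => lsub (v n) (v' n))).
  move=> e e0; have e2 : 0 < e / 2 by lra.
  have [N hN] := cv _ e2; have [M hM] := cv' _ e2; exists (maxn N M) => m n.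
  rewrite !geq_max => /andP[Nm Mm] /andP[Nn Mn].
  have -> : sn (lsub (lsub (v m) (v' m)) (lsub (v n) (v' n))) =
      sn (lsub (v m) (v n) ++ lsub (v' n) (v' m)).
    apply/eqP; rewrite -(@eqrXn2 _ 2) ?sn_ge0 // !sn_sq.
    rewrite /F /lsub !kformE rmorphN rmorph1.
    by apply/eqP; congr re; ring.
  apply: (le_trans (snD _ _)); have := hN m n Nm Nn; have := hM n m Mn Mm; lra.
move=> b; have := climitD (hv b) (climitZ (-1) (hv' b)); rewrite mulN1r subrr.
by apply: nulls_le => n; rewrite /F kform_subl mulN1r.
Qed.

Lemma represents_lin a v v' g h : represents v g -> represents v' h ->
  represents (fun n => lscale a (v n) ++ v' n) (a *: g + h : G -> R[i]).
Proof.
move=> [cv hv] [cv' hv']; split.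
  move=> e e0; have c1 : 0 < cn a + 1 by have := cn_ge0 a; lra.
  have d0 := divr_gt0 e0 c1; have : e / (cn a + 1) * (cn a + 1) = e by rewrite divfK ?gt_eqF.
  move: (e / _) d0 => d d0 ed.
  have [N hN] := cv _ d0; have [M hM] := cv' _ d0; exists (maxn N M) => m n.
  rewrite !geq_max => /andP[Nm Mm] /andP[Nn Mn].
  have -> : sn (lsub (lscale a (v m) ++ v' m) (lscale a (v n) ++ v' n)) =
      sn (lscale a (lsub (v m) (v n)) ++ lsub (v' m) (v' n)).
    apply/eqP; rewrite -(@eqrXn2 _ 2) ?sn_ge0 // !sn_sq.
    rewrite /F /lsub !kformE rmorphN rmorph1.
    by apply/eqP; congr re; ring.
  apply: (le_trans (snD _ _)); rewrite snZ.
  have := hN m n Nm Nn; have := hM m n Mm Mn; have := cn_ge0 a; nra.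
move=> b; apply: nulls_le (climitD (climitZ a (hv b)) (hv' b)) => n.
by rewrite /F kform_catl kform_scalel.
Qed.

Lemma represents0 : represents (fun=> [::]) (fun=> 0).
Proof.
split=> [e e0|b].
  exists 0%N => m n _ _; rewrite /sn /F /kform !big_nil sqrtr0 //; exact: ltW.
by apply: nulls_le (@nulls0 R) => n; rewrite /F /kform big_nil subrr cn0.
Qed.

Lemma represents_const l : represents (fun=> l) (fun b => F l [:: (1, b)]).
Proof.
split=> [e e0|b]; last exact: climit_const.
exists 0%N => m n _ _; rewrite /sn /F kform_subl !kform_subr !subrr sqrtr0.
exact: ltW.
Qed.

Lemma lcauchy_represents v : lcauchy v -> exists g, represents v g.
Proof.
move=> cv; have /choice[g hg] : forall b, exists z, climit (fun n => F (v n) [:: (1, b)]) z.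
  move=> b; apply: cauchy_climit => e e0.
  have s1 : 0 < sn [:: (1, b)] + 1 by have := sn_ge0 [:: (1, b)]; lra.
  have [N hN] := cv _ (divr_gt0 e0 s1); exists N => m n Nm Nn.
  rewrite -kform_subl; apply: (le_trans (kform_cs _ _)).
  have := hN m n Nm Nn; rewrite ler_pdivlMr // => h; apply: le_trans h.
  by rewrite ler_wpM2l ?sn_ge0 // lerDl.
by exists g.
Qed.

Definition kbounded (c : G -> G -> R[i]) (C : R) :=
  0 <= C /\ forall l l', cn (kform c l l') <= C * (sn l * sn l').

Lemma kbounded_self : kbounded k 1.
Proof. by split=> // l l'; rewrite mul1r kform_cs. Qed.

(** A kernel bounded by the seminorm extends to limits, with a value independent of the representing
    sequences; neither positivity nor symmetry of [c] enters. *)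
Lemma kform_climit c C v w g h : kbounded c C -> represents v g -> represents w h ->
  exists z, forall v' w', represents v' g -> represents w' h ->
    climit (fun n => kform c (v' n) (w' n)) z.
Proof.
move=> [C0 hC] vg wh; have [cv _] := vg; have [cw _] := wh.
have [B B0 [NB hB]] := lcauchy_bounded cv; have [D D0 [ND hD]] := lcauchy_bounded cw.
have [z hz] : exists z, climit (fun n => kform c (v n) (w n)) z.
  apply: cauchy_climit => e e0; set P := C * (D + B + 1).
  have P1 : 0 < P + 1 by rewrite /P; nra.
  have [N hN] := cv _ (divr_gt0 e0 P1); have [M hM] := cw _ (divr_gt0 e0 P1).
  exists (maxn (maxn N M) (maxn NB ND)) => m n; rewrite !geq_max.
  move=> /andP[/andP[Nm Mm] /andP[NBm NDm]] /andP[/andP[Nn Mn] /andP[NBn NDn]].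
  have -> : kform c (v m) (w m) - kform c (v n) (w n) =
      kform c (lsub (v m) (v n)) (w m) + kform c (v n) (lsub (w m) (w n)).
    by rewrite kform_subl kform_subr addrA subrK.
  apply: (le_trans (cnD _ _)); apply: (le_trans (lerD (hC _ _) (hC _ _))).
  have h1 := hN m n Nm Nn; have h2 := hM m n Mm Mn; have h3 := hD m NDm; have h4 := hB n NBn.
  have h5 : e / (P + 1) * (P + 1) = e by rewrite divfK ?gt_eqF.
  have d0 := divr_gt0 e0 P1.
  rewrite -mulrDr; apply: (@le_trans _ _ (C * (e / (P + 1) * (D + B)))).
    rewrite ler_wpM2l // mulrDr lerD //; first by rewrite ler_pM ?sn_ge0.
    by rewrite mulrC ler_pM ?sn_ge0.
  rewrite -[leRHS]h5 /P mulrCA; rewrite ler_wpM2l ?(ltW d0) //; nra.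
exists z => v' w' v'g w'h; apply: climit_shift hz _.
have n1 := represents_diff vg v'g; have n2 := represents_diff wh w'h.
have [B' B'0 [NB' hB']] := lcauchy_bounded v'g.1.
move=> e e0.
have nn := nullsD (nullsM (mulr_ge0 C0 D0) (fun n => sn_ge0 _) n1)
  (nullsM (mulr_ge0 C0 B'0) (fun n => sn_ge0 _) n2).
have [N hN] := nn e e0; exists (maxn N (maxn ND NB')) => n; rewrite !geq_max.
move=> /andP[Nn /andP[NDn NBn]]; apply: le_trans (hN n Nn).
have -> : kform c (v n) (w n) - kform c (v' n) (w' n) =
    kform c (lsub (v n) (v' n)) (w n) + kform c (v' n) (lsub (w n) (w' n)).
  by rewrite kform_subl kform_subr addrA subrK.
apply: (le_trans (cnD _ _)); apply: (le_trans (lerD (hC _ _) (hC _ _))).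
rewrite -!mulrA; apply: lerD; rewrite ler_wpM2l //.
  by rewrite mulrC ler_wpM2r ?sn_ge0 ?hD.
by rewrite ler_wpM2r ?sn_ge0 ?hB'.
Qed.
End Psd.
End Kernels.
Lemma four_quarters (R : realType) (e : R) : e / 4 + (e / 4 + e / 4 + e / 4) <= e.
Proof. lra. Qed.
Lemma three_quarters (R : realType) (e : R) : 0 < e -> e / 4 + (e / 4 + e / 4) < e.
Proof. lra. Qed.

Section KernelSpace.
Variables (R : realType) (G : Type) (k : G -> G -> R[i]).

(** As in a reproducing kernel space, a vector x of the completion is encoded by the function b |->
    <x, b> on G. Equality is then equality of functions, and no quotient by null vectors has to be
    formed. *)
Definition kpred : {pred (G -> R[i])} :=
  fun g => `[< exists v, represents k v g >].

Record kspace (psd : kernel_psd k) := KSpace { kfun : G -> R[i]; _ : kfun \in kpred }.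

Variable psd : kernel_psd k.

Lemma kpredP g : reflect (exists v, represents k v g) (g \in kpred).
Proof. exact: asboolP. Qed.

Lemma kpred_submod : GRing.submod_closed kpred.
Proof.
split; first by apply/kpredP; exists (fun=> [::]); exact: represents0.
move=> a g h /kpredP[v hv] /kpredP[w hw]; apply/kpredP.
by exists (fun n => lscale a (v n) ++ w n); exact: represents_lin.
Qed.
HB.instance Definition _ := GRing.isSubmodClosed.Build R[i] (G -> R[i]) kpred kpred_submod.
HB.instance Definition _ := [isSub for (@kfun psd)].
HB.instance Definition _ := [Choice of kspace psd by <:].
HB.instance Definition _ := [SubChoice_isSubLmodule of kspace psd by <:].

Implicit Types (x y z : kspace psd) (c : G -> G -> R[i]).

Lemma kspaceP x y : (forall b, kfun x b = kfun y b) -> x = y.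
Proof. by move=> h; apply: val_inj; apply/funext. Qed.

Lemma krep_ex x : exists v, represents k v (kfun x).
Proof. by apply/kpredP; case: x. Qed.

Lemma kfun_lin a x y : kfun (a *: x + y) = (a *: kfun x + kfun y : G -> R[i]).
Proof. by []. Qed.

Lemma represents_add a v w x y : represents k v (kfun x) -> represents k w (kfun y) ->
  represents k (fun n => lscale a (v n) ++ w n) (kfun (a *: x + y)).
Proof. by move=> vx wy; rewrite kfun_lin; exact: represents_lin. Qed.

Definition kext c x y : R[i] := xget 0 [set z | forall v w,
  represents k v (kfun x) -> represents k w (kfun y) ->
  climit (fun n => kform c (v n) (w n)) z].

Lemma kextP c C v w x y : kbounded k c C -> represents k v (kfun x) ->
  represents k w (kfun y) -> climit (fun n => kform c (v n) (w n)) (kext c x y).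
Proof.
move=> bc vx wy; have [z hz] := kform_climit psd bc vx wy.
by rewrite /kext; case: xgetP => [z' -> h|/(_ z)[]//]; exact: h.
Qed.

Section Form.
Variables (c : G -> G -> R[i]) (C : R).
Hypothesis bc : kbounded k c C.

Lemma kext_linl a x y z : kext c (a *: x + y) z = a * kext c x z + kext c y z.
Proof.
have [v vx] := krep_ex x; have [w wy] := krep_ex y; have [u uz] := krep_ex z.
apply: (climit_uniq (kextP bc (represents_add a vx wy) uz)).
apply: nulls_le (climitD (climitZ a (kextP bc vx uz)) (kextP bc wy uz)) => n.
by rewrite !kformE.
Qed.

Lemma kext_linr a x y z : kext c z (a *: x + y) = Num.conj a * kext c z x + kext c z y.
Proof.
have [v vx] := krep_ex x; have [w wy] := krep_ex y; have [u uz] := krep_ex z.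
apply: (climit_uniq (kextP bc uz (represents_add a vx wy))).
apply: nulls_le (climitD (climitZ (Num.conj a) (kextP bc uz vx)) (kextP bc uz wy)) => n.
by rewrite !kformE.
Qed.
End Form.

Let bk := kbounded_self psd.

Lemma kext_herm x y : kext k x y = Num.conj (kext k y x).
Proof.
have [v vx] := krep_ex x; have [w wy] := krep_ex y.
apply: (climit_uniq (kextP bk vx wy)).
apply: nulls_le (climit_conj (kextP bk wy vx)) => n.
by rewrite -kform_herm.
Qed.

Lemma kext_ge0 x : 0 <= kext k x x.
Proof.
have [v vx] := krep_ex x; apply: climit_ge0 (kextP bk vx vx) => n; exact: psd.
Qed.

Definition kembed l : kspace psd := KSpace psd (introT (kpredP _)
  (ex_intro _ (fun=> l) (@represents_const R G k l))).

Lemma represents_embed l : represents k (fun=> l) (kfun (kembed l)).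
Proof. exact: represents_const. Qed.

Lemma kext_embed c C l l' : kbounded k c C -> kext c (kembed l) (kembed l') = kform c l l'.
Proof.
move=> bc; apply: (climit_uniq (kextP bc (represents_embed l) (represents_embed l'))).
exact: climit_const.
Qed.

Lemma kfunE x b : kfun x b = kext k x (kembed [:: (1, b)]).
Proof.
have [v vx] := krep_ex x; apply: (climit_uniq (vx.2 b)).
exact: kextP bk vx (represents_embed _).
Qed.

Lemma kext_cs x y : cn (kext k x y) ^+ 2 <= re (kext k x x) * re (kext k y y).
Proof.
rewrite mulrC; apply: discriminant; first exact/ge0_re/kext_ge0.
move=> s; have := ge0_re (kext_ge0 (s *: x + y)).
rewrite (kext_linl bk) !(kext_linr bk) (kext_herm y x).
by rewrite !cE cn_sq (ge0_im (kext_ge0 x)) => h; apply: (le_trans h);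
  rewrite le_eqVlt; apply/orP; left; apply/eqP; ring.
Qed.

Lemma kext_eq0 x : kext k x x = 0 -> x = 0.
Proof.
move=> h; apply: kspaceP => b; rewrite kfunE.
have -> : kfun (0 : kspace psd) b = 0 by [].
apply: cn_eq0; apply/eqP; rewrite -sqrf_eq0 -normr_le0 ger0_norm ?sqr_ge0 //.
by apply: (le_trans (kext_cs _ _)); rewrite h re0 mul0r.
Qed.

Definition knorm x : R := Num.sqrt (re (kext k x x)).
Lemma knorm_sq x : knorm x ^+ 2 = re (kext k x x).
Proof. by rewrite sqr_sqrtr // ge0_re // kext_ge0. Qed.
Lemma knorm_ge0 x : 0 <= knorm x. Proof. exact: sqrtr_ge0. Qed.

Lemma kextD x y : kext k (x + y) (x + y) = kext k x x + kext k x y + (kext k y x + kext k y y).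
Proof.
have E u v w : kext k (u + v) w = kext k u w + kext k v w.
  by rewrite -{1}[u]scale1r (kext_linl bk) mul1r.
have E' u v w : kext k w (u + v) = kext k w u + kext k w v.
  by rewrite -{1}[u]scale1r (kext_linr bk) rmorph1 mul1r.
by rewrite E !E'.
Qed.
Lemma kextZ a x y : kext k (a *: x) y = a * kext k x y.
Proof.
have z0 : kext k 0 y = 0.
  have := kext_linl bk 1 0 0 y; rewrite scale1r addr0 mul1r => /eqP.
  by rewrite -subr_eq0 opprD addrA subrr add0r oppr_eq0 => /eqP.
by rewrite -[a *: x]addr0 (kext_linl bk) z0 addr0.
Qed.

Definition kcnorm x : R[i] := (knorm x)%:C.

Lemma kcnormD x y : kcnorm (x + y) <= kcnorm x + kcnorm y.
Proof.
rewrite /kcnorm -rmorphD lecR.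
rewrite -(@ler_pXn2r _ 2) ?nnegrE ?knorm_ge0 ?addr_ge0 ?knorm_ge0 //.
rewrite sqrrD !knorm_sq kextD (kext_herm y x) !cE.
have : re (kext k x y) <= knorm x * knorm y.
  apply: (le_trans (re_le_cn _)).
  rewrite -(@ler_pXn2r _ 2) ?nnegrE ?cn_ge0 ?mulr_ge0 ?knorm_ge0 //.
  by rewrite exprMn !knorm_sq kext_cs.
lra.
Qed.
Lemma kcnormZ (a : R[i]) x : kcnorm (a *: x) = `|a| * kcnorm x.
Proof.
rewrite /kcnorm cnE -rmorphM; congr (_%:C); apply/eqP.
rewrite -(@eqrXn2 _ 2) ?knorm_ge0 ?mulr_ge0 ?cn_ge0 ?knorm_ge0 //.
rewrite exprMn !knorm_sq kextZ (kext_herm x (a *: x)) kextZ.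
by rewrite !cE cn_sq (ge0_im (kext_ge0 x)); apply/eqP; ring.
Qed.
Lemma kcnorm0_eq0 x : kcnorm x = 0 -> x = 0.
Proof.
move=> /realC_inj h; apply: kext_eq0; apply: ceqP; last exact/ge0_im/kext_ge0.
by rewrite -knorm_sq h expr0n.
Qed.

HB.instance Definition _ := @Lmodule_isNormed.Build R[i] (kspace psd)
  kcnorm kcnormD kcnormZ kcnorm0_eq0.

Lemma knormE x : `|x| = (knorm x)%:C. Proof. by []. Qed.

Lemma kembed_dense x v : represents k v (kfun x) ->
  nulls (fun n => knorm (x - kembed (v n))).
Proof.
move=> vx e e0; have [N hN] := vx.1 _ e0; exists N => n Nn.
rewrite -(@ler_pXn2r _ 2) ?nnegrE ?knorm_ge0 ?(ltW e0) // knorm_sq.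
apply: (le_trans (re_le_cn _)).
have hr := represents_add (-1) (represents_embed (v n)) vx.
have -> : x - kembed (v n) = -1 *: kembed (v n) + x by rewrite scaleN1r addrC.
apply/ler_addgt0Pr => d d0; have [M hM] := kextP bk hr hr d0.
set m := maxn N M; have := hM m (leq_maxr _ _) => {}hM.
set l := lscale (-1) (v n) ++ v m in hM.
have -> : kext k (-1 *: kembed (v n) + x) (-1 *: kembed (v n) + x) =
   kform k l l - (kform k l l - kext k (-1 *: kembed (v n) + x) (-1 *: kembed (v n) + x)).
  by rewrite subKr.
apply: (le_trans (cnD _ _)); rewrite cnN lerD //.
apply: (le_trans (kform_cs psd _ _)); rewrite -expr2 ler_pXn2r ?nnegrE ?sn_ge0 ?(ltW e0) //.
have -> : sn k l = sn k (lsub (v m) (v n)); last by apply: hN => //; exact: leq_maxl.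
apply/eqP; rewrite -(@eqrXn2 _ 2) ?sn_ge0 // !sn_sq //.
by rewrite /l /lsub !kformE rmorphN rmorph1; apply/eqP; congr re; ring.
Qed.

Lemma knorm_embed l : knorm (kembed l) = sn k l.
Proof. by rewrite /knorm (kext_embed _ _ bk). Qed.

Lemma kembed_sub l l' : kembed (lsub l l') = kembed l - kembed l'.
Proof.
have -> : kembed l - kembed l' = -1 *: kembed l' + kembed l by rewrite scaleN1r addrC.
apply: kspaceP => b; rewrite kfun_lin.
change (kform k (lsub l l') [:: (1, b)] =
  -1 * kform k l' [:: (1, b)] + kform k l [:: (1, b)]).
by rewrite kform_subl mulN1r addrC.
Qed.

Lemma knorm_tri z x y : knorm (x - y) <= knorm (x - z) + knorm (z - y).
Proof. by have := kcnormD (x - z) (z - y); rewrite addrA subrK -rmorphD lecR. Qed.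
Lemma knorm_subC x y : knorm (x - y) = knorm (y - x).
Proof.
rewrite -opprB -scaleN1r; apply: realC_inj; rewrite -/(kcnorm _) kcnormZ.
by rewrite normrN normr1 mul1r.
Qed.

(** Pick centres x_n of balls of radius 1/(n+1) belonging to the filter, and finite combinations v_n
    within 1/(n+1) of them. The sequence v is Cauchy, and the function it represents is the
    limit. *)
Lemma kspace_complete (F : set_system (kspace psd)) :
  ProperFilter F -> cauchy F -> cvg F.
Proof.
move=> FF /cauchyP cF.
have /choice[x hx] : forall n : nat, exists x : kspace psd, F (ball x ((n.+1%:R^-1 : R)%:C : R[i])).
  by move=> n; apply: cF; rewrite ltcR invr_gt0.
have inb (a b : kspace psd) (e : R) : ball a (e%:C : R[i]) b <-> knorm (a - b) < e.
  by rewrite -ball_normE /= knormE ltcR.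
have /choice[v hv] : forall n, exists l, knorm (x n - kembed l) <= n.+1%:R^-1.
  move=> n; have [w wx] := krep_ex (x n).
  have n0 : (0 : R) < n.+1%:R^-1 by rewrite invr_gt0.
  by have [N hN] := kembed_dense wx n0; exists (w N); exact: hN.
have xx m n : knorm (x m - x n) <= m.+1%:R^-1 + n.+1%:R^-1.
  have [a [/inb h1 /inb h2]] := filter_ex (filterI (hx m) (hx n)).
  apply: (le_trans (knorm_tri a _ _)); rewrite (knorm_subC a).
  by rewrite lerD ?ltW.
have cv : lcauchy k v.
  move=> e e0; have e4 : 0 < e / 4 by lra.
  have [N hN] := small_invS e4; exists N => m n Nm Nn.
  rewrite -knorm_embed kembed_sub.
  apply: (le_trans (knorm_tri (x m) _ _)); rewrite knorm_subC.
  have hm := hN m Nm; have hn := hN n Nn.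
  have h1 := le_trans (hv m) hm; have h2 := le_trans (hv n) hn.
  have h3 := le_trans (xx m n) (lerD hm hn).
  have h4 := le_trans (knorm_tri (x n) (x m) (kembed (v n))) (lerD h3 h2).
  exact: le_trans (lerD h1 h4) (four_quarters e).
have [g vg] := lcauchy_represents psd cv.
have gP : g \in kpred by apply/kpredP; exists v.
pose y : kspace psd := KSpace psd gP.
have vy : represents k v (kfun y) by [].
apply/cvg_ex; exists y; apply/cvg_ballP => e e0.
have eE : e = (re e)%:C by apply: ceqP; rewrite ?cE // (ge0_im (ltW e0)).
have re0 : 0 < re e by rewrite -ltcR -eE.
have e4 : 0 < re e / 4 by lra.
have [N hN] := small_invS e4; have [M hM] := kembed_dense vy e4.
set n := maxn N M; have n1 := hN n (leq_maxl _ _); have n2 := hM n (leq_maxr _ _).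
apply: filterS (hx n) => a /inb xa; rewrite eE; apply/inb.
have h1 := le_trans (hv n) n1; rewrite knorm_subC in h1.
have h2 := le_trans (knorm_tri (x n) (kembed (v n)) a) (lerD h1 (le_trans (ltW xa) n1)).
apply: (le_lt_trans (le_trans (knorm_tri (kembed (v n)) y a) (lerD n2 h2))).
exact: three_quarters.
Qed.
HB.instance Definition _ := Uniform_isComplete.Build (kspace psd) kspace_complete.

Definition kdot (x y : kspace psd) : R[i] := kext k x y.

Lemma kdot_linearl y : linear_for *%R (kdot^~ y).
Proof. by move=> a u v; rewrite /kdot (kext_linl bk). Qed.
Lemma kdot_linearr x : linear_for (Num.conj \; *%R) (kdot x).
Proof. by move=> a u v; rewrite /kdot (kext_linr bk). Qed.
HB.instance Definition _ := bilinear_isBilinear.Build R[i] (kspace psd) (kspace psd) R[i]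
  *%R (Num.conj \; *%R) kdot (kdot_linearl, kdot_linearr).
Lemma kdot_herm x y : kdot x y = (-1) ^+ false * Num.conj (kdot y x).
Proof. by rewrite expr0 mul1r /kdot kext_herm. Qed.
HB.instance Definition _ := isHermitianSesquilinear.Build R[i] (kspace psd) false
  Num.conj kdot kdot_herm.
Lemma kdot_gt0 x : x != 0 -> 0 < kdot x x.
Proof.
move=> x0; rewrite lt_def kext_ge0 andbT; apply: contra x0 => /eqP h.
by apply/eqP/kext_eq0.
Qed.
HB.instance Definition _ := isDotProduct.Build R[i] (kspace psd) kdot kdot_gt0.

Lemma kdot_norm x : (kdot : {dot (kspace psd) for @Num.conj R[i]}) x x = `|x| ^+ 2.
Proof.
rewrite knormE -rmorphXn knorm_sq; apply: ceqP => //.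
by rewrite imC (ge0_im (kext_ge0 x)).
Qed.

Definition khilbert : hilbert R :=
  @Hilbert R (kspace psd) (kdot : {dot (kspace psd) for @Num.conj R[i]}) kdot_norm.
End KernelSpace.

(** * Operators on a kernel space defined by bounded kernels *)

Section KernelOperators.
Variables (R : realType) (G : Type) (k : G -> G -> R[i]) (psd : kernel_psd k).
Local Notation KH := (khilbert psd).
Implicit Types (c : G -> G -> R[i]) (C : R).

Definition kpoint (a : G) : KH := kembed psd [:: (1, a)].

Lemma hdot_kernel (x y : KH) : hdot KH x y = kext k x y. Proof. by []. Qed.
Lemma nr_kernel (x : KH) : nr x = knorm x. Proof. by []. Qed.

Lemma kext_bound c C (x y : KH) : kbounded k c C ->
  cn (kext c x y) <= C * (nr x * nr y).
Proof.
move=> bc; have [v vx] := krep_ex x; have [w wy] := krep_ex y.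
apply: (@climit_cn_le R _ _ (fun n => C * (sn k (v n) * sn k (w n))) _
  (fun n => bc.2 _ _) (kextP bc vx wy)).
move=> e e0; have [C0 _] := bc; set X := nr x; set Y := nr y.
have X0 : 0 <= X := nr_ge0 _; have Y0 : 0 <= Y := nr_ge0 _.
set P := C * (X + Y + 1).
have P1 : 0 < P + 1 by rewrite ltr_wpDl // mulr_ge0 // addr_ge0 // addr_ge0.
have d0 : 0 < Num.min 1 (e / (P + 1)) by rewrite lt_min ltr01 divr_gt0.
have [N hN] := kembed_dense vx d0; have [M hM] := kembed_dense wy d0.
have d1 : Num.min 1 (e / (P + 1)) <= 1 by rewrite ge_min lexx.
have d2 : Num.min 1 (e / (P + 1)) * (P + 1) <= e.
  by rewrite -ler_pdivlMr // ge_min lexx orbT.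
move: (Num.min _ _) d0 d1 d2 hN hM => d d0 d1 d2 hN hM.
exists (maxn N M) => n; rewrite geq_max => /andP[/hN a1 /hM a2].
have b1 : sn k (v n) <= X + d.
  rewrite -(knorm_embed psd); apply: le_trans (lerD (lexx X) a1).
  have := nrD x (kembed psd (v n) - x : KH); rewrite addrC subrK nrB !nr_kernel.
  by [].
have b2 : sn k (w n) <= Y + d.
  rewrite -(knorm_embed psd); apply: le_trans (lerD (lexx Y) a2).
  have := nrD y (kembed psd (w n) - y : KH); rewrite addrC subrK nrB !nr_kernel.
  by [].
have b3 := ler_pM (sn_ge0 k _) (sn_ge0 k _) b1 b2.
have b4 := ler_wpM2l C0 b3.
rewrite lerBlDr; apply: (le_trans b4).
apply: (@le_trans _ _ (d * (P + 1) + C * (X * Y))); last by rewrite lerD2r.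
have b5 : C * (d * d) <= C * d by rewrite ler_wpM2l // ler_piMl // ltW.
have -> : C * ((X + d) * (Y + d)) = C * (X * Y) + C * d * (X + Y) + C * (d * d) by ring.
have -> : d * (P + 1) + C * (X * Y) = C * (X * Y) + C * d * (X + Y) + C * d + d.
  by rewrite /P; ring.
by rewrite -[leRHS]addrA lerD2l (le_trans b5) // lerDl ltW.
Qed.

(** For fixed x the conjugate of the extended form is a bounded linear functional of the second
    variable, so Riesz supplies the vector A x. *)
Lemma kop_ex c C : kbounded k c C -> exists A : KH -> KH,
  bounded_op KH KH A /\ forall x y, hdot KH (A x) y = kext c x y.
Proof.
move=> bc; have [C0 _] := bc.
have /choice[A hA] : forall x : KH, exists z : KH, forall y, Num.conj (kext c x y) = hdot KH y z.
  move=> x; apply: (@riesz _ KH _ (C * nr x)) => [a u w|y].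
    by rewrite (kext_linr bc) rmorphD rmorphM /= conjCK.
  by rewrite cnJ -mulrA; exact: kext_bound.
have dA x y : hdot KH (A x) y = kext c x y by rewrite dotC -hA conjCK.
exists A; split=> //; apply/bopP; split.
  by move=> a x y; apply: dot_inj => z; rewrite dotDl dotZl !dA (kext_linl bc).
exists C => // x; have [->|/eqP n0] := eqVneq (nr (A x)) 0; first by rewrite mulr_ge0 ?nr_ge0.
have n1 : 0 < nr (A x) by rewrite lt_def nr_ge0 andbT; apply/eqP.
rewrite -(ler_pM2r n1) -expr2.
have -> : nr (A x) ^+ 2 = re (hdot KH (A x) (A x)) by rewrite dotxx reC.
rewrite dA; apply: (le_trans (re_le_cn _)); rewrite -mulrA; exact: kext_bound.
Qed.

Definition kop c : KH -> KH :=
  xget 0 [set A | bounded_op KH KH A /\ forall x y, hdot KH (A x) y = kext c x y].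

Section OneKernel.
Variables (c : G -> G -> R[i]) (C : R).
Hypothesis bc : kbounded k c C.
Lemma kopP : bounded_op KH KH (kop c) /\ forall x y, hdot KH (kop c x) y = kext c x y.
Proof.
have [A hA] := kop_ex bc.
exact: (@xgetI _ 0 [set A | bounded_op KH KH A /\ forall x y, hdot KH (A x) y = kext c x y] A hA).
Qed.
Lemma kop_bop : bounded_op KH KH (kop c). Proof. exact: kopP.1. Qed.
Lemma kop_dot x y : hdot KH (kop c x) y = kext c x y. Proof. exact: kopP.2. Qed.
Lemma kop_points a b : hdot KH (kop c (kpoint a)) (kpoint b) = c a b.
Proof. by rewrite kop_dot (@kext_embed _ _ _ psd _ _ _ _ bc) kform_1. Qed.
End OneKernel.

Lemma kpoint_dot_inj (x y : KH) :
  (forall b, hdot KH x (kpoint b) = hdot KH y (kpoint b)) -> x = y.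
Proof. by move=> h; apply: kspaceP => b; rewrite !kfunE; exact: h. Qed.

Lemma kembed_cons p l : kembed psd (p :: l) = (p.1 *: kpoint p.2 + kembed psd l : KH).
Proof.
apply: kspaceP => b.
change (kform k (p :: l) [:: (1, b)] =
  p.1 * kform k [:: (1, p.2)] [:: (1, b)] + kform k l [:: (1, b)]).
by rewrite -cat1s kform_catl; congr (_ + _); rewrite /kform !big_seq1 /= mul1r !mulrA.
Qed.

Lemma kop_eq (A B : KH -> KH) : bounded_op KH KH A -> bounded_op KH KH B ->
  (forall a, A (kpoint a) = B (kpoint a)) -> A = B.
Proof.
move=> bA bB h; have bD := bopB bA bB; have [d d0 hd] := op_bound bD.
have D0 l : (A - B) (kembed psd l) = 0.
  elim: l => [|p l ih].
    have -> : kembed psd [::] = (0 : KH).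
      apply: kspaceP => b; change (kform k [::] [:: (1, b)] = 0).
      by rewrite /kform big_nil.
    exact: op0.
  by rewrite kembed_cons (opD bD) (opZ bD) ih addr0 !opE h subrr scaler0.
apply/funext => x; apply/eqP; rewrite -subr_eq0; apply/eqP/nr_eq0/eqP.
rewrite -normr_le0; apply/ler_addgt0Pr => e e0; rewrite add0r ger0_norm ?nr_ge0 //.
have [v vx] := krep_ex x; have [N hN] := kembed_dense vx (divr_gt0 e0 d0).
have -> : A x - B x = (A - B) (x - kembed psd (v N) : KH).
  by rewrite (opB bD) D0 subr0 !opE.
apply: (le_trans (hd _)); have := hN N (leqnn N); rewrite -nr_kernel ler_pdivlMr //.
by rewrite mulrC.
Qed.

Lemma kop_mpos n (c : 'I_n -> 'I_n -> G -> G -> R[i]) :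
  (forall i j, exists C, kbounded k (c i j) C) ->
  mpos (fun i j => kop (c i j)) <->
  forall l : 'I_n -> seq (R[i] * G), 0 <= \sum_i \sum_j kform (c i j) (l j) (l i).
Proof.
move=> bc; have dE i j x y : hdot KH (kop (c i j) x) y = kext (c i j) x y.
  by have [C hC] := bc i j; exact: (kop_dot hC).
split=> [h l|h xi].
  have := h (fun i => kembed psd (l i)).
  under eq_bigr => i _ do under eq_bigr => j _ do rewrite dE.
  suff -> : \sum_i \sum_j kext (c i j) (kembed psd (l j)) (kembed psd (l i)) =
    \sum_i \sum_j kform (c i j) (l j) (l i) by [].
  apply: eq_bigr => i _; apply: eq_bigr => j _; have [C hC] := bc i j.
  exact: (@kext_embed _ _ _ psd _ _ _ _ hC).
have /choice[v hv] : forall i, exists v, represents k v (kfun (xi i : kspace psd)).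
  by move=> i; exact: krep_ex.
apply: (@climit_ge0 _ (fun m => \sum_i \sum_j kform (c i j) (v j m) (v i m))).
  by move=> m; exact: h.
apply: climit_sum => i; apply: climit_sum => j; rewrite dE.
by have [C hC] := bc i j; exact: (kextP hC).
Qed.
End KernelOperators.

(** * Criterion for commuting in the envelope *)

Section Criterion.
Variables (R : realType) (H : hilbert R) (S : set (opspace H)) (E : cstar_envelope S).
Hypothesis oS : operator_system S.
Variables (G : Type) (kap : (H -> H) -> G -> G -> R[i]).
Hypothesis kap_lin : forall a x y, S x -> S y -> forall p q,
  kap (a *: x + y) p q = a * kap x p q + kap y p q.
Hypothesis kap_pos : forall n (x : 'I_n -> 'I_n -> H -> H), (forall i j, S (x i j)) ->
  mpos x <-> forall l : 'I_n -> seq (R[i] * G),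
    0 <= \sum_i \sum_j kform (kap (x i j)) (l j) (l i).

Let Sb : forall x, S x -> bounded_op H H x. Proof. by case: oS. Qed.
Let sS : @Defs.subspace _ (opspace H) S. Proof. by case: oS. Qed.
Let S1 : S idfun. Proof. by case: oS. Qed.

Let kform_lin a x y l l' : S x -> S y ->
  kform (kap (a *: x + y)) l l' = a * kform (kap x) l l' + kform (kap y) l l'.
Proof.
move=> Sx Sy; rewrite /kform mulr_sumr -big_split; apply: eq_bigr => p _ /=.
rewrite mulr_sumr -big_split; apply: eq_bigr => q _ /=.
by rewrite kap_lin //; ring.
Qed.

Let kform_id c l l' : kform (kap (c%:C *: idfun)) l l' = c%:C * kform (kap idfun) l l'.
Proof.
have k0 m m' : kform (kap 0) m m' = 0.
  have := kform_lin 1 m m' (subspace0 sS) (subspace0 sS).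
  rewrite scale1r addr0 mul1r => /eqP.
  by rewrite -subr_eq0 opprD addrA subrr add0r oppr_eq0 => /eqP.
have := kform_lin c%:C l l' S1 (subspace0 sS).
by rewrite k0 !addr0.
Qed.

Let psd : kernel_psd (kap idfun).
Proof.
move=> l; have p1 : mpos (fun _ _ : 'I_1 => idfun : H -> H).
  by move=> xi; rewrite !big_ord1; exact: dotxx_ge0.
have := (@kap_pos 1%N (fun _ _ => idfun) (fun _ _ => S1)).1 p1 (fun=> l).
by rewrite !big_ord1.
Qed.

(** Only the matrix order of S passes to the kernels; the bound on [s] is therefore carried across
    as positivity of a 2 x 2 matrix. *)
Let block s s' (c : R) : S s -> is_adjoint s s' -> (forall u, nr (s u) <= c * nr u) ->
  forall l l', 0 <= c%:C * kform (kap idfun) l l + kform (kap s) l' l +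
    (kform (kap s') l l' + c%:C * kform (kap idfun) l' l').
Proof.
move=> Ss ss hc l l'; have Ss' : S s' by case: oS => _ _ _ /(_ s s' Ss ss).
have Sc : S (c%:C *: idfun) by exact: (subspaceZ sS).
pose x (i j : 'I_2) : H -> H :=
  if i == ord0 then (if j == ord0 then c%:C *: idfun else s)
  else (if j == ord0 then s' else c%:C *: idfun).
have Sx i j : S (x i j) by rewrite /x; case: ifP; case: ifP.
have px : mpos x.
  move=> xi; rewrite !big_ord_recl !big_ord0 !addr0 /x /= !opE !dotZl.
  exact: block2_form.
have := (kap_pos Sx).1 px (fun i => if i == ord0 then l else l').
by rewrite !big_ord_recl !big_ord0 !addr0 /x /= !kform_id.
Qed.

(** The discriminant of the 2 x 2 form along (l', t l) gives |F_s(l, l')|^2 <= (c F(l', l')) (c F(l,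
    l)), with F the form of the identity and F_s that of s. *)
Let kbd s : S s -> exists C, kbounded (kap idfun) (kap s) C.
Proof.
move=> Ss; have [c c0 hc] := op_bound (Sb Ss); exists c; split; first exact: ltW.
have bl := block Ss (adjP (Sb Ss)) hc.
have imF m : im (kform (kap idfun) m m) = 0 by exact: ge0_im.
have imE m m' : im (kform (kap s) m' m) = - im (kform (kap (adj s)) m m').
  have := ge0_im (bl m m'); rewrite !imD !imM !imF !imC; lra.
have reE m m' : re (kform (kap s) m' m) = re (kform (kap (adj s)) m m').
  have := imE m (lscale 'i%C m'); rewrite kform_scalel kform_scaler !imM !cE.
  by rewrite !mul0r !mul1r !add0r mulN1r opprK.
move=> l l'; rewrite -(@ler_pXn2r _ 2) ?nnegrE ?cn_ge0 ?mulr_ge0 ?sn_ge0 ?(ltW c0) //.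
rewrite !exprMn !sn_sq //.
set a := re (kform _ l l); set b := re (kform _ l' l').
have -> : c ^+ 2 * (a * b) = (c * b) * (c * a) by ring.
apply: discriminant; first by rewrite mulr_ge0 ?(ltW c0) // ge0_re.
move=> t; have := ge0_re (bl l' (lscale t l)).
rewrite !kform_scalel !kform_scaler !reD !reM !imM !imJ !reJ !imC !reC -!reE.
have := imE l' l; rewrite -/a -/b cn_sq imF.
move: (im (kform (kap (adj s)) l' l)) => ia e h.
have iaE : ia = - im (kform (kap s) l l') by rewrite e opprK.
rewrite iaE in h.
apply: (le_trans h); rewrite le_eqVlt; apply/orP; left; apply/eqP.
by rewrite reM; ring.
Qed.

Let j (s : opspace H) : opspace (khilbert psd) := kop (kap s).

Let ucoe_j : ucoe S j.
Proof.
split.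
- by move=> x Sx; have [C hC] := kbd Sx; exact: (kop_bop psd hC).
- move=> a x y Sx Sy; apply: op_ext => u v; rewrite !opE dotDl dotZl.
  have [C hC] := kbd (sS.2 a _ _ Sx Sy).
  have [Cx hx] := kbd Sx; have [Cy hy] := kbd Sy.
  rewrite (kop_dot hC) (kop_dot hx) (kop_dot hy).
  have [v1 r1] := krep_ex u; have [v2 r2] := krep_ex v.
  apply: (climit_uniq (kextP hC r1 r2)).
  apply: nulls_le (climitD (climitZ a (kextP hx r1 r2)) (kextP hy r1 r2)) => n.
  by rewrite kform_lin.
- apply: op_ext => u v; rewrite (kop_dot (kbounded_self psd)).
  by rewrite hdot_kernel.
- move=> n M SM.
  have h := kop_mpos psd (fun i j' => kbd (SM i j')).
  apply: (iff_trans (kap_pos SM)); apply: (iff_trans (iff_sym h)).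
  suff -> : (fun i j' => kop (kap (M i j'))) = (fun i j' => (map_mx j M) i j') by [].
  by apply/funext => i; apply/funext => j'; rewrite mxE.
Qed.

Variables (z : H -> H) (Az Az' : G -> G).
Hypothesis Sz : S z.
Hypothesis kap_act : forall s, S s -> forall p q, kap s (Az p) q = kap s p (Az' q).
Hypothesis kap_z : forall p q, kap z p q = kap idfun (Az p) q.

(** Here j(z) sends the point p to the point [Az p] and its adjoint sends q to [Az' q]. Hence <z s
    p, q> = <s p, Az' q> = <s (Az p), q> = <s z p, q> at points, and points span a dense
    subspace. *)
Let j_comm s : S s -> (j z : _ -> _) \o j s = (j s : _ -> _) \o j z.
Proof.
move=> Ss; have [Cz hz] := kbd Sz; have [Cs hs] := kbd Ss.
have bz := kop_bop psd hz; have bs := kop_bop psd hs.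
have jz p : kop (kap z) (kpoint psd p) = kpoint psd (Az p).
  apply: kpoint_dot_inj => b; rewrite (kop_points psd hz) kap_z.
  by rewrite hdot_kernel (@kext_embed _ _ _ psd _ _ _ _ (kbounded_self psd)) kform_1.
have jz' q : adj (kop (kap z) : khilbert psd -> khilbert psd) (kpoint psd q) = kpoint psd (Az' q).
  apply: kpoint_dot_inj => b; rewrite dot_adjl // dotC [RHS]dotC; congr Num.conj.
  rewrite (kop_points psd hz) kap_z kap_act //.
  by rewrite hdot_kernel (@kext_embed _ _ _ psd _ _ _ _ (kbounded_self psd)) kform_1.
apply: (kop_eq (bop_comp bz bs) (bop_comp bs bz)) => p.
apply: kpoint_dot_inj => q.
change (hdot (khilbert psd) (kop (kap z) (kop (kap s) (kpoint psd p))) (kpoint psd q) =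
  hdot (khilbert psd) (kop (kap s) (kop (kap z) (kpoint psd p))) (kpoint psd q)).
by rewrite jz -(dot_adjr bz) jz' !(kop_points psd hs) kap_act.
Qed.

(** The kernels give a C*-cover j of S in which z and s commute; the multiplicative map from that
    cover to the envelope carries the relation over. *)
Lemma criterion_commute s : S s ->
  (env_map E z : _ -> _) \o env_map E s = (env_map E s : _ -> _) \o env_map E z.
Proof.
move=> Ss; have [pi [_ _ piM _] pij] := env_univ E ucoe_j.
have gen x : S x -> cstar_gen (j @` S) (j x) by move=> Sx A [_]; apply; exists x.
by rewrite -!pij // -!piM ?j_comm //; exact: gen.
Qed.
End Criterion.

Section Centre.
Variables (R : realType) (H : hilbert R) (S : set (opspace H)) (E : cstar_envelope S).
Hypothesis oS : operator_system S.

(** The operators commuting with both z and its adjoint form a C*-subalgebra; it contains the image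
    of S, hence the generated algebra. The adjoint of z is included to make this set selfadjoint. *)
Lemma commute_centre z : S z ->
  (forall s, S s -> (env_map E z : _ -> _) \o env_map E s = (env_map E s : _ -> _) \o env_map E z) ->
  centre E z.
Proof.
move=> Sz cz; split=> // y; have u := env_ucoe E; have Sz' := opsys_adj oS Sz.
have Sb : forall x, S x -> bounded_op H H x by case: oS.
have bE x : S x -> bounded_op (env_space E) (env_space E) (env_map E x) by exact: (ucoe_bop u).
have adE x : S x -> adj (env_map E x : env_space E -> _) = env_map E (adj x).
  by move=> Sx; apply: adjE; [exact: bE|apply: (ucoe_adj oS u) => //; exact/adjP/Sb].
have cz' s : S s -> (env_map E (adj z) : _ -> _) \o env_map E s =
    (env_map E s : _ -> _) \o env_map E (adj z).
  move=> Ss; have Ss' := opsys_adj oS Ss.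
  have h1 := is_adjoint_comp (adjP (bE _ Sz)) (adjP (bE _ Ss')).
  have h2 := is_adjoint_comp (adjP (bE _ Ss')) (adjP (bE _ Sz)).
  rewrite (cz _ Ss') !adE // (adjK (Sb _ Ss)) in h1.
  rewrite !adE // (adjK (Sb _ Ss)) in h2.
  exact: adjoint_uniq h2 h1.
pose W : set (opspace (env_space E)) := [set w | bounded_op (env_space E) (env_space E) w /\
  ((env_map E z : _ -> _) \o (w : env_space E -> env_space E) = w \o env_map E z /\
  (env_map E (adj z) : _ -> _) \o (w : env_space E -> env_space E) = w \o env_map E (adj z))].
suff cW : cstar_subalgebra W.
  move=> Ey; have [_ [h _]] : W y; last exact: h.
  apply: Ey; split=> // _ [s Ss <-]; split; first exact: bE.
  by split; [exact: cz|exact: cz'].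
have bz := bE _ Sz; have bz' := bE _ Sz'.
split.
- split.
  + by move=> w [].
  + split.
      split; first exact: bop0.
      by split; apply/funext => x /=; rewrite !opE op0.
    move=> a v w [bv [v1 v2]] [bw [w1 w2]]; split; first by apply: bopD => //; exact: bopZ.
    split; apply/funext => x /=; rewrite !opE.
      rewrite (opD bz) (opZ bz).
      by rewrite -[env_map E z (v x)]/((_ \o _) x) v1 -[env_map E z (w x)]/((_ \o _) x) w1.
    rewrite (opD bz') (opZ bz').
    by rewrite -[env_map E (adj z) (v x)]/((_ \o _) x) v2 -[env_map E (adj z) (w x)]/((_ \o _) x) w2.
  + by split; [exact: bop_id|].
  + move=> w w' [bw [w1 w2]] ww'; have bw' := adjoint_bop bw ww'; split=> //.
    have z1 := adjP bz; rewrite adE // in z1; have z2 := adjoint_sym z1.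
    split.
      apply: (@adjoint_uniq _ _ _ (w \o env_map E (adj z))).
        exact: (is_adjoint_comp ww' z2).
      by rewrite -w2; exact: (is_adjoint_comp z2 ww').
    apply: (@adjoint_uniq _ _ _ (w \o env_map E z)).
      exact: (is_adjoint_comp ww' z1).
    by rewrite -w1; exact: (is_adjoint_comp z1 ww').
- move=> _ [v [bv [v1 v2]] [w [bw [w1 w2]] <-]]; split; first exact: bop_comp.
  split; apply/funext => x.
    by have := congr1 (fun f => f (w x)) v1; have := congr1 (fun f => f x) w1 => /= -> ->.
  by have := congr1 (fun f => f (w x)) v2; have := congr1 (fun f => f x) w2 => /= -> ->.
- move=> w /opclosureP[bw hw]; split=> //.
  have key (t : env_space E -> env_space E) : bounded_op _ _ t ->
      (forall v, W v -> t \o (v : env_space E -> env_space E) = v \o t) -> t \o w = w \o t.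
    move=> bt ht; apply: odist_eq => e e0; have [c c0 hc] := op_bound bt.
    have d0 : 0 < e / (2 * c) by rewrite divr_gt0 // mulr_gt0.
    have [v Wv wv] := hw _ d0; have hv := ht v Wv.
    have dE : c * (e / (2 * c)) = e / 2 by field; rewrite gt_eqF.
    have -> : e = e / 2 + e / 2 by lra.
    apply: (@odist_tri _ _ _ _ (t \o v)).
      move=> x /=; rewrite -(opB bt); apply: (le_trans (hc _)).
      by apply: (le_trans (ler_wpM2l (ltW c0) (wv x))); rewrite mulrA dE.
    rewrite hv => x /=; rewrite nrB; apply: (le_trans (wv _)).
    apply: (le_trans (ler_wpM2l (ltW d0) (hc x))).
    by rewrite mulrA -[X in X * nr x <= _]mulrC dE.
  by split; apply: key => // v [_ []].
Qed.
End Centre.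
(** * Ternary rings and intertwined elements *)

Section TernaryRings.
Variable R : realType.
Implicit Types (H K L : hilbert R).

Lemma opclosure_mul3 (H1 H2 H3 H4 : hilbert R) (A : set (H3 -> H4)) (X : set (H2 -> H3))
    (C : set (H1 -> H2)) (W : set (H1 -> H4)) :
  A `<=` bounded_op H3 H4 -> X `<=` bounded_op H2 H3 -> C `<=` bounded_op H1 H2 ->
  (forall a x c, A a -> X x -> C c -> opclosure W (a \o x \o c)) ->
  forall a x c, opclosure A a -> opclosure X x -> opclosure C c ->
    opclosure W (a \o x \o c).
Proof.
move=> bA bX bC h.
have h1 a x c : opclosure A a -> X x -> C c -> opclosure W (a \o x \o c).
  move=> Aa Xx Cc; have bxc := bop_comp (bX _ Xx) (bC _ Cc).
  exact: (@opclosure_compr _ _ _ _ (x \o c) A W bxc (fun a' Aa' => h a' x c Aa' Xx Cc) a Aa).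
have h2 a x c : opclosure A a -> opclosure X x -> C c -> opclosure W (a \o x \o c).
  move=> Aa Xx Cc; have ba := opclosure_bop Aa.
  have Xc : opclosure [set x \o c | x in X] (x \o c).
    apply: (opclosure_compr (bC _ Cc) _ Xx) => x' Xx'; apply: sub_opclosure.
      by move=> _ [y Xy <-]; apply: bop_comp; [exact: bX|exact: bC].
    by exists x'.
  have h' b : [set x \o c | x in X] b -> opclosure W (a \o b).
    by move=> [x' Xx' <-]; exact: (h1 a x' c Aa Xx' Cc).
  exact: (@opclosure_compl _ _ _ _ a [set x \o c | x in X] W ba h' _ Xc).
move=> a x c Aa Xx Cc.
have bax : bounded_op H2 H4 (a \o x).
  by apply: bop_comp; [exact: opclosure_bop Aa|exact: opclosure_bop Xx].
exact: (@opclosure_compl _ _ _ _ (a \o x) C W bax (fun c' Cc' => h2 a x c' Aa Xx Cc') _ Cc).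
Qed.

(* TRO-equivalence of norm closed sets; of non-degeneracy only the approximation of
   the units by finite sums is kept. *)
Record tro_linked H K (N : set (H -> K)) (S : set (opspace H)) (T : set (opspace K)) : Prop :=
  TroLinked {
    tl_bop : N `<=` bounded_op H K;
    tl_sub : @Defs.subspace _ (H -> K) N;
    tl_closed : opclosed N;
    tl_ternary : forall a b c, N a -> N b -> N c -> N (a \o adj b \o c);
    tl_S : operator_system S;
    tl_T : operator_system T;
    tl_Scl : @opclosed R H H S;
    tl_Tcl : @opclosed R K K T;
    tl_TS : forall a b (t : K -> K), N a -> N b -> T t -> S (adj a \o t \o b);
    tl_ST : forall a b (s : H -> H), N a -> N b -> S s -> T (a \o s \o adj b);
    tl_left : exists l : seq ((H -> K) * (H -> K)), (forall p, p \in l -> N p.1 /\ N p.2) /\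
      odist idfun (\sum_(p <- l) (p.1 \o adj p.2)) 2^-1;
    tl_right : exists l : seq ((H -> K) * (H -> K)), (forall p, p \in l -> N p.1 /\ N p.2) /\
      odist idfun (\sum_(p <- l) (adj p.1 \o p.2)) 2^-1 }.

Lemma adjset_adj H K (M : set (H -> K)) : M `<=` bounded_op H K ->
  adjset M = [set adj a | a in M].
Proof.
move=> bM; apply/seteqP; split=> b.
  by move=> [a Ma ab]; exists a => //; apply: adjE => //; exact: bM.
by move=> [a Ma <-]; exists a => //; exact/adjP/bM.
Qed.

Lemma adj_comp H K L (A : K -> L) (B : H -> K) : bounded_op K L A -> bounded_op H K B ->
  adj (A \o B) = adj B \o adj A.
Proof.
move=> bA bB; apply: adjE; first exact: bop_comp.
by apply: is_adjoint_comp; exact: adjP.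
Qed.

Lemma adj_lin H K a (A B : H -> K) : bounded_op H K A -> bounded_op H K B ->
  adj (a *: A + B) = Num.conj a *: adj A + adj B.
Proof.
move=> bA bB; apply: adjE; first by apply: bopD => //; exact: bopZ.
by apply: is_adjoint_lin; exact: adjP.
Qed.

Lemma tro_linked_sym H K N S T : @tro_linked H K N S T ->
  @tro_linked K H [set adj a | a in N] T S.
Proof.
move=> [Nb Ns Nc N3 oS oT Sc Tc hTS hST [l1 [hl1 d1]] [l2 [hl2 d2]]]; split=> //.
- by move=> _ [a Na <-]; apply: adj_bop; exact: Nb.
- split.
    exists 0; first exact: subspace0.
    by apply: adjE; [exact: bop0|exact: is_adjoint0].
  move=> a _ _ [x Nx <-] [y Ny <-]; exists (Num.conj a *: x + y); first exact: Ns.2.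
  by rewrite adj_lin ?conjCK //; exact: Nb.
- move=> x clx; have bx := opclosure_bop clx.
  exists (adj x); last exact: adjK.
  apply: Nc; apply: (opclosure_adj _ _ clx).
    by move=> _ [a Na <-]; apply: adj_bop; exact: Nb.
  move=> _ [a Na <-]; rewrite adjK; last exact: Nb.
  exact: (sub_opclosure Nb).
- move=> _ _ _ [a Na <-] [b Nb' <-] [c Nc' <-]; exists (c \o adj b \o a); first exact: N3.
  have ba := Nb _ Na; have bb := Nb _ Nb'; have bc := Nb _ Nc'; have bb' := adj_bop bb.
  by rewrite (adj_comp (bop_comp bc bb') ba) (adj_comp bc bb').
- by move=> _ _ s [a Na <-] [b Nb' <-] Ss; rewrite adjK; [exact: hST|exact: Nb].
- by move=> _ _ t [a Na <-] [b Nb' <-] Tt; rewrite adjK; [exact: hTS|exact: Nb].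
- exists [seq (adj p.1, adj p.2) | p <- l2]; split.
    move=> p /mapP[q /hl2[N1 N2] ->] /=; split; [by exists q.1|by exists q.2].
  rewrite big_map /= big_seq.
  suff -> : \sum_(p <- l2 | p \in l2) (adj p.1 \o adj (adj p.2)) =
    \sum_(p <- l2 | p \in l2) (adj p.1 \o p.2) by rewrite -big_seq.
  by apply: eq_bigr => p /hl2[_ N2]; rewrite adjK //; exact: Nb.
- exists [seq (adj p.1, adj p.2) | p <- l1]; split.
    move=> p /mapP[q /hl1[N1 N2] ->] /=; split; [by exists q.1|by exists q.2].
  rewrite big_map /= big_seq.
  suff -> : \sum_(p <- l1 | p \in l1) (adj (adj p.1) \o adj p.2) =
    \sum_(p <- l1 | p \in l1) (p.1 \o adj p.2) by rewrite -big_seq.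
  by apply: eq_bigr => p /hl1[N1 _]; rewrite adjK //; exact: Nb.
Qed.

(** Scalars are absorbed into the second factor, so elements of the span are plain sums of products,
    without coefficients. *)
Lemma clspan_pairs H K L (M : set (K -> L)) (M' : set (H -> K)) (w : H -> L) (e : R) :
  @Defs.subspace _ (H -> K) M' -> M `<=` bounded_op K L ->
  clspan (opmul M M') w -> 0 < e ->
  exists l : seq ((K -> L) * (H -> K)), (forall p, p \in l -> M p.1 /\ M' p.2) /\
    odist w (\sum_(p <- l) (p.1 \o p.2)) e.
Proof.
move=> sM' bM /opclosureP[_ hw] e0; have [A SA wA] := hw e e0.
pose W : set (H -> L) := [set B | exists l : seq ((K -> L) * (H -> K)),
  (forall p, p \in l -> M p.1 /\ M' p.2) /\ B = \sum_(p <- l) (p.1 \o p.2)].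
have [l [hl AE]] : W A.
  apply: SA; split.
    split; first by exists [::]; split=> //; rewrite big_nil.
    move=> a _ _ [l [hl ->]] [l' [hl' ->]].
    exists ([seq (p.1, a *: p.2) | p <- l] ++ l'); split.
      move=> p; rewrite mem_cat => /orP[/mapP[q /hl[h1 h2] ->]|/hl'//].
      by split=> //=; exact: (subspaceZ sM').
    rewrite big_cat big_map /=; congr (_ + _).
    rewrite scaler_sumr [LHS]big_seq [RHS]big_seq; apply: eq_bigr => p /hl[/bM b1 _].
    by apply/funext => x; rewrite /= !opE (opZ b1).
  move=> _ [a Ma [b Mb <-]]; exists [:: (a, b)]; rewrite big_seq1; split=> //.
  by move=> p; rewrite inE => /eqP ->.
by exists l; split=> //; rewrite -AE.
Qed.

Lemma tro_equivalent_linked H K (S : set (opspace H)) (T : set (opspace K)) :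
  operator_system S -> operator_system T -> TRO_equivalent S T ->
  exists N, @tro_linked H K N (opclosure S) (opclosure T).
Proof.
move=> oS oT [M [[Mb Ms M3] [ndr ndl] MTS MST]].
have [Sb sS _ _] := oS; have [Tb sT _ _] := oT.
rewrite !(adjset_adj Mb) in M3 ndr ndl MTS MST.
have bM' : [set adj a | a in M] `<=` bounded_op K H.
  by move=> _ [a Ma <-]; apply: adj_bop; exact: Mb.
have Ms' : @Defs.subspace _ (K -> H) [set adj a | a in M].
  split.
    exists 0; first exact: subspace0.
    by apply: adjE; [exact: bop0|exact: is_adjoint0].
  move=> a _ _ [x Nx <-] [y Ny <-]; exists (Num.conj a *: x + y); first exact: Ms.2.
  by rewrite adj_lin ?conjCK //; exact: Mb.
have cl_adj a : opclosure M a -> opclosure [set adj a | a in M] (adj a).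
  move=> Ma; apply: (opclosure_adj Mb _ Ma) => b Mb'; apply: (sub_opclosure bM').
  by exists b.
have half0 : (0 : R) < 2^-1 by [].
exists (opclosure M); split.
- exact: opclosure_bop.
- exact: opclosure_subspace.
- exact: opclosureK.
- move=> a b c Ma Mb' Mc.
  apply: (opclosure_mul3 Mb bM' Mb _ Ma (cl_adj _ Mb') Mc).
  move=> x y z Mx My Mz; apply: (sub_opclosure Mb); apply: M3.
  by exists (x \o y); [exists x => //; exists y|exists z].
- exact: opsys_closure.
- exact: opsys_closure.
- exact: opclosureK.
- exact: opclosureK.
- move=> a b t Ma Mb' Tt.
  apply: (opclosure_mul3 bM' Tb Mb _ (cl_adj _ Ma) Tt Mb').
  move=> x y z Mx My Mz; apply: MTS.
  by exists (x \o y); [exists x => //; exists y|exists z].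
- move=> a b s Ma Mb' Ss.
  apply: (opclosure_mul3 Mb Sb bM' _ Ma Ss (cl_adj _ Mb')).
  move=> x y z Mx My Mz; apply: MST.
  by exists (x \o y); [exists x => //; exists y|exists z].
- have [l [hl d]] := clspan_pairs Ms' Mb ndl half0.
  exists [seq (p.1, adj p.2) | p <- l]; split.
    move=> p /mapP[q /hl[h1 [a Ma aq]] ->] /=; split; first exact: (sub_opclosure Mb).
    by rewrite -aq adjK; [exact: (sub_opclosure Mb)|exact: Mb].
  rewrite big_map /= big_seq.
  suff -> : \sum_(p <- l | p \in l) (p.1 \o adj (adj p.2)) = \sum_(p <- l | p \in l) (p.1 \o p.2).
    by rewrite -big_seq.
  by apply: eq_bigr => p /hl[_ h2]; rewrite adjK //; exact: bM'.
- have [l [hl d]] := clspan_pairs Ms bM' ndr half0.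
  exists [seq (adj p.1, p.2) | p <- l]; split.
    move=> p /mapP[q /hl[[a Ma aq] h2] ->] /=; split; last exact: (sub_opclosure Mb).
    by rewrite -aq adjK; [exact: (sub_opclosure Mb)|exact: Mb].
  rewrite big_map /= big_seq.
  suff -> : \sum_(p <- l | p \in l) (adj (adj p.1) \o p.2) = \sum_(p <- l | p \in l) (p.1 \o p.2).
    by rewrite -big_seq.
  by apply: eq_bigr => p /hl[h1 _]; rewrite adjK //; exact: bM'.
Qed.

Section Frame.
Variables (H K : hilbert R) (N : set (H -> K)) (S : set (opspace H)) (T : set (opspace K)).
Hypothesis link : tro_linked N S T.
Let Nb := tl_bop link.

(* h = sum (a a^* + b b^* ) dominates 2 Re (sum a b^* ), hence 1. *)
Lemma tro_frame : exists (n : nat) (m : 'I_n -> H -> K) (g : K -> K),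
  [/\ forall i, N (m i), bounded_op K K g /\ posop g,
     forall a, N a -> N (g \o a),
     forall x, \sum_i m i (adj (m i) (g x)) = x &
     forall x, g (\sum_i m i (adj (m i) x)) = x].
Proof.
have [l [hl d]] := tl_left link.
pose s : seq (H -> K) := flatten [seq [:: p.1; p.2] | p <- l].
pose m (i : 'I_(size s)) : H -> K := tnth (in_tuple s) i.
pose h : K -> K := \sum_i (m i \o adj (m i)).
have sN a : a \in s -> N a.
  by move=> /flatten_mapP[p /hl[h1 h2]]; rewrite !inE => /orP[] /eqP ->.
have Nm i : N (m i) by apply: sN; exact: (mem_tnth i (in_tuple s)).
have bm i := Nb (Nm i).
have bh : bounded_op K K h.
  by apply: bop_sum => i _; apply: bop_comp => //; exact: adj_bop.
have hE x : hdot K (h x) x = \sum_i (nr (adj (m i) x) ^+ 2)%:C.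
  rewrite /h sumopE dot_suml; apply: eq_bigr => i _ /=.
  by rewrite -dot_adjr // dotxx.
have ph : posop h by move=> x; rewrite hE sumr_ge0 // => i _; rewrite ler0c sqr_ge0.
have h1 x : 1 * nr x ^+ 2 <= re (hdot K (h x) x).
  have hE2 : re (hdot K (h x) x) =
      \sum_(p <- l) (nr (adj p.1 x) ^+ 2 + nr (adj p.2 x) ^+ 2).
    rewrite hE re_sum -(big_tnth _ _ s predT (fun a => nr (adj a x) ^+ 2)).
    by rewrite /s big_flatten big_map; apply: eq_bigr => p _; rewrite big_cons big_seq1.
  set c := \sum_(p <- l) (p.1 \o adj p.2) in d.
  have e1 : re (hdot K (c x) x) <= re (hdot K (h x) x) / 2.
    rewrite hE2 mulr_suml /c sumopE dot_suml re_sum [leLHS]big_seq [leRHS]big_seq.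
    apply: ler_sum => p /hl[/Nb b1 /Nb b2] /=; rewrite -dot_adjr //.
    apply: (le_trans (re_le_cn _)); apply: (le_trans (cauchy_schwarz _ _)).
    by have := sqr_ge0 (nr (adj p.1 x) - nr (adj p.2 x)); rewrite sqrrB; lra.
  have e2 : re (hdot K (x - c x) x) <= 2^-1 * nr x * nr x.
    apply: (le_trans (re_le_cn _)); apply: (le_trans (cauchy_schwarz _ _)).
    by rewrite ler_wpM2r ?nr_ge0 //; exact: d.
  have e3 : nr x ^+ 2 = re (hdot K (x - c x) x) + re (hdot K (c x) x).
    by rewrite -reD -dotDl subrK dotxx reC.
  by rewrite mul1r; lra.
have [g [bg pg _ [gh hg] Wg]] := invertible_bounded_below bh ph ltr01 h1.
have hsum x : h x = \sum_i m i (adj (m i) x) by rewrite /h sumopE.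
exists (size s), m, g; split=> //; last 2 first.
- by move=> x; rewrite -hsum hg.
- by move=> x; rewrite -hsum gh.
(* Left multipliers of N: closed because N is, and stable under h by the ternary product. The
   inverse g thus lies in W, so the second frame g m_i also consists of elements of N. *)
pose W : set (K -> K) := [set w : K -> K | forall a, N a -> N (w \o a)].
apply: (Wg W) => //.
- split; first by move=> a Na; exact: (subspace0 (tl_sub link)).
  by move=> a v w hv hw b Nb'; apply: (tl_sub link).2; [exact: hv|exact: hw].
- move=> w clw a Na; apply: (tl_closed link).
  apply: (opclosure_compr (Nb Na) _ clw) => v Wv; apply: (sub_opclosure Nb).
  exact: Wv.
- move=> w Ww a Na; have -> : (h \o w) \o a = \sum_i (m i \o adj (m i) \o (w \o a)).
    by apply/funext => x; rewrite /= hsum sumopE.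
  apply: (subspace_sum (tl_sub link)) => i _; apply: (tl_ternary link) => //.
  exact: Ww.
Qed.

Definition intertwines (x : H -> H) (y : K -> K) : Prop :=
  (forall a, N a -> forall u, y (a u) = a (x u)) /\ (forall a, N a -> forall v, x (adj a v) = adj a (y v)).

(** The frame writes every vector as a combination of values of elements of N, where y is dictated
    by x. *)
Lemma intertwines_uniq x y y' : bounded_op K K y -> bounded_op K K y' ->
  intertwines x y -> intertwines x y' -> y = y'.
Proof.
move=> by1 by2 [h1 _] [h2 _]; have [n [m [g [Nm _ _ hg _]]]] := tro_frame.
apply/funext => v; rewrite -(hg v) (op_sum by1) (op_sum by2).
by apply: eq_bigr => i _; rewrite h1 // h2.
Qed.

(** The partner is y = sum m_i x (g m_i)^*, an element of N S N^* and so of T. Commutation of x with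
    products of N^* and N moves x past the frame. *)
Lemma intertwines_ex x : S x ->
  (forall a b, N a -> N b -> forall u, x (adj a (b u)) = adj a (b (x u))) ->
  exists2 y, T y & intertwines x y.
Proof.
move=> Sx cx; have [n [m [g [Nm [bg pg] Ng hg gh]]]] := tro_frame.
have bx : bounded_op H H x by case: (tl_S link) => h _ _ _; exact: h.
have [_ sT _ _] := tl_T link.
have sg := posop_sa bg pg.
have adE i : adj (m i) \o g = adj (g \o m i).
  by rewrite adj_comp ?(adjE bg sg) //; exact: Nb.
pose y : K -> K := \sum_i (m i \o x \o adj (g \o m i)).
have yE v : y v = \sum_i m i (x (adj (m i) (g v))).
  by rewrite /y sumopE; apply: eq_bigr => i _; rewrite -adE.
exists y.
  by apply: (subspace_sum sT) => i _; apply: (tl_ST link) => //; exact: Ng.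
split=> a Na.
  move=> u; rewrite yE -[RHS](hg (a (x u))); apply: eq_bigr => i _; congr (m i _).
  exact: (cx (m i) (g \o a) (Nm i) (Ng _ Na)).
move=> v; rewrite yE (op_sum (adj_bop (Nb Na))).
rewrite -{1}(hg v) (op_sum (adj_bop (Nb Na))) (op_sum bx); apply: eq_bigr => i _.
exact: cx.
Qed.

(** With h = sum m_k m_k^*, the matrix y_ij h = sum m_k x_ij m_k^* is visibly positive. Multiplying
    by the commuting positive inverse g of h removes the factor. *)
Lemma intertwines_mpos (I : finType) (x : I -> I -> H -> H) (y : I -> I -> K -> K) :
  (forall i j, bounded_op H H (x i j)) -> (forall i j, bounded_op K K (y i j)) ->
  (forall i j, intertwines (x i j) (y i j)) -> mpos x -> mpos y.
Proof.
move=> bx by_ xy px; have [n [m [g [Nm [bg pg] Ng hg gh]]]] := tro_frame.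
pose h : K -> K := \sum_k (m k \o adj (m k)).
have bm k := Nb (Nm k).
have hE v : h v = \sum_k m k (adj (m k) v) by rewrite /h sumopE.
have bh : bounded_op K K h.
  by apply: bop_sum => i _; apply: bop_comp => //; exact: adj_bop.
have cyh i j v : y i j (h v) = h (y i j v).
  rewrite !hE (op_sum (by_ i j)); apply: eq_bigr => k _.
  by rewrite (xy i j).1 // (xy i j).2.
have pyh : mpos (fun i j => y i j \o h).
  move=> xi; have -> : \sum_i \sum_j hdot K ((y i j \o h) (xi j)) (xi i) =
      \sum_k \sum_i \sum_j hdot H (x i j (adj (m k) (xi j))) (adj (m k) (xi i)).
    rewrite [RHS]exchange_big; apply: eq_bigr => i _.
    rewrite [RHS]exchange_big; apply: eq_bigr => j _ /=.
    rewrite hE (op_sum (by_ i j)) dot_suml; apply: eq_bigr => k _.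
    by rewrite dot_adjr // (xy i j).1.
  by apply: sumr_ge0 => k _; exact: (px (fun i => adj (m k) (xi i))).
have byh i j : bounded_op K K (y i j \o h) by exact: bop_comp.
have cg i j v : (y i j \o h) (g v) = g ((y i j \o h) v).
  by rewrite /= [h (g v)]hE hg cyh hE gh.
have := mpos_mul byh pyh bg pg cg.
suff -> : (fun i j => (y i j \o h) \o g) = y by [].
by apply/funext => i; apply/funext => j; apply/funext => v /=; rewrite hE hg.
Qed.
End Frame.

Lemma intertwines_sym H K N (S : set (opspace H)) (T : set (opspace K)) x y :
  tro_linked N S T -> intertwines N x y -> intertwines [set adj a | a in N] y x.
Proof.
move=> link [h1 h2]; split=> _ [a Na <-]; first exact: h2.
by move=> v; rewrite adjK; [rewrite h1|exact: (tl_bop link)].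
Qed.
End TernaryRings.

(** * Inducing faithful kernels along a link *)

Section LinkedKernels.
Variable R : realType.
Implicit Types (H K L : hilbert R).

(** Repeating rows and columns keeps positivity: the vectors over each fibre of [tau] are added
    up. *)
Lemma mpos_pull H (I J : finType) (tau : J -> I) (t : I -> I -> H -> H) :
  (forall i j, bounded_op H H (t i j)) -> mpos t -> mpos (fun a b => t (tau a) (tau b)).
Proof.
move=> bt pt w; have := pt (fun i => \sum_(a | tau a == i) w a).
suff -> : \sum_i \sum_j hdot H (t i j (\sum_(a | tau a == j) w a)) (\sum_(a | tau a == i) w a) =
  \sum_a \sum_b hdot H (t (tau a) (tau b) (w b)) (w a) by [].
rewrite [RHS](partition_big tau xpredT) //=; apply: eq_bigr => i _.
under eq_bigr do rewrite dot_sumr.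
rewrite exchange_big /=; apply: eq_bigr => a /eqP ai.
rewrite [RHS](partition_big tau xpredT) //=; apply: eq_bigr => j _.
rewrite (op_sum (bt i j)) dot_suml; apply: eq_bigr => b /eqP bj.
by rewrite ai bj.
Qed.

Lemma sum_pair (V : nmodType) (I J : finType) (F : I * J -> V) :
  \sum_p F p = \sum_i \sum_j F (i, j).
Proof. by rewrite pair_bigA; apply: eq_bigr => -[]. Qed.

Lemma kform_flatten (X I J : Type) (k : X -> X -> R[i]) (r : seq I) (s : seq J)
    (A : I -> seq (R[i] * X)) (B : J -> seq (R[i] * X)) :
  kform k (flatten [seq A i | i <- r]) (flatten [seq B j | j <- s]) =
  \sum_(i <- r) \sum_(j <- s) kform k (A i) (B j).
Proof.
rewrite /kform big_flatten big_map; apply: eq_bigr => i _.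
rewrite exchange_big big_flatten big_map; apply: eq_bigr => j _ /=.
by rewrite exchange_big.
Qed.

Lemma sum_lists (V : nmodType) (X : Type) n (l : 'I_n -> seq X) (F : 'I_n -> X -> V) :
  \sum_i \sum_(p <- l i) F i p =
  \sum_(a : {i : 'I_n & 'I_(size (l i))}) F (tag a) (tnth (in_tuple (l (tag a))) (tagged a)).
Proof.
rewrite -(@sig_big_dep _ _ _ _ _ xpredT (fun _ _ => true)
  (fun i (k : 'I_(size (l i))) => F i (tnth (in_tuple (l i)) k))) /=.
by apply: eq_bigr => i _; rewrite big_tnth.
Qed.

Definition kernel_linear H (S : set (H -> H)) (G : Type) (kap : (H -> H) -> G -> G -> R[i]) :=
  forall a x y, S x -> S y -> forall p q, kap (a *: x + y) p q = a * kap x p q + kap y p q.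

Definition kernel_faithful H (S : set (H -> H)) (G : Type)
    (kap : (H -> H) -> G -> G -> R[i]) :=
  forall n (x : 'I_n -> 'I_n -> H -> H), (forall i j, S (x i j)) ->
    mpos x <-> forall l : 'I_n -> seq (R[i] * G),
      0 <= \sum_i \sum_j kform (kap (x i j)) (l j) (l i).

Lemma kernel_faithful_fin H (S : set (H -> H)) (G : Type) (kap : (H -> H) -> G -> G -> R[i])
    (I : finType) (x : I -> I -> H -> H) :
  S `<=` bounded_op H H -> kernel_faithful S kap -> (forall i j, S (x i j)) ->
  mpos x <-> forall l : I -> seq (R[i] * G),
      0 <= \sum_i \sum_j kform (kap (x i j)) (l j) (l i).
Proof.
move=> Sb kf Sx; pose x' (i j : 'I_#|I|) := x (enum_val i) (enum_val j).
have P := kf _ x' (fun i j => Sx _ _).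
have reix (l : 'I_#|I| -> seq (R[i] * G)) :
    \sum_i \sum_j kform (kap (x' i j)) (l j) (l i) =
    \sum_(a : I) \sum_(b : I) kform (kap (x a b)) (l (enum_rank b)) (l (enum_rank a)).
  rewrite (reindex (@enum_rank I)) /=; last first.
    by exists enum_val => i _; rewrite ?enum_rankK ?enum_valK.
  apply: eq_bigr => a _; rewrite (reindex (@enum_rank I)) /=; last first.
    by exists enum_val => i _; rewrite ?enum_rankK ?enum_valK.
  by apply: eq_bigr => b _; rewrite /x' !enum_rankK.
split=> h.
  have h' : mpos x' by apply: (mpos_pull enum_val) h => i j; exact: Sb.
  move=> l; have := P.1 h' (fun i => l (enum_val i)); rewrite reix.
  suff -> : \sum_a \sum_b kform (kap (x a b)) (l (enum_val (enum_rank b)))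
      (l (enum_val (enum_rank a))) = \sum_i \sum_j kform (kap (x i j)) (l j) (l i) by [].
  by apply: eq_bigr => a _; apply: eq_bigr => b _; rewrite !enum_rankK.
have h' : mpos x' by apply: P.2 => l; rewrite reix; exact: h.
have {}h' := mpos_pull (@enum_rank I) (fun i j => Sb _ (Sx _ _)) h'.
suff -> : x = (fun a b => x (enum_val (enum_rank a)) (enum_val (enum_rank b))) by [].
by apply/funext => i; apply/funext => j; rewrite !enum_rankK.
Qed.

Section Link.
Variables (H K : hilbert R) (N : set (H -> K)) (S : set (opspace H)) (T : set (opspace K)).
Hypothesis link : tro_linked N S T.
Variables (G : Type) (phi : (H -> H) -> G -> G -> R[i]).
Hypotheses (phi_lin : kernel_linear S phi) (phi_faithful : kernel_faithful S phi).

Let Nb := tl_bop link.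
Let Tb : forall t, T t -> bounded_op K K t. Proof. by case: (tl_T link). Qed.
Let Sb : forall s, S s -> bounded_op H H s. Proof. by case: (tl_S link). Qed.

(** The form <t (a (x) p), b (x) q> on the induced space N (x) G; the middle operator b^* t a
    belongs to S, where [phi] applies. *)
Definition link_kernel (t : K -> K) (p q : {a | N a} * G) : R[i] :=
  phi (adj (sval q.1) \o t \o sval p.1) p.2 q.2.

Lemma link_kernel_linear : kernel_linear T link_kernel.
Proof.
move=> a x y Tx Ty [[b Nb'] p] [[c Nc] q]; rewrite /link_kernel /=.
rewrite -phi_lin; [|exact: (tl_TS link)|exact: (tl_TS link)].
suff -> : adj c \o (a *: x + y) \o b = a *: (adj c \o x \o b) + (adj c \o y \o b) by [].
have bc := adj_bop (Nb Nc).
by apply/funext => u; rewrite /= !opE (opD bc) (opZ bc).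
Qed.

Lemma link_kernel_faithful : kernel_faithful T link_kernel.
Proof.
move=> n t Tt; split=> h.
  move=> l; pose I := {i : 'I_n & 'I_(size (l i))}.
  pose el (a : I) := tnth (in_tuple (l (tag a))) (tagged a).
  pose x (a b : I) : H -> H := adj (sval (el a).2.1) \o t (tag a) (tag b) \o sval (el b).2.1.
  have Sx a b : S (x a b).
    by apply: (tl_TS link) => //; exact: svalP.
  have px : mpos x.
    move=> w; have := mpos_pull (tag : I -> 'I_n) (fun i j => Tb (Tt i j)) h
      (fun a => sval (el a).2.1 (w a)).
    suff -> : \sum_a \sum_b hdot K (t (tag a) (tag b) (sval (el b).2.1 (w b)))
        (sval (el a).2.1 (w a)) = \sum_a \sum_b hdot H (x a b (w b)) (w a) by [].
    apply: eq_bigr => a _; apply: eq_bigr => b _.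
    by rewrite /x /= dot_adjl //; exact/Nb/svalP.
  have := (kernel_faithful_fin Sb phi_faithful Sx).1 px (fun a => [:: ((el a).1, (el a).2.2)]).
  suff -> : \sum_a \sum_b kform (phi (x a b)) [:: ((el b).1, (el b).2.2)]
      [:: ((el a).1, (el a).2.2)] =
      \sum_i \sum_j kform (link_kernel (t i j)) (l j) (l i) by [].
  transitivity (\sum_i \sum_(q <- l i) \sum_j \sum_(p <- l j)
      p.1 * Num.conj q.1 * link_kernel (t i j) p.2 q.2); last first.
    apply: eq_bigr => i _; rewrite exchange_big; apply: eq_bigr => j _ /=.
    by rewrite exchange_big.
  rewrite [RHS](sum_lists l); apply: eq_bigr => a _.
  rewrite [RHS](sum_lists l); apply: eq_bigr => b _.
  by rewrite /kform !big_seq1.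
(* For the converse, the enlarged matrix p_k^* t_ij p_k' over S is positive by faithfulness of
   [phi]; at the vectors p_k^* g xi_i the frame identity turns its form back into that of t. *)
have [m [p [g [Np [bg pg] Ng hg gh]]]] := tro_frame link.
pose x (a b : 'I_n * 'I_m) : H -> H := adj (p a.2) \o t a.1 b.1 \o p b.2.
have Sx a b : S (x a b) by exact: (tl_TS link).
have px : mpos x.
  apply/(kernel_faithful_fin Sb phi_faithful Sx) => l.
  pose l' i := flatten [seq [seq (q.1, (exist N (p k) (Np k), q.2)) | q <- l (i, k)]
    | k <- index_enum 'I_m].
  have := h l'.
  suff -> : \sum_i \sum_j kform (link_kernel (t i j)) (l' j) (l' i) =
    \sum_a \sum_b kform (phi (x a b)) (l b) (l a) by [].
  rewrite sum_pair; apply: eq_bigr => i _; under [RHS]eq_bigr do rewrite sum_pair.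
  rewrite [RHS]exchange_big /=; apply: eq_bigr => j _; rewrite /l' kform_flatten exchange_big.
  apply: eq_bigr => k _; apply: eq_bigr => k' _.
  rewrite /kform big_map; apply: eq_bigr => q _; rewrite big_map.
  by apply: eq_bigr.
move=> xi; have := px (fun a => adj (p a.2) (g (xi a.1))).
suff -> : \sum_a \sum_b hdot H (x a b (adj (p b.2) (g (xi b.1)))) (adj (p a.2) (g (xi a.1))) =
  \sum_i \sum_j hdot K (t i j (xi j)) (xi i) by [].
rewrite sum_pair; apply: eq_bigr => i _; under eq_bigr do rewrite sum_pair.
rewrite exchange_big /=; apply: eq_bigr => j _.
rewrite -{2}(hg (xi i)) dot_sumr; apply: eq_bigr => k _.
rewrite -[in RHS](hg (xi j)) (op_sum (Tb (Tt i j))) dot_suml; apply: eq_bigr => k' _.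
by rewrite /x /= dot_adjl //; exact: Nb.
Qed.
End Link.
End LinkedKernels.
(** * Transfer of the centre *)

Section CentreTransfer.
Variable R : realType.

Section Iso.
Variables (H K : hilbert R) (N : set (H -> K)) (S : set (opspace H)) (T : set (opspace K)).
Hypothesis link : tro_linked N S T.
Let Tb : forall t, T t -> bounded_op K K t. Proof. by case: (tl_T link). Qed.
Let Sb : forall s, S s -> bounded_op H H s. Proof. by case: (tl_S link). Qed.

Lemma intertwines_id : intertwines N idfun idfun. Proof. by split. Qed.

Lemma intertwines_lin a x y x' y' : intertwines N x y -> intertwines N x' y' ->
  intertwines N (a *: x + x') (a *: y + y').
Proof.
move=> [h1 h2] [h1' h2']; split=> b Nb u; have bb := tl_bop link Nb.
  by rewrite !opE h1 // h1' // (opD bb) (opZ bb).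
have bb' := adj_bop bb.
by rewrite !opE h2 // h2' // (opD bb') (opZ bb').
Qed.

Lemma intertwined_iso (Z : set (opspace H)) (Z' : set (opspace K)) :
  Z `<=` S -> Z' `<=` T ->
  (forall x : H -> H, Z x -> exists2 y : K -> K, Z' y & intertwines N x y) ->
  (forall y : K -> K, Z' y -> exists2 x : H -> H, Z x & intertwines N x y) ->
  uco_isomorphic Z Z'.
Proof.
move=> ZS ZT hx hy.
pose theta (x : opspace H) : opspace K := xget 0 [set y | T y /\ intertwines N x y].
have thetaE x y : T y -> intertwines N x y -> theta x = y.
  move=> Ty xy; have [Ty' xy'] := @xgetI _ 0 [set y0 | T y0 /\ intertwines N x y0] y (conj Ty xy).
  by apply: (intertwines_uniq link _ _ xy' xy); exact: Tb.
have thetaP x : Z x -> Z' (theta x) /\ intertwines N x (theta x).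
  by move=> /hx[y Zy xy]; rewrite (thetaE x y) //; exact: ZT.
have [_ sT T1 _] := tl_T link.
exists theta; last first.
  apply/seteqP; split; first by move=> _ [x Zx <-]; have [] := thetaP _ Zx.
  move=> y Zy; have [x Zx xy] := hy _ Zy; exists x => //.
  by apply: thetaE => //; exact: ZT.
split.
- by move=> x /thetaP[/ZT/Tb].
- move=> a x y /thetaP[zx ix] /thetaP[zy iy]; apply: thetaE.
    by apply: sT.2; exact: ZT.
  exact: intertwines_lin.
- by apply: thetaE => //; exact: intertwines_id.
- move=> n M ZM.
  have iM i j : intertwines N (M i j) (theta (M i j)) by have [] := thetaP _ (ZM i j).
  have bM i j : bounded_op H H (M i j) by exact/Sb/ZS.
  have bT i j : bounded_op K K (theta (M i j)).
    by have [z _] := thetaP _ (ZM i j); exact/Tb/ZT.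
  have E : (fun i j => (map_mx theta M) i j) = (fun i j => theta (M i j)).
    by apply/funext => i; apply/funext => j; rewrite mxE.
  split=> h.
    have : mpos (fun i j => theta (M i j) : K -> K) by exact: (intertwines_mpos link bM bT iM).
    by rewrite -E.
  have h' : mpos (fun i j => theta (M i j) : K -> K) by rewrite -E.
  exact: (intertwines_mpos (tro_linked_sym link) bT bM (fun i j => intertwines_sym link (iM i j)) h').
Qed.

(** Inserting the frame of the reversed link on the right gives a^* b s = sum a^* (b s m_i) (m_i^*
    g), where b s m_i lies in T and m_i^* g in N. So products of N^* and N are multipliers of S. *)
Lemma linked_mul_left a b s : N a -> N b -> S s -> S (adj a \o b \o s).
Proof.
move=> Na Nb Ss; have [n [m [g [Nm [bg pg] Ng hg gh]]]] := tro_frame (tro_linked_sym link).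
have bb := tl_bop link Nb; have ba := adj_bop (tl_bop link Na); have bs := Sb Ss.
have [_ sS _ _] := tl_S link.
have Nm' i : N (adj (m i)).
  by have [c Nc <-] := Nm i; rewrite adjK //; exact: (tl_bop link).
have Ngm i : N (adj (m i) \o g).
  have [c Nc ce] := Ng _ (Nm i); have bm : bounded_op K H (m i).
    by have [d Nd <-] := Nm i; apply: adj_bop; exact: (tl_bop link).
  have sg := posop_sa bg pg.
  have -> : adj (m i) \o g = adj (g \o m i) by rewrite adj_comp // (adjE bg sg).
  by rewrite -ce adjK //; exact: (tl_bop link).
have -> : adj a \o b \o s =
    \sum_i (adj a \o (b \o s \o adj (adj (m i))) \o (adj (m i) \o g)).
  apply/funext => u; rewrite sumopE /= -{1}(hg u) (op_sum bs) (op_sum bb) (op_sum ba).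
  apply: eq_bigr => i _; rewrite adjK //.
  by have [c Nc <-] := Nm i; apply: adj_bop; exact: (tl_bop link).
apply: (subspace_sum sS) => i _; apply: (tl_TS link) => //.
exact: (tl_ST link).
Qed.

Lemma linked_mul_right a b s : N a -> N b -> S s -> S (s \o adj a \o b).
Proof.
move=> Na Nb Ss; have bb := tl_bop link Nb; have ba := tl_bop link Na; have bs := Sb Ss.
have bb' := adj_bop bb; have ba' := adj_bop ba; have bs' := adj_bop bs.
have := opsys_adj (tl_S link) (linked_mul_left Nb Na (opsys_adj (tl_S link) Ss)).
rewrite (adj_comp (bop_comp bb' ba) bs') (adj_comp bb' ba) !adjK //.
Qed.

Lemma linked_mul a b : N a -> N b -> S (adj a \o b).
Proof.
by move=> Na Nb; have [_ _ S1 _] := tl_S link; exact: (linked_mul_left Na Nb S1).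
Qed.
End Iso.

Section Envelope.
Variables (H : hilbert R) (S : set (opspace H)) (E : cstar_envelope S).
Hypothesis oS : operator_system S.

Lemma ucoe_id : ucoe S (idfun : opspace H -> opspace H).
Proof.
have [Sb _ _ _] := oS; split=> // n M _; by rewrite map_mx_id.
Qed.

(** The identity representation of S is itself a C*-cover, so [env_map] is the restriction of a
    multiplicative map and respects those products that stay inside S. *)
Lemma env_mul (s t : H -> H) : S s -> S t -> S (s \o t) ->
  env_map E (s \o t) = (env_map E s : _ -> _) \o env_map E t.
Proof.
move=> Ss St Sst; have [pi [_ _ piM _] pij] := env_univ E ucoe_id.
have gen x : S x -> cstar_gen (idfun @` S) x by move=> Sx A [_]; apply; exists x.
have := piM s t (gen _ Ss) (gen _ St); rewrite !pij //.
Qed.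

Lemma env_algebra_gen s : S s -> env_algebra E (env_map E s).
Proof. by move=> Ss A [_]; apply; exists s. Qed.

Lemma centre_commutes x d : centre E x -> S d -> S (x \o d) -> S (d \o x) ->
  (x : H -> H) \o d = d \o x.
Proof.
move=> [Sx cx] Sd Sxd Sdx; apply: (ucoe_inj oS (env_ucoe E)) => //.
rewrite (env_mul Sx Sd Sxd) (env_mul Sd Sx Sdx); apply: cx; exact: env_algebra_gen.
Qed.

Let L := env_space E.
Definition env_kernel (s : H -> H) (u v : L) : R[i] := hdot L (env_map E s u) v.

Lemma env_kernel_linear : kernel_linear S env_kernel.
Proof.
move=> a x y Sx Sy p q; have [_ l _ _] := env_ucoe E.
by rewrite /env_kernel l // !opE dotDl dotZl.
Qed.

Lemma env_kernel_faithful : kernel_faithful S env_kernel.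
Proof.
move=> n x Sx; apply: (iff_trans (ucoe_mpos (env_ucoe E) Sx)).
have fE s (l l' : seq (R[i] * L)) : S s -> kform (env_kernel s) l l' =
    hdot L (env_map E s (\sum_(p <- l) p.1 *: p.2)) (\sum_(p <- l') p.1 *: p.2).
  move=> Ss; have bs := ucoe_bop (env_ucoe E) Ss.
  rewrite (op_sum bs) dot_suml; apply: eq_bigr => p _.
  rewrite (opZ bs) dotZl dot_sumr mulr_sumr; apply: eq_bigr => q _.
  by rewrite dotZr /env_kernel mulrA.
split=> h.
  move=> l; have := h (fun i => \sum_(p <- l i) p.1 *: p.2).
  suff -> : \sum_i \sum_j kform (env_kernel (x i j)) (l j) (l i) =
    \sum_i \sum_j hdot L (env_map E (x i j) (\sum_(p <- l j) p.1 *: p.2))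
      (\sum_(p <- l i) p.1 *: p.2) by [].
  by apply: eq_bigr => i _; apply: eq_bigr => j _; rewrite fE.
move=> xi; have := h (fun i => [:: (1, xi i)]).
suff -> : \sum_i \sum_j kform (env_kernel (x i j)) [:: (1, xi j)] [:: (1, xi i)] =
  \sum_i \sum_j hdot L (env_map E (x i j) (xi j)) (xi i) by [].
by apply: eq_bigr => i _; apply: eq_bigr => j _; rewrite kform_1.
Qed.
End Envelope.

Section Transfer.
Variables (H K : hilbert R) (N : set (H -> K)) (S : set (opspace H)) (T : set (opspace K)).
Hypothesis link : tro_linked N S T.
Variables (ES : cstar_envelope S) (ET : cstar_envelope T).

(* T is represented on the induced space N (x) L, with L the space of the envelope
   of S; there the partner y of a central x acts by a (x) u |-> a (x) x u. *)
Lemma centre_transfer x : centre ES x ->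
  exists2 y : K -> K, centre ET y & intertwines N x y.
Proof.
move=> cx; have [Sx cx'] := cx; have oS := tl_S link; have oT := tl_T link.
have [Sb sS S1 _] := oS.
have bx := Sb _ Sx; have Sx' := opsys_adj oS Sx.
(* The products x a^* b and a^* b x both remain in S, so commutation in the envelope can be pulled
   back to S. *)
have cd a b : N a -> N b -> (x : H -> H) \o (adj a \o b) = (adj a \o b) \o x.
  move=> Na Nb; apply: (centre_commutes oS cx).
  - exact: (linked_mul link).
  - exact: (linked_mul_right link).
  - exact: (linked_mul_left link).
have [y Ty xy] : exists2 y, T y & intertwines N x y.
  apply: (intertwines_ex link) => // a b Na Nb u.
  exact: (congr1 (fun f => f u) (cd a b Na Nb)).
exists y => //.
have kl := link_kernel_linear link (@env_kernel_linear _ _ ES).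
have kf := link_kernel_faithful link (@env_kernel_faithful _ _ ES).
pose L := env_space ES.
have bL s : S s -> bounded_op L L (env_map ES s) by exact: (ucoe_bop (env_ucoe ES)).
pose Az (p : {a | N a} * L) := (p.1, env_map ES x p.2).
pose Az' (p : {a | N a} * L) := (p.1, adj (env_map ES x : L -> L) p.2).
apply: (commute_centre oT) => // t Tt.
apply: (criterion_commute ET oT kl kf (z := y) (Az := Az) (Az' := Az')) => //.
- move=> s Ts [[a Na] p] [[b Nb] q]; rewrite /link_kernel /env_kernel /=.
  have Sb' : S (adj b \o s \o a) by exact: (tl_TS link).
  rewrite (dot_adjr (bL _ Sx)); congr (hdot L _ q).
  exact: (esym (congr1 (fun f : L -> L => f p) (cx' _ (@env_algebra_gen _ _ ES _ Sb')))).
- move=> [[a Na] p] [[b Nb] q]; rewrite /link_kernel /env_kernel /=.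
  have -> : adj b \o y \o a = (adj b \o a) \o x.
    by apply/funext => u /=; rewrite xy.1.
  by rewrite (env_mul ES oS (linked_mul link Nb Na) Sx (linked_mul_left link Nb Na Sx)).
Qed.
End Transfer.

Lemma linked_centres (H K : hilbert R) (N : set (H -> K)) (S : set (opspace H))
    (T : set (opspace K)) (ES : cstar_envelope S) (ET : cstar_envelope T) :
  tro_linked N S T -> uco_isomorphic (centre ES) (centre ET).
Proof.
move=> link; apply: (intertwined_iso link); [by move=> ? []|by move=> ? []| |].
  by move=> x cx; exact: (centre_transfer link ET cx).
move=> y cy; have [x cx xy] := centre_transfer (tro_linked_sym link) ES cy.
exists x => //; split=> a Na.
  move=> u; have [_ h] := xy.
  have := h (adj a); rewrite adjK; last exact: (tl_bop link).
  by move=> ->//; exists a.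
move=> v; have [h _] := xy; rewrite h //; by exists a.
Qed.
End CentreTransfer.

(** * Passing from linked closures to Delta-equivalent systems *)

Section DeltaEquivalence.
Variable R : realType.

Lemma uco_isomorphic_trans (A B C : mospace R) (X : set A) (Y : set B) (Z : set C) :
  uco_isomorphic X Y -> uco_isomorphic Y Z -> uco_isomorphic X Z.
Proof.
move=> [phi uphi <-] [psi upsi <-]; exists (psi \o phi); first exact: ucoe_comp.
by rewrite image_comp.
Qed.

Lemma envelope_extend (H K : hilbert R) (S : set (opspace H)) (phi : opspace H -> opspace K)
    (E : cstar_envelope (opclosure S)) : operator_system S -> ucoe S phi ->
  exists (phi' : opspace H -> opspace K) (E' : cstar_envelope (opclosure (phi @` S))),
    [/\ ucoe (opclosure S : set (opspace H)) phi',
        phi' @` (opclosure S : set (opspace H)) = opclosure (phi @` S) &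
        centre E' = phi' @` (centre E)].
Proof.
move=> oS uphi; have [phi' [uphi' _ im]] := ucoe_extend oS uphi.
exists phi'; have := envelope_transport E (opsys_closure oS) uphi'.
by rewrite im => -[E' cE]; exists E'.
Qed.

(** Both embeddings extend to the closures and carry the given envelopes to envelopes of the images,
    whose centres are linked; the inverse of the second extension leads back. *)
Lemma delta_centres (H K : hilbert R) (S : set (opspace H)) (T : set (opspace K))
    (ES : cstar_envelope (opclosure S)) (ET : cstar_envelope (opclosure T)) :
  operator_system S -> operator_system T -> delta_equivalent S T ->
  uco_isomorphic (centre ES) (centre ET).
Proof.
move=> oS oT [H1 [K1 [phi [psi [uphi upsi tro]]]]].
have oS1 := ucoe_image_opsys oS (opspace_order_bounded oS) uphi.
have oT1 := ucoe_image_opsys oT (opspace_order_bounded oT) upsi.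
have [N link] := tro_equivalent_linked oS1 oT1 tro.
have [phi' [E1 [uphi' _ cE1]]] := envelope_extend ES oS uphi.
have [psi' [E2 [upsi' _ cE2]]] := envelope_extend ET oT upsi.
have iso := linked_centres E1 E2 link; rewrite cE1 cE2 in iso.
have subS : centre ES `<=` opclosure S by move=> x [].
have subT : centre ET `<=` opclosure T by move=> x [].
apply: (@uco_isomorphic_trans _ (opspace H1) _ _ (phi' @` centre ES)).
  by exists phi' => //; exact: ucoe_sub uphi'.
apply: (uco_isomorphic_trans iso).
have [chi [uchi chiK]] := ucoe_inverse (opsys_closure oT) upsi'.
exists chi.
  by apply: (ucoe_sub _ uchi) => _ [x cx <-]; exists x => //; exact: subT.
apply/seteqP; split; first by move=> _ [_ [x cx <-] <-]; rewrite chiK //; exact: subT.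
by move=> x cx; exists (psi' x); [exists x|rewrite chiK //; exact: subT].
Qed.
End DeltaEquivalence.
(** * Multiplicative states and multipliers *)

(* Linear identities between operators, checked on matrix coefficients. *)
Ltac op_ring := apply: op_ext => ? ?; rewrite /= ?opE ?(dotDl, dotNl, dotZl, dot0l); ring.
Ltac op_field := apply: op_ext => ? ?; rewrite /= ?opE ?(dotDl, dotNl, dotZl, dot0l);
  field; rewrite ?fmorph_eq0 //.

Lemma sa_bounded (R : realType) (K : hilbert R) (t : K -> K) :
  bounded_op K K t -> is_adjoint t t ->
  exists2 k : R, 0 < k & posop (k%:C *: idfun + t) /\ posop (k%:C *: idfun - t).
Proof.
move=> bt st; have [k k0 hk] := op_bound bt; exists k => //.
have cs x : cn (hdot K (t x) x) <= k * nr x ^+ 2.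
  apply: (le_trans (cauchy_schwarz _ _)).
  by rewrite expr2 mulrA ler_wpM2r ?nr_ge0.
split=> x; apply/ge0cP; rewrite !opE.
  rewrite dotDl dotZl dotxx !cE (sa_real st) !(mul0r, mulr0, addr0, subr0); split=> //.
  by have := re_geN_cn (hdot K (t x) x); have := cs x; lra.
rewrite dotBl dotZl dotxx !cE (sa_real st) !(mul0r, mulr0, addr0, subr0, oppr0); split=> //.
by have := re_le_cn (hdot K (t x) x); have := cs x; lra.
Qed.

Lemma sa_decompose (R : realType) (K : hilbert R) (T : set (opspace K)) (t : K -> K) :
  operator_system T -> T t -> exists a b : K -> K,
  [/\ T a, is_adjoint a a, T b, is_adjoint b b & t = 'i%C *: a + b].
Proof.
move=> oT Tt; have [Tb sT _ _] := oT; have bt := Tb _ Tt; have Tt' := opsys_adj oT Tt.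
have [h h'] := (adjP bt, adjoint_sym (adjP bt)).
exists (((- 'i%C) * (2^-1 : R)%:C) *: (t - adj t)), ((2^-1 : R)%:C *: (t + adj t)); split.
- by apply: (subspaceZ sT); exact: (subspaceB sT).
- have := is_adjointZ ((- 'i%C) * (2^-1 : R)%:C) (is_adjointB h h').
  suff -> : Num.conj ((- 'i%C) * (2^-1 : R)%:C : R[i]) *: (adj t - t) =
     (- 'i%C * (2^-1)%:C) *: (t - adj t) by [].
  rewrite -opprB scalerN -scaleNr; congr (_ *: _).
  by apply: ceqP; rewrite !cE; ring.
- by apply: (subspaceZ sT); exact: (subspaceD sT).
- have := is_adjointZ (2^-1 : R)%:C (is_adjointD h h').
  by rewrite conjC_real [adj t + t]addrC.
apply: op_ext => x y; rewrite !opE !(dotDl, dotZl, dotNl).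
by apply: ceqP; rewrite !cE; field.
Qed.

Section MultiplicativeStates.
Variables (R : realType) (K : hilbert R) (T : set (opspace K)).
Hypothesis oT : operator_system T.
Implicit Types (s t d : K -> K).

Definition multiplier d := bounded_op K K d /\
  forall t, T t -> T (d \o t) /\ T (t \o d).
Hypothesis mult_central : forall d t, multiplier d -> T t -> d \o t = t \o d.

Let Tb : forall t, T t -> bounded_op K K t. Proof. by case: oT. Qed.
Let sT : @Defs.subspace _ (K -> K) T. Proof. by case: oT. Qed.
Let T1 : T idfun. Proof. by case: oT. Qed.
Let Tadj : forall t t', T t -> is_adjoint t t' -> T t'. Proof. by case: oT. Qed.

Let Tsa t := T t /\ is_adjoint t t.
Let Dpos d := multiplier d /\ posop d.
Let sc (r : R) : K -> K := r%:C *: idfun.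

Let T_D d : multiplier d -> T d. Proof. by move=> [_ /(_ _ T1)[]]. Qed.
Let Dc d t x : multiplier d -> T t -> d (t x) = t (d x).
Proof. by move=> Dd Tt; exact: (congr1 (fun f => f x) (mult_central Dd Tt)). Qed.
Lemma mult_lin a d d' : multiplier d -> multiplier d' -> multiplier (a *: d + d').
Proof.
move=> [bd hd] [bd' hd']; split; first by apply: bopD => //; exact: bopZ.
move=> t Tt; have [h1 h2] := hd _ Tt; have [h3 h4] := hd' _ Tt; split.
  have -> : (a *: d + d') \o t = a *: (d \o t) + (d' \o t) by [].
  exact: sT.2.
have -> : t \o (a *: d + d') = a *: (t \o d) + (t \o d').
  by apply/funext => x; rewrite /= !opE (opD (Tb Tt)) (opZ (Tb Tt)).
exact: sT.2.
Qed.
Lemma mult_id : multiplier idfun. Proof. by split; [exact: bop_id|]. Qed.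
Lemma mult_comp d d' : multiplier d -> multiplier d' -> multiplier (d \o d').
Proof.
move=> [bd hd] [bd' hd']; split; first exact: bop_comp.
move=> t Tt; split; first exact: (hd _ (hd' _ Tt).1).1.
exact: (hd' _ (hd _ Tt).2).2.
Qed.
Lemma mult_adj d : multiplier d -> multiplier (adj d).
Proof.
move=> [bd hd]; split; first exact: adj_bop.
move=> t Tt; have bt := Tb Tt; have Tt' : T (adj t) by exact: (Tadj Tt (adjP bt)).
have [h1 h2] := hd _ Tt'; split.
  apply: (Tadj h2); have := is_adjoint_comp (adjP (adj_bop bt)) (adjP bd).
  by rewrite adjK.
by apply: (Tadj h1); have := is_adjoint_comp (adjP bd) (adjP (adj_bop bt)); rewrite adjK.
Qed.
Lemma mult_sc r : multiplier (sc r).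
Proof.
have -> : sc r = (r - 1)%:C *: idfun + idfun by rewrite /sc; op_ring.
by apply: mult_lin; exact: mult_id.
Qed.

Let TsaZ (r : R) t : Tsa t -> Tsa (r%:C *: t).
Proof.
move=> [Tt ht]; split; first exact: (subspaceZ sT).
by have := is_adjointZ r%:C ht; rewrite conjC_real.
Qed.
Let Tsa_sc r : Tsa (sc r). Proof. exact: TsaZ. Qed.
Let TsaD s t : Tsa s -> Tsa t -> Tsa (s + t).
Proof.
by move=> [Ts hs] [Tt ht]; split; [exact: (subspaceD sT)|exact: is_adjointD].
Qed.
Let TsaN t : Tsa t -> Tsa (- t).
Proof. by move=> [Tt ht]; split; [exact: (subspaceN sT)|exact: is_adjointN]. Qed.
Let TsaB s t : Tsa s -> Tsa t -> Tsa (s - t).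
Proof. by move=> ? ?; apply: TsaD => //; exact: TsaN. Qed.
Let Tsa_pos t : T t -> posop t -> Tsa t.
Proof. by move=> Tt pt; split=> //; apply: posop_sa => //; exact: Tb. Qed.
Let Tsa_mul d t : multiplier d -> is_adjoint d d -> Tsa t -> Tsa (d \o t).
Proof.
move=> Dd hd [Tt ht]; split; first exact: (Dd.2 _ Tt).1.
by rewrite {2}(mult_central Dd Tt); exact: is_adjoint_comp.
Qed.
Let pos_mul d t : Dpos d -> T t -> posop t -> posop (d \o t).
Proof.
move=> [Dd pd] Tt pt; rewrite (mult_central Dd Tt).
apply: posop_mul => //; [exact: Tb|exact: Dd.1|].
by move=> x; rewrite (Dc _ Dd Tt).
Qed.
Let Dpos_comp d d' : Dpos d -> Dpos d' -> Dpos (d \o d').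
Proof.
move=> hd hd'; split; first exact: (mult_comp hd.1 hd'.1).
by apply: pos_mul => //; [exact: T_D hd'.1|exact: hd'.2].
Qed.
Let posop_sc r : 0 <= r -> posop (sc r).
Proof. by move=> r0 x; rewrite /sc opE dotZl mulr_ge0 ?ler0c // dotxx_ge0. Qed.
Let Dpos_sc r : 0 <= r -> Dpos (sc r).
Proof. by move=> r0; split; [exact: mult_sc|exact: posop_sc]. Qed.

Let bound t : Tsa t -> exists2 k : R, 0 < k & posop (sc k + t) /\ posop (sc k - t).
Proof. by move=> [Tt st]; exact: sa_bounded (Tb Tt) st. Qed.

(* Proper cones of selfadjoint elements of T that are modules over the positive
   multipliers. *)
Record cone (Q : set (K -> K)) : Prop := Cone {
  cone_sa : forall t, Q t -> Tsa t;
  cone_pos : forall t, T t -> posop t -> Q t;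
  cone_add : forall s t, Q s -> Q t -> Q (s + t);
  cone_mul : forall d t, Dpos d -> Q t -> Q (d \o t);
  cone_proper : ~ Q (sc (-1)) }.

Let sc_comp r t : sc r \o t = r%:C *: t. Proof. by []. Qed.
Let scD r r' : sc r + sc r' = sc (r + r').
Proof. by rewrite /sc -scalerDl -rmorphD. Qed.
Let scN r : - sc r = sc (- r).
Proof. by rewrite /sc -scaleNr -rmorphN. Qed.
Let scB r r' : sc r - sc r' = sc (r - r').
Proof. by rewrite scN scD. Qed.
Let scZ r r' : r%:C *: sc r' = sc (r * r').
Proof. by rewrite /sc scalerA -rmorphM. Qed.

Section OneCone.
Variable Q : set (K -> K).
Hypothesis cQ : cone Q.

Lemma cone_scale (r : R) t : 0 <= r -> Q t -> Q (r%:C *: t).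
Proof. by move=> r0 Qt; rewrite -sc_comp; apply: (cone_mul cQ) => //; exact: Dpos_sc. Qed.
Lemma cone_sc r : Q (sc r) -> 0 <= r.
Proof.
move=> Qr; rewrite leNgt; apply/negP => r0; apply: (cone_proper cQ).
have nr0 : 0 <= (- r)^-1 by rewrite invr_ge0 oppr_ge0 ltW.
have := cone_scale nr0 Qr; rewrite scZ.
by have -> : (- r)^-1 * r = -1 by field; rewrite lt_eqF.
Qed.
Lemma cone_scP r : 0 <= r -> Q (sc r).
Proof.
move=> r0; apply: (cone_pos cQ); last exact: posop_sc.
exact: (T_D (mult_sc r)).
Qed.

Hypothesis total : forall t, Tsa t -> Q t \/ Q (- t).

(** The number at which t is cut in the preorder of Q. The tolerance e is there because Q need not
    be closed. *)
Definition value t (v : R) := forall e : R, 0 < e -> Q (t - sc (v - e)) /\ Q (sc (v + e) - t).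

Lemma value_le s t v w : value s v -> value t w -> Q (t - s) -> v <= w.
Proof.
move=> hv hw Qts; apply/ler_addgt0Pr => e e0; have e2 : 0 < e / 2 by lra.
have := cone_add cQ (cone_add cQ (hv _ e2).1 Qts) (hw _ e2).2.
have -> : s - sc (v - e / 2) + (t - s) + (sc (w + e / 2) - t) = sc (w + e - v).
  by rewrite /sc; op_field.
by move/cone_sc; lra.
Qed.
Let Q0 : Q 0. Proof. by have := cone_scP (lexx 0); rewrite /sc scale0r. Qed.
Lemma value_uniq t v w : value t v -> value t w -> v = w.
Proof.
move=> hv hw; apply/eqP; rewrite eq_le.
by rewrite (value_le hv hw) ?(value_le hw hv) // subrr.
Qed.
Lemma value_ex t : Tsa t -> exists v, value t v.
Proof.
move=> st; have [k k0 [pk1 pk2]] := bound st; have [Tt _] := st.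
pose A := [set r : R | Q (t - sc r)].
have A0 : A !=set0.
  exists (- k); apply: (cone_pos cQ).
    by apply: (subspaceB sT) => //; exact: (T_D (mult_sc _)).
  by have -> : t - sc (- k) = sc k + t by rewrite /sc; op_ring.
have ub : ubound A k.
  move=> r Qr; have Qk : Q (sc k - t).
    apply: (cone_pos cQ) => //; apply: (subspaceB sT) => //; exact: (T_D (mult_sc _)).
  have := cone_add cQ Qr Qk.
  have -> : t - sc r + (sc k - t) = sc (k - r) by rewrite /sc; op_ring.
  by move/cone_sc; lra.
have hA : has_sup A by split=> //; exists k.
exists (sup A) => e e0; split.
  have [r Ar hr] := sup_adherent e0 hA.
  have -> : t - sc (sup A - e) = t - sc r + sc (r - (sup A - e)).
    by rewrite /sc; op_ring.
  by apply: (cone_add cQ) => //; apply: cone_scP; rewrite subr_ge0 ltW.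
have [|] := total (TsaB st (Tsa_sc (sup A + e))); last by rewrite opprB.
move=> h; have := sup_ubound (ex_intro _ k ub) h.
by rewrite gerDl leNgt e0.
Qed.
Lemma valueD s t v w : value s v -> value t w -> value (s + t) (v + w).
Proof.
move=> hv hw e e0; have e2 : 0 < e / 2 by lra.
have [h1 h2] := hv _ e2; have [h3 h4] := hw _ e2; split.
  have -> : s + t - sc (v + w - e) = (s - sc (v - e / 2)) + (t - sc (w - e / 2)).
    by rewrite /sc; op_field.
  exact: (cone_add cQ).
have -> : sc (v + w + e) - (s + t) = (sc (v + e / 2) - s) + (sc (w + e / 2) - t).
  by rewrite /sc; op_field.
exact: (cone_add cQ).
Qed.
Lemma valueN t v : value t v -> value (- t) (- v).
Proof.
move=> hv e e0; have [h1 h2] := hv _ e0; split.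
  by have -> : - t - sc (- v - e) = sc (v + e) - t by rewrite /sc; op_ring.
by have -> : sc (- v + e) - - t = t - sc (v - e) by rewrite /sc; op_ring.
Qed.
Lemma value_pos t v : T t -> posop t -> value t v -> 0 <= v.
Proof.
move=> Tt pt hv; apply/ler_addgt0Pr => e e0.
have := cone_add cQ (hv _ e0).2 (cone_pos cQ Tt pt).
by rewrite subrK => /cone_sc.
Qed.
Lemma value_sc r : value (sc r) r.
Proof.
by move=> e e0; rewrite !scB; split; apply: cone_scP; lra.
Qed.
Lemma value_mul d t v w : Dpos d -> value d v -> Tsa t -> value t w -> value (d \o t) (v * w).
Proof.
move=> pd hv st hw; have [Dd ppd] := pd; have [bd _] := Dd.
have sd : Tsa d by exact: (Tsa_pos (T_D Dd) ppd).
have [k k0 [_ pk]] := bound sd.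
(* Only the lower estimate is needed, the upper one being that for -t. It adds d (t' - w' + e/(2k))
   and w' d - v w' + e/2, treated by the sign of w', to e/2 - (e/(2k)) d, which is positive since d
   <= k. *)
have lower t' w' : value t' w' -> forall e, 0 < e -> Q ((d \o t') - sc (v * w' - e)).
  move=> ht e e0.
  have e1 : 0 < e / (2 * k) by rewrite divr_gt0 // mulr_gt0.
  have w1 : 0 < `|w'| + 1 by rewrite ltr_wpDl.
  have e2 : 0 < e / (2 * (`|w'| + 1)) by rewrite divr_gt0 // mulr_gt0.
  have e2E : e / (2 * (`|w'| + 1)) * (`|w'| + 1) = e / 2 by field; rewrite gt_eqF.
  have q1 := cone_mul cQ pd (ht _ e1).1.
  have q2 : Q (w'%:C *: d - sc (v * w' - e / 2)).
    have [h1 h2] := hv _ e2; move: (e / (2 * _)) e2 e2E h1 h2 => f f0 fE h1 h2.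
    have [w0|w0] := leP 0 w'.
      have := cone_add cQ (cone_scale w0 h1) (cone_scP (_ : 0 <= e / 2 - w' * f)).
      have -> : w'%:C *: (d - sc (v - f)) + sc (e / 2 - w' * f) =
        w'%:C *: d - sc (v * w' - e / 2) by rewrite /sc; op_field.
      by apply; rewrite -fE (ger0_norm w0); nra.
    have nw0 : 0 <= - w' by rewrite oppr_ge0 ltW.
    have := cone_add cQ (cone_scale nw0 h2) (cone_scP (_ : 0 <= e / 2 + w' * f)).
    have -> : (- w')%:C *: (sc (v + f) - d) + sc (e / 2 + w' * f) =
      w'%:C *: d - sc (v * w' - e / 2) by rewrite /sc; op_field.
    by apply; rewrite -fE (ltr0_norm w0); nra.
  have q3 : Q (sc (e / 2) - (e / (2 * k))%:C *: d).
    have -> : sc (e / 2) - (e / (2 * k))%:C *: d = (e / (2 * k))%:C *: (sc k - d).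
      by rewrite /sc; op_field; rewrite gt_eqF.
    apply: cone_scale; first exact: ltW.
    apply: (cone_pos cQ) => //; apply: (subspaceB sT); [exact: (T_D (mult_sc _))|exact: sd.1].
  have := cone_add cQ (cone_add cQ q1 q2) q3.
  have -> : d \o (t' - sc (w' - e / (2 * k))) =
      (d \o t') - ((w' - e / (2 * k))%:C *: d).
    by apply/funext => x; rewrite /sc /= !opE (opB bd) (opZ bd).
  suff -> : ((d \o t') - (w' - e / (2 * k))%:C *: d) + (w'%:C *: d - sc (v * w' - e / 2)) +
     (sc (e / 2) - (e / (2 * k))%:C *: d) = (d \o t') - sc (v * w' - e) by [].
  by rewrite /sc; op_field; rewrite gt_eqF.
move=> e e0; split; first exact: lower.
have := lower _ _ (valueN hw) e e0.
suff -> : (d \o (- t)) - sc (v * - w - e) = sc (v * w + e) - (d \o t) by [].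
have -> : d \o (- t) = - (d \o t) by apply/funext => x; rewrite /= !opE (opN bd).
by rewrite /sc; op_ring.
Qed.
End OneCone.

Let rp t : K -> K := (2^-1 : R)%:C *: (t + adj t).
Let T_adj t : T t -> T (adj t). Proof. by move=> Tt; apply: (Tadj Tt); exact/adjP/Tb. Qed.
Let Tsa_rp t : T t -> Tsa (rp t).
Proof.
move=> Tt; split; first by apply: (subspaceZ sT); apply: (subspaceD sT) => //; exact: T_adj.
have h := is_adjointZ (2^-1 : R)%:C (is_adjointD (adjP (Tb Tt)) (adjoint_sym (adjP (Tb Tt)))).
by move: h; rewrite conjC_real [adj t + t]addrC.
Qed.
Let rp_lin a s t : T s -> T t ->
  rp (a *: s + t) = (re a)%:C *: rp s + ((- im a)%:C *: rp (- 'i%C *: s) + rp t).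
Proof.
move=> Ts Tt; rewrite /rp adj_lin; [|exact: Tb|exact: Tb].
have -> : adj (- 'i%C *: s) = 'i%C *: adj s.
  apply: adjE; first by apply: bopZ; exact: Tb.
  have := is_adjointZ (- 'i%C) (adjP (Tb Ts)).
  by have -> : Num.conj (- 'i%C : R[i]) = 'i%C by apply: ceqP; rewrite !cE ?opprK ?oppr0.
apply: op_ext => x y; rewrite !opE !(dotDl, dotZl).
by apply: ceqP; rewrite !cE; field.
Qed.
Let rp_dec t : T t -> t = 'i%C *: rp (- 'i%C *: t) + rp t.
Proof.
move=> Tt; rewrite /rp.
have -> : adj (- 'i%C *: t) = 'i%C *: adj t.
  apply: adjE; first by apply: bopZ; exact: Tb.
  have := is_adjointZ (- 'i%C) (adjP (Tb Tt)).
  by have -> : Num.conj (- 'i%C : R[i]) = 'i%C by apply: ceqP; rewrite !cE ?opprK ?oppr0.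
apply: op_ext => x y; rewrite !opE !(dotDl, dotZl).
by apply: ceqP; rewrite !cE; field.
Qed.
Let rp_sa t : Tsa t -> rp t = t.
Proof.
move=> [Tt st]; rewrite /rp (adjE (Tb Tt) st); op_field.
Qed.
Let rp_sa0 t : Tsa t -> rp (- 'i%C *: t) = 0.
Proof.
move=> [Tt st]; rewrite /rp.
have -> : adj (- 'i%C *: t) = 'i%C *: t.
  apply: adjE; first by apply: bopZ; exact: Tb.
  have := is_adjointZ (- 'i%C) st.
  by have -> : Num.conj (- 'i%C : R[i]) = 'i%C by apply: ceqP; rewrite !cE ?opprK ?oppr0.
by rewrite scaleNr addNr scaler0.
Qed.

(** Cutting by a total cone gives a real linear functional on selfadjoint elements; it is
    complexified through t = Re t + i Im t. Multiplicativity is known for positive multipliers and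
    spreads to selfadjoint and then to all multipliers. *)
Lemma cone_state Q : cone Q -> (forall t, Tsa t -> Q t \/ Q (- t)) ->
  exists f : (K -> K) -> R[i],
    [/\ forall a s t, T s -> T t -> f (a *: s + t) = a * f s + f t,
        forall t, T t -> posop t -> 0 <= f t, f idfun = 1,
        forall d t, multiplier d -> T t -> f (d \o t) = f d * f t &
        forall t v, Tsa t -> value Q t v -> f t = v%:C].
Proof.
move=> cQ total.
pose v t : R := xget 0 [set r | value Q t r].
have vP t : Tsa t -> value Q t (v t).
  by move=> /(value_ex cQ total)[r hr]; exact: (@xgetI _ 0 [set r0 | value Q t r0] r hr).
have vE t r : value Q t r -> v t = r.
  move=> hr; have hv : value Q t (v t) by exact: (@xgetI _ 0 [set r0 | value Q t r0] r hr).
  exact: (value_uniq cQ hv hr).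
have v0 : v 0 = 0 by apply: vE; have := value_sc cQ 0; rewrite /sc scale0r.
have valZ r t w : Tsa t -> value Q t w -> value Q (r%:C *: t) (r * w).
  move=> st hw; have [r0|r0] := leP 0 r.
    exact: (value_mul cQ (Dpos_sc r0) (value_sc cQ r) st hw).
  have nr0 : 0 <= - r by rewrite oppr_ge0 ltW.
  have := valueN (value_mul cQ (Dpos_sc nr0) (value_sc cQ _) st hw).
  have -> : - (- r * w) = r * w by ring.
  by have -> : - (sc (- r) \o t) = r%:C *: t by rewrite /sc; op_ring.
have vD s t : Tsa s -> Tsa t -> v (s + t) = v s + v t.
  by move=> ss st; apply: vE; apply: (valueD cQ); exact: vP.
have vZ r t : Tsa t -> v (r%:C *: t) = r * v t.
  by move=> st; apply: vE; apply: valZ => //; exact: vP.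
pose f t : R[i] := (v (rp t))%:C + 'i%C * (v (rp (- 'i%C *: t)))%:C.
have TZ a t : T t -> T (a *: t) by exact: (subspaceZ sT).
have flin a s t : T s -> T t -> f (a *: s + t) = a * f s + f t.
  move=> Ts Tt; rewrite /f scalerDr scalerA.
  have Tis := TZ (- 'i%C) _ Ts; have Tit := TZ (- 'i%C) _ Tt.
  have s1 := Tsa_rp Ts; have s2 := Tsa_rp Tis; have s3 := Tsa_rp Tt; have s4 := Tsa_rp Tit.
  have v3 p q x y z : Tsa x -> Tsa y -> Tsa z ->
      v (p%:C *: x + (q%:C *: y + z)) = p * v x + (q * v y + v z).
    move=> sx sy sz; rewrite vD; [|exact: TsaZ|by apply: TsaD => //; exact: TsaZ].
    by rewrite vD ?vZ //; exact: TsaZ.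
  rewrite (rp_lin a Ts Tt) (rp_lin _ Ts Tit) !v3 //.
  by apply: ceqP; rewrite !cE; ring.
have fsa t : Tsa t -> f t = (v t)%:C.
  by move=> st; rewrite /f rp_sa // rp_sa0 // v0 mulr0 addr0.
have fmul_sa d t : multiplier d -> is_adjoint d d -> Tsa t -> f (d \o t) = f d * f t.
  move=> Dd sd st; have sd' : Tsa d by split=> //; exact: T_D.
  rewrite !fsa //; last exact: Tsa_mul.
  (* A selfadjoint multiplier becomes positive after adding the scalar k, for which multiplicativity
     is just scaling. *)
  rewrite -rmorphM; congr (_%:C); have [k k0 [pk _]] := bound sd'.
  have Dk : Dpos (sc k + d).
    split=> //; have := mult_lin 1 (mult_sc k) Dd; by rewrite scale1r.
  have hk : value Q (sc k + d) (k + v d) by apply: (valueD cQ); [exact: value_sc|exact: vP].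
  have := vE _ _ (value_mul cQ Dk hk st (vP _ st)).
  have -> : (sc k + d) \o t = k%:C *: t + (d \o t) by [].
  rewrite vD; [|exact: TsaZ|exact: Tsa_mul]; rewrite vZ // mulrDl => h.
  by apply: (@addrI _ (k * v t)); rewrite h.
have fmul_r d t : multiplier d -> is_adjoint d d -> T t -> f (d \o t) = f d * f t.
  move=> Dd sd Tt; have [bd _] := Dd.
  have s1 := Tsa_rp Tt; have s2 := Tsa_rp (TZ (- 'i%C) _ Tt).
  have ft : f t = 'i%C * f (rp (- 'i%C *: t)) + f (rp t).
    by rewrite {1}(rp_dec Tt) flin //; [exact: s2.1|exact: s1.1].
  have dt : d \o t = 'i%C *: (d \o rp (- 'i%C *: t)) + (d \o rp t).
    by rewrite {1}(rp_dec Tt); apply/funext => x; rewrite /= !opE (opD bd) (opZ bd).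
  rewrite dt (flin _ _ _ (Dd.2 _ s2.1).1 (Dd.2 _ s1.1).1).
  rewrite (fmul_sa _ _ Dd sd s2) (fmul_sa _ _ Dd sd s1) ft; ring.
exists f; split=> //.
- move=> t Tt pt; have st := Tsa_pos Tt pt.
  by rewrite fsa // ler0c; apply: (value_pos cQ Tt pt); exact: vP.
- by rewrite fsa //; congr (_%:C); apply: vE; have := value_sc cQ 1; rewrite /sc scale1r.
- move=> d t Dd Tt; have Td := T_D Dd.
  have mrp d' : multiplier d' -> multiplier (rp d').
    move=> Dd'; rewrite /rp; have -> : (2^-1 : R)%:C *: (d' + adj d') =
       (2^-1 : R)%:C *: d' + ((2^-1 : R)%:C *: adj d' + 0) by rewrite addr0 scalerDr.
    have m0 : multiplier (0 : K -> K).
      have := mult_lin (-1) mult_id mult_id; by rewrite scaleN1r addNr.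
    by apply: mult_lin => //; apply: mult_lin => //; exact: mult_adj.
  have Did : multiplier (- 'i%C *: d).
    have m0 : multiplier (0 : K -> K).
      have := mult_lin (-1) mult_id mult_id; by rewrite scaleN1r addNr.
    by have := mult_lin (- 'i%C) Dd m0; rewrite addr0.
  have m1 := mrp _ Dd; have m2 := mrp _ Did.
  have s1 := Tsa_rp Td; have s2 := Tsa_rp (TZ (- 'i%C) _ Td).
  have fd : f d = 'i%C * f (rp (- 'i%C *: d)) + f (rp d).
    by rewrite {1}(rp_dec Td) flin //; [exact: s2.1|exact: s1.1].
  have dt : d \o t = 'i%C *: (rp (- 'i%C *: d) \o t) + (rp d \o t).
    by rewrite {1}(rp_dec Td).
  rewrite dt (flin _ _ _ (m2.2 _ Tt).1 (m1.2 _ Tt).1).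
  rewrite (fmul_r _ _ m2 s2.2 Tt) (fmul_r _ _ m1 s1.2 Tt) fd; ring.
- by move=> t r st hr; rewrite fsa // (vE _ _ hr).
Qed.

Lemma cone_max Q0 : cone Q0 -> exists Q, [/\ cone Q, Q0 `<=` Q &
  forall t, Tsa t -> Q t \/ Q (- t)].
Proof.
move=> cQ0; pose P := [set Q : set (K -> K) | Q = set0 \/ (cone Q /\ Q0 `<=` Q)].
have [F FP Ftot|A [PA maxA]] := @Zorn_bigcup (K -> K) P.
  have [[X [FX [cX QX]]]|none] := pselect (exists X, F X /\ (cone X /\ Q0 `<=` X)); last first.
    left; apply/seteqP; split=> // t [X FX Xt]; have [X0|h] := FP _ FX; last by case: none; exists X.
    by rewrite X0 in Xt.
  have inc Y t : F Y -> Y t -> cone Y.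
    by move=> FY Yt; have [Y0|[//]] := FP _ FY; rewrite Y0 in Yt.
  right; split; last by move=> t Qt; exists X => //; exact: QX.
  split.
  - by move=> t [Y FY Yt]; exact: (cone_sa (inc _ _ FY Yt)).
  - by move=> t Tt pt; exists X => //; exact: (cone_pos cX).
  - move=> s t [Y FY Ys] [Z FZ Zt]; have [YZ|ZY] := Ftot _ _ FY FZ.
      by exists Z => //; apply: (cone_add (inc _ _ FZ Zt)) => //; exact: YZ.
    by exists Y => //; apply: (cone_add (inc _ _ FY Ys)) => //; exact: ZY.
  - by move=> d t pd [Y FY Yt]; exists Y => //; exact: (cone_mul (inc _ _ FY Yt)).
  - by move=> [Y FY Yt]; exact: (cone_proper (inc _ _ FY Yt)).
have [cA QA] : cone A /\ Q0 `<=` A.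
  case: PA => // A0; exfalso; apply: (maxA Q0); last by right; split.
  rewrite A0; split; first by move=> t.
  move=> h; have := h (sc 1); rewrite /= => /(_ _)[]; exact: (cone_scP cQ0).
exists A; split=> // t st; apply: contrapT => /not_orP[nt nnt].
(* By maximality the module generated by A and u is no longer proper, so it contains -1. *)
have step u : Tsa u -> ~ A u -> exists q d, [/\ A q, Dpos d & sc (-1) = q + (d \o u)].
  move=> su nu; apply: contrapT => none.
  pose B := [set w | exists q d, [/\ A q, Dpos d & w = q + (d \o u)]].
  have z0 : Dpos (sc 0) by exact: Dpos_sc.
  have A0 : A 0 by have := cone_scP cA (lexx 0); rewrite /sc scale0r.
  have AB : A `<=` B.
    by move=> w Aw; exists w, (sc 0); split; [exact: Aw|exact: z0|rewrite /sc; op_ring].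
  apply: (maxA B).
    split=> //; move=> BA; apply: nu; apply: BA; exists 0, idfun; split=> //.
      by split; [exact: mult_id|move=> x; exact: dotxx_ge0].
    by rewrite add0r.
  right; split; last by move=> w /QA/AB.
  split.
  - move=> _ [q [d [Aq pd ->]]]; apply: TsaD; first exact: (cone_sa cA).
    apply: Tsa_mul => //; first exact: pd.1.
    by apply: posop_sa; [exact: pd.1.1|exact: pd.2].
  - by move=> w Tw pw; apply: AB; exact: (cone_pos cA).
  - move=> _ _ [q [d [Aq pd ->]]] [q' [d' [Aq' pd' ->]]].
    exists (q + q'), (d + d'); split; first exact: (cone_add cA).
      split; last by apply: posopD; [exact: pd.2|exact: pd'.2].
      by have := mult_lin 1 pd.1 pd'.1; rewrite scale1r.
    by rewrite addrACA.
  - move=> d' _ pd' [q [d [Aq pd ->]]]; exists (d' \o q), (d' \o d); split.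
    + exact: (cone_mul cA).
    + exact: Dpos_comp.
    + by apply/funext => x; rewrite /= !opE (opD pd'.1.1).
  - by move=> [q [d h]]; apply: none; exists q, d.
have [q [d [Aq pd e1]]] := step _ st nt.
have [q' [d' [Aq' pd' e2]]] := step _ (TsaN st) nnt.
have [bd bd'] := (pd.1.1, pd'.1.1); have [Tt _] := st; have bt := Tb Tt.
have Ad := cone_pos cA (T_D pd.1) pd.2; have Ad' := cone_pos cA (T_D pd'.1) pd'.2.
have dd' x : d' (d x) = d (d' x) by exact: (Dc x pd'.1 (T_D pd.1)).
(* From -1 = q + d t and -1 = q' - d' t the terms in t cancel in d' q + d q' + d', leaving -d. Then
   d t = d (k + t) - k d lies in A, and so does -1 = q + d t. *)
have neg : A (- d).
  have := cone_add cA (cone_add cA (cone_mul cA pd' Aq) (cone_mul cA pd Aq')) Ad'.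
  have -> : q = sc (-1) - (d \o t) by rewrite e1 addrK.
  have -> : q' = sc (-1) - (d' \o (- t)) by rewrite e2 addrK.
  suff -> : (d' \o (sc (-1) - (d \o t))) + (d \o (sc (-1) - (d' \o (- t)))) + d' = - d by [].
  apply: op_ext => x y; rewrite /sc /= !opE /= (opB bd) (opB bd') (opZ bd) (opZ bd').
  rewrite /= !opE (opN bd') (opN bd) dd' !(dotDl, dotNl, dotZl); ring.
have [k k0 [pk _]] := bound st.
have Adt : A (d \o t).
  have Tk : T (sc k + t) by apply: (subspaceD sT) => //; exact: (T_D (mult_sc k)).
  have := cone_add cA (cone_mul cA pd (cone_pos cA Tk pk)) (cone_scale cA (ltW k0) neg).
  suff -> : (d \o (sc k + t)) + k%:C *: (- d) = d \o t by [].
  apply/funext => x; rewrite /sc /= !opE /= !opE (opD bd) (opZ bd) scalerN.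
  by rewrite addrAC subrr add0r.
by apply: (cone_proper cA); rewrite e1; exact: (cone_add cA).
Qed.

(** The cone is generated by the positive elements and -(t0 + e). Keeping a margin e makes the
    resulting state strictly negative at t0, not merely nonpositive. *)
Lemma base_cone t0 : Tsa t0 -> ~ posop t0 ->
  exists (e : R) (Q : set (K -> K)), [/\ 0 < e, cone Q & Q (- (t0 + sc e))].
Proof.
move=> st0 np; have [Tt0 sa0] := st0.
have [x hx] : exists x, re (hdot K (t0 x) x) < 0.
  apply: contrapT => h; apply: np; apply/(sa_posP sa0) => x.
  by rewrite leNgt; apply/negP => hx; apply: h; exists x.
set dl := - re (hdot K (t0 x) x); have dl0 : 0 < dl by rewrite oppr_gt0.
have x1 : 0 < nr x ^+ 2 + 1 by have := sqr_ge0 (nr x); lra.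
(* Chosen so that e |x|^2 < dl: then x still witnesses that t0 + e is not positive. *)
pose e := dl / (2 * (nr x ^+ 2 + 1)).
have e0 : 0 < e by rewrite divr_gt0 // mulr_gt0.
have eE : e * (nr x ^+ 2 + 1) = dl / 2 by rewrite /e; field; rewrite gt_eqF.
set a := t0 + sc e.
have sa : Tsa a by apply: TsaD.
have [Ta adja] := sa; have ba := Tb Ta.
have npa : ~ posop a.
  move=> /(_ x)/ge0_re; rewrite /a /sc !opE dotDl dotZl dotxx !cE mul0r subr0.
  have -> : re (hdot K (t0 x) x) = - dl by rewrite opprK.
  have h1 := sqr_ge0 (nr x); nra.
exists e, [set w | exists p d, [/\ T p, posop p, Dpos d & w = p - (d \o a)]]; split=> //; last first.
  exists 0, idfun; split=> //; first exact: (subspace0 sT).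
  - by move=> y; rewrite opE dot0l.
  - by split; [exact: mult_id|move=> y; exact: dotxx_ge0].
  - by rewrite add0r.
split.
- move=> _ [p [d [Tp pp pd ->]]]; apply: TsaB; first exact: Tsa_pos.
  apply: Tsa_mul => //; first exact: pd.1.
  by apply: posop_sa; [exact: pd.1.1|exact: pd.2].
- move=> w Tw pw; exists w, (sc 0); split=> //; first exact: Dpos_sc.
  by rewrite /sc; op_ring.
- move=> _ _ [p [d [Tp pp pd ->]]] [p' [d' [Tp' pp' pd' ->]]].
  exists (p + p'), (d + d'); split.
  + exact: (subspaceD sT).
  + exact: posopD.
  + split; last by apply: posopD; [exact: pd.2|exact: pd'.2].
    by have := mult_lin 1 pd.1 pd'.1; rewrite scale1r.
  + by rewrite addrACA -opprD.
- move=> d' _ pd' [p [d [Tp pp pd ->]]]; exists (d' \o p), (d' \o d); split.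
  + exact: (pd'.1.2 _ Tp).1.
  + exact: pos_mul.
  + exact: Dpos_comp.
  + by apply/funext => y; rewrite /= !opE (opB pd'.1.1).
move=> [p [d [Tp pp pd ep]]]; clearbody a.
have [bd Dd] := pd.1; have pd2 := pd.2.
have [k k0 hk] := op_bound ba; have k1 : 0 < k^-1 by rewrite invr_gt0.
have da y : d (a y) = y + p y.
  have := congr1 (fun f => f y) ep; rewrite /sc !opE /= rmorphN rmorph1 scaleN1r => h.
  by apply/eqP; rewrite -subr_eq0 -[X in _ - (X + _)]opprK h opprB subrK subrr.
(* If -1 = p - d a, then d a = 1 + p, but d need not be invertible. With b = d + 1/k one has b a = p
   + (k + a)/k >= 0, and b is invertible, so a = (b a) b^(-1) would be positive. *)
pose b := d + sc k^-1.
have bb : bounded_op K K b by apply: bopD => //; apply: bopZ; exact: bop_id.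
have pb : posop b by apply: posopD => //; apply: posop_sc; exact: ltW.
have lb y : k^-1 * nr y ^+ 2 <= re (hdot K (b y) y).
  rewrite /b /sc !opE dotDl dotZl dotxx !cE mul0r subr0 lerDr.
  exact/ge0_re/pd2.
have [g [bg pg _ [gb bg'] _]] := invertible_bounded_below bb pb k1 lb.
have cab y : a (b y) = b (a y).
  by rewrite /b /sc !opE (opD ba) (opZ ba) -(Dc _ pd.1 Ta).
have pba : posop (b \o a).
  move=> y; have -> : hdot K ((b \o a) y) y = hdot K (p y) y + (k^-1)%:C * (k%:C * hdot K y y + hdot K (a y) y).
    rewrite /b /sc /= !opE da !dotDl dotZl mulrDr mulrA -rmorphM mulVf ?gt_eqF // mul1r.
    rewrite /=; ring.
  rewrite addr_ge0 // mulr_ge0 ?ler0c ?(ltW k1) //.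
  apply/ge0cP; rewrite dotxx !cE (sa_real adja) !(mul0r, mulr0, addr0, subr0); split=> //.
  have h := cauchy_schwarz (a y) y; have h' := ler_wpM2r (nr_ge0 y) (hk y).
  have := re_geN_cn (hdot K (a y) y); rewrite expr2 mulrA; lra.
apply: npa; have -> : a = (b \o a) \o g by apply/funext => y /=; rewrite -cab bg'.
apply: posop_mul => //; first exact: bop_comp.
move=> y /=; have ga z : g (a z) = a (g z) by rewrite -[in LHS](bg' z) cab gb.
by rewrite gb -ga bg'.
Qed.

(** For t0 = u + i w with u, w selfadjoint, one of u, w, -w fails to be positive, since otherwise w
    = 0 and t0 = u >= 0. A state negative there makes the real part of f(t0) negative or its
    imaginary part nonzero. *)
Lemma multiplicative_state t0 : T t0 -> ~ posop t0 ->
  exists f : (K -> K) -> R[i],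
    [/\ forall a s t, T s -> T t -> f (a *: s + t) = a * f s + f t,
        forall t, T t -> posop t -> 0 <= f t, f idfun = 1,
        forall d t, multiplier d -> T t -> f (d \o t) = f d * f t &
        ~ (0 <= f t0)].
Proof.
have sa_case t : Tsa t -> ~ posop t -> exists f : (K -> K) -> R[i],
    [/\ forall a s t, T s -> T t -> f (a *: s + t) = a * f s + f t,
        forall t, T t -> posop t -> 0 <= f t, f idfun = 1,
        forall d t, multiplier d -> T t -> f (d \o t) = f d * f t &
        (forall s, Tsa s -> im (f s) = 0) /\ re (f t) < 0].
  move=> st np; have [e [Q0 [e0 cQ0 Q0t]]] := base_cone st np.
  have [Q [cQ Q0Q tot]] := cone_max cQ0.
  have [f [f1 f2 f3 f4 f5]] := cone_state cQ tot; exists f; split=> //.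
  have fr s : Tsa s -> im (f s) = 0.
    by move=> ss; have [v hv] := value_ex cQ tot ss; rewrite (f5 _ _ ss hv).
  split=> //; have [v hv] := value_ex cQ tot st; rewrite (f5 _ _ st hv) reC.
  have hv' : value Q (- (t + sc e)) (- (v + e)).
    by apply: valueN; apply: (valueD cQ) => //; exact: value_sc.
  have := value_le cQ (value_sc cQ 0) hv'.
  have -> : - (t + sc e) - sc 0 = - (t + sc e) by rewrite /sc; op_ring.
  by move=> /(_ (Q0Q _ Q0t)); lra.
move=> Tt0 np; have s1 := Tsa_rp Tt0.
have s2 := Tsa_rp (subspaceZ sT (- 'i%C) Tt0).
have dec := rp_dec Tt0; set u := rp t0 in s1 dec; set w := rp (- 'i%C *: t0) in s2 dec.
have fdec (f : (K -> K) -> R[i]) :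
    (forall a s t, T s -> T t -> f (a *: s + t) = a * f s + f t) ->
    (forall s, Tsa s -> im (f s) = 0) -> re (f t0) = re (f u) /\ im (f t0) = re (f w).
  move=> f1 fr; rewrite dec f1; [|exact: s2.1|exact: s1.1].
  by rewrite !cE (fr _ s1) (fr _ s2); split; ring.
have [pu|npu] := pselect (posop u); last first.
  have [f [f1 f2 f3 f4 [f5 f6]]] := sa_case u s1 npu; exists f; split=> // /ge0_re.
  by rewrite (fdec f f1 f5).1 leNgt f6.
have [pw|npw] := pselect (posop w); last first.
  have [f [f1 f2 f3 f4 [f5 f6]]] := sa_case w s2 npw; exists f; split=> // /ge0_im.
  by rewrite (fdec f f1 f5).2 => h; rewrite h ltxx in f6.
have [pw'|npw'] := pselect (posop (- w)); last first.
  have [f [f1 f2 f3 f4 [f5 f6]]] := sa_case (- w) (TsaN s2) npw'; exists f; split=> // /ge0_im.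
  rewrite (fdec f f1 f5).2 => h; move: f6.
  have -> : - w = -1 *: w + 0 by rewrite addr0 scaleN1r.
  rewrite f1; [|exact: s2.1|exact: (subspace0 sT)].
  have -> : f 0 = 0.
    have := f1 1 0 0 (subspace0 sT) (subspace0 sT); rewrite scale1r addr0 mul1r => /eqP.
    by rewrite -subr_eq0 opprD addrA subrr add0r oppr_eq0 => /eqP.
  by rewrite addr0 mulN1r reN h oppr0 ltxx.
case: np => x; rewrite dec !opE dotDl dotZl; have := pw x; have := pw' x.
rewrite opE dotNl oppr_ge0 => h1 h2; have -> : hdot K (w x) x = 0.
  by apply/eqP; rewrite eq_le h1 h2.
by rewrite mulr0 add0r; exact: pu.
Qed.
End MultiplicativeStates.

(* Matrix positivity in T is tested by scalar compressions, as in a function system. *)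
Definition minimal_order (R : realType) (K : hilbert R) (T : set (K -> K)) :=
  forall n (t : 'I_n -> 'I_n -> K -> K), (forall i j, T (t i j)) ->
  (forall c : 'I_n -> R[i], posop (\sum_i \sum_j (c j * Num.conj (c i)) *: t i j)) -> mpos t.

(** * Multipliers commute with a system of minimal order *)

Section CommutingMultipliers.
Variables (R : realType) (K : hilbert R) (T : set (opspace K)).
Hypotheses (oT : operator_system T) (Tcl : @opclosed R K K T).
Hypothesis minT : minimal_order T.

Let Tb : forall t, T t -> bounded_op K K t. Proof. by case: oT. Qed.
Let sT : @Defs.subspace _ (K -> K) T. Proof. by case: oT. Qed.
Let T1 : T idfun. Proof. by case: oT. Qed.

Lemma zero_form (A : K -> K) : bounded_op K K A ->
  (forall x, hdot K (A x) x = 0) -> A = 0.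
Proof.
move=> bA h; apply/funext => x; apply/nr_eq0/eqP; rewrite eq_le nr_ge0 andbT.
have pA : posop A by move=> y; rewrite h.
have := @posop_norm R K A 0 bA pA (lexx 0) (fun y => _) x; rewrite mul0r; apply=> y.
by rewrite h mul0r.
Qed.

Let E (d t : K -> K) : K -> K :=
  (d \o t \o adj d) - (d \o adj d \o t) - (t \o d \o adj d) + (adj d \o t \o d).

Let E_bop d t : bounded_op K K d -> bounded_op K K t -> bounded_op K K (E d t).
Proof.
move=> bd bt; have bd' := adj_bop bd.
have c3 (x y z : K -> K) : bounded_op K K x -> bounded_op K K y -> bounded_op K K z ->
    bounded_op K K (x \o y \o z).
  by move=> bx b_y bz; apply: (@bop_comp _ _ _ _ (x \o y) z) => //; exact: bop_comp.
by apply: bopD; [apply: bopB; [apply: bopB|]|]; exact: c3.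
Qed.

(* By minimality the transpose of a positive matrix over T is positive; here the matrix
   is [adj a_i t a_j] for a = (1, d). *)
Let E_pos d t : multiplier T d -> T t -> posop t -> posop (E d t).
Proof.
move=> [bd hd] Tt pt y; have bt := Tb Tt; have bd' := adj_bop bd.
have [_ hd'] := mult_adj oT (conj bd hd).
pose a (i : 'I_2) : K -> K := if i == ord0 then idfun else d.
have ba i : bounded_op K K (a i) by rewrite /a; case: eqP => _ //; exact: bop_id.
have aid : adj (idfun : K -> K) = idfun by apply: adjE; [exact: bop_id|move=> ? ?].
pose t' i j : K -> K := adj (a j) \o t \o a i.
have Tt' i j : T (t' i j).
  rewrite /t' /a; case: eqP => _; case: eqP => _; rewrite ?aid //.
  - exact: (hd _ Tt).2.
  - exact: (hd' _ Tt).1.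
  - exact: (hd _ (hd' _ Tt).1).2.
have pt' : mpos t'.
  apply: minT => // c x; rewrite !opE dot_suml.
  pose b := \sum_i Num.conj (c i) *: a i x.
  suff -> : \sum_i hdot K ((\sum_j (c j * Num.conj (c i)) *: t' i j) x) x = hdot K (t b) b.
    exact: pt.
  rewrite {1}/b (op_sum bt) dot_suml; apply: eq_bigr => i _.
  rewrite !opE dot_suml /b dot_sumr; apply: eq_bigr => j _.
  rewrite !opE (opZ bt) !dotZl dotZr conjCK mulrA [c j * _]mulrC -!mulrA; congr (_ * (_ * _)).
  by rewrite /t' /= dot_adjl.
(* Testing the transposed matrix at (-d^* y, y) produces exactly the four terms of [E d t]. *)
have := pt' (fun i => if i == ord0 then - adj d y else y).
rewrite !big_ord_recl !big_ord0 /= !addr0 /t' /a /= aid /=.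
rewrite !(opN bt) !(opN bd) !(opN bt).
suff -> : hdot K (E d t y) y =
  hdot K (t (adj d y)) (adj d y) - hdot K (adj d (t y)) (adj d y)
  + (- hdot K (t (d (adj d y))) y + hdot K (adj d (t (d y))) y).
  by rewrite !(dotNl, dotNr) !opprK.
rewrite /E !opE /= !(dotDl, dotNl) (dot_adjr bd) (dot_adjr bd); ring.
Qed.

Let E_lin d a s t : bounded_op K K d -> E d (a *: s + t) = a *: E d s + E d t.
Proof.
move=> bd; have bd' := adj_bop bd; apply/funext => x.
rewrite /E !opE /= !opE !(opD bd, opZ bd, opD bd', opZ bd').
apply: dot_inj => z; rewrite !(dotDl, dotNl, dotZl); ring.
Qed.

Let E_id d : E d idfun = (adj d \o d) - (d \o adj d).
Proof. by rewrite /E; op_ring. Qed.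

(** At t = 1 the form is d^* d - d d^*; applying positivity to d and to its adjoint shows that it
    vanishes. Then E is nonnegative at k + t and k - t for selfadjoint t, which forces E(t) = 0. *)
Let E_zero d t : multiplier T d -> T t -> E d t = 0.
Proof.
move=> md; have [bd _] := md; have bd' := adj_bop bd.
have md' := mult_adj oT md.
have E1 : E d idfun = 0.
  apply: zero_form; first by apply: E_bop => //; exact: bop_id.
  move=> x; have := E_pos md T1 (fun x => dotxx_ge0 x) x.
  have := E_pos md' T1 (fun x => dotxx_ge0 x) x.
  rewrite !E_id (adjK bd) !opE /= !(dotDl, dotNl) => h1 h2.
  by apply/eqP; rewrite eq_le h2 andbT -oppr_ge0 opprB.
have sa_case s : T s -> is_adjoint s s -> E d s = 0.
  move=> Ts hs; have [k k0 [pk1 pk2]] := sa_bounded (Tb Ts) hs.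
  apply: zero_form; first by apply: E_bop => //; exact: Tb.
  move=> x.
  have := E_pos md (sT.2 k%:C _ _ T1 Ts) pk1 x.
  have := E_pos md (sT.2 k%:C _ _ T1 (subspaceN sT Ts)) pk2 x.
  rewrite -[- s]scaleN1r -[_ *: s]addr0 !(E_lin _ _ _ bd) E1.
  have -> : E d 0 = 0 by apply/funext => y; rewrite /E !opE /= ?opE !(op0 bd, op0 bd') ?opE !subr0 addr0.
  rewrite !opE !scaler0 add0r addr0 scaleN1r add0r dotNl oppr_ge0 => h1 h2.
  by apply/eqP; rewrite eq_le h1 h2.
move=> Tt; have [a [b [Ta ha Tb' hb ->]]] := sa_decompose oT Tt.
by rewrite (E_lin _ _ _ bd) !sa_case // scaler0 addr0.
Qed.

Let mult_closed : @opclosed R K K (multiplier T).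
Proof.
move=> d cd; split; first exact: (opclosure_bop cd).
move=> t Tt; split; apply: Tcl.
  apply: (opclosure_compr (Tb Tt) _ cd) => a [ba ha].
  by apply: sub_opclosure => //; exact: (ha _ Tt).1.
apply: (opclosure_compl (Tb Tt) _ cd) => a [ba ha].
by apply: sub_opclosure => //; exact: (ha _ Tt).2.
Qed.

(* For a unitary multiplier u, conjugation satisfies [alpha + alpha^-1 = 2], so the
   bounded sequence [alpha^n t] is [t + n (alpha t - t)]. *)
Let unitary_commutes (u v t : K -> K) : multiplier T u -> is_adjoint u v ->
  (forall x, u (v x) = x) -> (forall x, v (u x) = x) -> T t -> u \o t = t \o u.
Proof.
move=> mu auv uv vu Tt; have [bu hu] := mu; have vE := adjE bu auv.
have bv : bounded_op K K v by exact: (adjoint_bop bu auv).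
have [_ hv] : multiplier T v by rewrite -vE; exact: mult_adj.
pose al (x : K -> K) : K -> K := u \o x \o v.
have alT s : T s -> T (al s) by move=> Ts; exact: (hv _ (hu _ Ts).1).2.
have rel s : T s -> forall x, al s x + v (s (u x)) = s x + s x.
  move=> Ts x; have := congr1 (fun f => f x) (E_zero mu Ts).
  rewrite /E vE !opE /= !uv => h; apply/eqP; rewrite -subr_eq0; apply/eqP.
  by rewrite -[RHS]h opprD addrA addrAC [_ + v _ - _]addrAC.
pose dl := al t - t.
have Tdl : T dl by apply: (subspaceB sT) => //; exact: alT.
have aldl : al dl = dl.
  apply/funext => x; have := rel _ (alT _ Tt) x; rewrite /al /= vu vu => h.
  rewrite /dl /al !opE /= (opB bu); apply/eqP.
  by rewrite subr_eq addrAC -h addrK.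
have iterE n : iter n al t = t + n%:R *: dl.
  elim: n => [|n IH]; first by rewrite scale0r addr0.
  rewrite iterS IH; apply/funext => x; rewrite /al /= !opE (opD bu) (opZ bu).
  have := congr1 (fun f => f x) aldl; rewrite /al /= => ->.
  rewrite -natr1 scalerDl scale1r [RHS]addrA [RHS]addrAC; congr (_ + _).
  by rewrite /dl !opE addrC subrK.
have iso (w w' : K -> K) : is_adjoint w w' -> (forall x, w' (w x) = x) -> forall x, nr (w x) = nr x.
  move=> ww w'w x; apply/eqP; rewrite -(@eqrXn2 _ 2) ?nr_ge0 //; apply/eqP/realC_inj.
  by rewrite -!dotxx ww w'w.
have iso_u := iso _ _ auv vu; have iso_v := iso _ _ (adjoint_sym auv) uv.
have [k k0 hk] := op_bound (Tb Tt).
have bound n x : nr (iter n al t x) <= k * nr x.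
  by elim: n x => [//|n IH] x; rewrite iterS {1}/al /= iso_u -[nr x]iso_v.
have dl0 : dl = 0.
  apply: odist_eq => e e0 x; rewrite subr0.
  have ek : 0 < e / (2 * k) by rewrite divr_gt0 // mulr_gt0.
  have [n hn] := small_invS ek.
  have {}hn := hn _ (leqnn n).
  have n0 : 0 < n.+1%:R :> R by rewrite ltr0n.
  have h1 : n.+1%:R * nr (dl x) <= nr (iter n.+1 al t x) + nr (t x).
    have -> : n.+1%:R * nr (dl x) = nr (iter n.+1 al t x + - t x).
      rewrite iterE !opE addrAC subrr add0r nrZ.
      have -> : (n.+1%:R : R[i]) = (n.+1%:R)%:C by rewrite rmorph_nat.
      by rewrite cn_real ger0_norm // ltW.
    by apply: (le_trans (nrD _ _)); rewrite nrN.
  have := bound n.+1 x; have := hk x => h2 h3.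
  have {hn} hn : 2 * k <= n.+1%:R * e.
    by move: hn; rewrite -div1r ler_pdivrMr // mulrAC ler_pdivlMr ?mulr_gt0 // mul1r [e * _]mulrC.
  have := ler_wpM2r (nr_ge0 x) hn; rewrite -mulrA => h4.
  by rewrite -(ler_pM2l n0); lra.
apply/funext => x; have := congr1 (fun f => f (u x)) dl0.
by rewrite /dl /al !opE /= vu => /eqP; rewrite subr_eq0 => /eqP.
Qed.

(* The Cayley transform 2 (1 - c)^-1 - 1 of a skew-adjoint c is unitary. *)
Let skew_commutes (c t : K -> K) : multiplier T c -> is_adjoint c (- c) ->
  (forall x, nr (c x) <= 2^-1 * nr x) -> T t -> c \o t = t \o c.
Proof.
move=> mc ac hc Tt; have [bc _] := mc; have bt := Tb Tt.
have m0 : multiplier T (0 : K -> K).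
  by have := mult_lin oT (-1) (mult_id T) (mult_id T); rewrite scaleN1r addNr.
have mN a : multiplier T a -> multiplier T (- a).
  by move=> ma; have := mult_lin oT (-1) ma m0; rewrite scaleN1r addr0.
have mD a a' : multiplier T a -> multiplier T a' -> multiplier T (a + a').
  by move=> ma ma'; have := mult_lin oT 1 ma ma'; rewrite scale1r.
have h0 : (0 : R) <= 2^-1 by lra.
have h1 : (2^-1 : R) < 1 by lra.
have [g [bg mg g1 g2]] := neumann bc h0 h1 hc m0
  (fun a ma => mD _ _ (mult_id T) (mult_comp mc ma)) mult_closed.
have hNc x : nr ((- c) x) <= 2^-1 * nr x by rewrite opE nrN.
have mNc := mN _ mc; have [bNc _] := mNc.
have [g' [bg' _ g'1 g'2]] := neumann bNc h0 h1 hNc m0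
  (fun a ma => mD _ _ (mult_id T) (mult_comp mNc ma)) mult_closed.
have agg : is_adjoint g g'.
  move=> x y; rewrite -[in LHS](g'1 y) -[in RHS](g1 x).
  by rewrite opE opprK dotDr dotBl [hdot K (c _) _]ac opE dotNr opprK.
pose u := g + g - idfun; pose v := g' + g' - idfun.
have mu : multiplier T u by exact: (mD _ _ (mD _ _ mg mg) (mN _ (mult_id T))).
have auv : is_adjoint u v.
  by apply: is_adjointB => //; exact: is_adjointD.
have uE x : u (x - c x) = x + c x by rewrite /u !opE g2 opprB addrA addrAC addrK.
have vE x : v (x + c x) = x - c x.
  have gx : g' (x + c x) = x by rewrite -[in RHS](g'2 x) opE opprK.
  by rewrite /v !opE gx opprD addrA addrK.
have surj1 x : exists y, x = y - c y by exists (g x); rewrite g1.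
have surj2 x : exists y, x = y + c y by exists (g' x); rewrite -[LHS]g'1 opE opprK.
have uv x : u (v x) = x by have [y ->] := surj2 x; rewrite vE uE.
have vu x : v (u x) = x by have [y ->] := surj1 x; rewrite uE vE.
have gt z : g (t z) = t (g z).
  have := congr1 (fun f => f z) (unitary_commutes mu auv uv vu Tt).
  rewrite /u /= !opE (opB bt) (opD bt) => /addIr h.
  have two : (2%:R : R[i]) != 0 by rewrite pnatr_eq0.
  by apply: (scalerI two); rewrite !scaler_nat !mulr2n.
apply/funext => x /=; have [y ->] : exists y, x = g y by exists (x - c x); rewrite g2.
have := g1 (t y); rewrite gt -[in RHS](g1 y) (opB bt) => /addrI/oppr_inj.
by [].
Qed.

Lemma multiplier_commutes (d t : K -> K) : multiplier T d -> T t -> d \o t = t \o d.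
Proof.
move=> md Tt; have [bd _] := md; have bt := Tb Tt; have md' := mult_adj oT md.
have m0 : multiplier T (0 : K -> K).
  by have := mult_lin oT (-1) (mult_id T) (mult_id T); rewrite scaleN1r addNr.
have mZ a c : multiplier T c -> multiplier T (a *: c).
  by move=> mc; have := mult_lin oT a mc m0; rewrite addr0.
have skew c x : multiplier T c -> is_adjoint c (- c) -> c (t x) = t (c x).
  move=> mc ac; have [bc _] := mc; have [k k0 hk] := op_bound bc.
  pose r : R := (2 * k)^-1; have r0 : 0 < r by rewrite invr_gt0 mulr_gt0.
  have := congr1 (fun f => f x) (@skew_commutes (r%:C *: c) t (mZ _ _ mc) _ _ Tt).
  rewrite /= !opE (opZ bt) => h.
  have rn0 : (r%:C : R[i]) != 0 by rewrite fmorph_eq0 gt_eqF.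
  apply: (scalerI rn0); apply: h.
    have := is_adjointZ r%:C ac; rewrite conjC_real.
    by have -> : r%:C *: (- c) = - (r%:C *: c) by rewrite scalerN.
  move=> y; rewrite opE nrZ cn_real gtr0_norm //; have := hk y.
  by move=> /(ler_wpM2l (ltW r0)); rewrite /r invfM mulrA -[_ * k^-1 * k]mulrA mulVf ?gt_eqF // mulr1.
have h := adjP bd; have h' := adjoint_sym h.
have s1 x : (d - adj d) (t x) = t ((d - adj d) x).
  apply: skew; last by rewrite opprB; exact: is_adjointB.
  by have := mult_lin oT (-1) md' md; rewrite scaleN1r addrC.
have s2 x : ('i%C *: (d + adj d)) (t x) = t (('i%C *: (d + adj d)) x).
  apply: skew.
    by apply: mZ; have := mult_lin oT 1 md md'; rewrite scale1r.
  have := is_adjointZ 'i%C (is_adjointD h h').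
  by have -> : Num.conj ('i%C : R[i]) *: (adj d + d) = - ('i%C *: (d + adj d)) by
     rewrite [adj d + d]addrC -scaleNr; congr (_ *: _); apply: ceqP; rewrite !cE ?oppr0.
apply/funext => x /=; move: (s1 x) (s2 x); rewrite !opE (opZ bt) (opB bt) (opD bt).
have in0 : ('i%C : R[i]) != 0 by rewrite eq_complex /= oner_eq0 andbF.
move=> e1 /(scalerI in0) e2.
have two : (2%:R : R[i]) != 0 by rewrite pnatr_eq0.
apply: (scalerI two); rewrite !scaler_nat !mulr2n.
have dbl (a b : K) : a + a = (a - b) + (a + b) by rewrite addrACA addNr addr0.
by rewrite (dbl _ (adj d (t x))) (dbl (t (d x)) (t (adj d x))) e1 e2.
Qed.

End CommutingMultipliers.

(** * Function systems *)

Section MinimalSystems.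
Variables (R : realType) (K : hilbert R).

Lemma min_hermitian n (t : 'I_n -> 'I_n -> K -> K) :
  (forall i j, bounded_op K K (t i j)) ->
  (forall c : 'I_n -> R[i], posop (\sum_i \sum_j (c j * Num.conj (c i)) *: t i j)) ->
  forall i j, is_adjoint (t i j) (t j i).
Proof.
move=> bt pt i0 j0; suff -> : t j0 i0 = adj (t i0 j0) by exact: adjP.
apply/eqP; rewrite -subr_eq0; apply/eqP/zero_form.
  by apply: bopB; [exact: bt|exact/adj_bop/bt].
move=> x; rewrite !opE dotBl.
(* For fixed x the scalar matrix <t_ij x, x> is positive; it is viewed as an operator
   matrix by means of the rank one operator of x. *)
pose P v : K := hdot K v x *: x.
have bP : bounded_op K K P.
  apply/bopP; split; first by move=> a u v; rewrite /P dotDl dotZl scalerDl scalerA.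
  exists (nr x * nr x); first by rewrite mulr_ge0 ?nr_ge0.
  move=> v; rewrite /P nrZ mulrAC ler_wpM2r ?nr_ge0 // mulrC.
  exact: cauchy_schwarz.
pose A i j : K -> K := hdot K (t i j x) x *: P.
have pA : mpos A.
  move=> xi; have := pt (fun j => hdot K (xi j) x) x.
  rewrite !opE dot_suml; congr (0 <= _); apply: eq_bigr => i _.
  rewrite opE dot_suml; apply: eq_bigr => j _.
  by rewrite !opE /A /P !dotZl -dotC; ring.
have := mpos_hermitian (fun i j => bopZ _ bP) pA i0 j0 x x.
rewrite /A /P !opE !(dotZl, dotZr).
have [->|x0] := eqVneq x 0; first by rewrite dot0l => _; rewrite !dot0r subrr.
have n0 : (nr x ^+ 2)%:C != 0 :> R[i].
  by rewrite fmorph_eq0 expf_eq0 /=; apply: contra_neq x0; exact: nr_eq0.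
rewrite dotxx conjC_real !mulrA => /(mulIf n0)/(mulIf n0) h.
rewrite (dot_adjl (bt i0 j0)) (dotC x (t i0 j0 x)).
by apply/eqP; rewrite subr_eq0; apply/eqP; rewrite h conjCK.
Qed.

Section Perturbation.
Variables (n : nat) (t a : 'I_n -> 'I_n -> K -> K) (e : R).
Hypothesis bt : forall i j, bounded_op K K (t i j).
Hypothesis pt : forall c : 'I_n -> R[i],
  posop (\sum_i \sum_j (c j * Num.conj (c i)) *: t i j).
Hypothesis ha : forall i j, is_adjoint (a i j) (a j i).
Hypotheses (ba : forall i j, bounded_op K K (a i j)) (e0 : 0 <= e).
Hypothesis ta : forall i j, odist (t i j) (a i j) e.

Let form (b : 'I_n -> 'I_n -> K -> K) (c : 'I_n -> R[i]) x :
  (forall i j, bounded_op K K (b i j)) ->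
  hdot K ((\sum_i \sum_j (c j * Num.conj (c i)) *: b i j) x) x =
  \sum_i \sum_j hdot K (b i j (c j *: x)) (c i *: x).
Proof.
move=> bb; rewrite !opE dot_suml; apply: eq_bigr => i _.
rewrite opE dot_suml; apply: eq_bigr => j _.
by rewrite !opE dotZl dotZr (opZ (bb i j)) dotZl mulrA [c j * _]mulrC.
Qed.

Lemma min_perturb (c : 'I_n -> R[i]) : posop (\sum_i \sum_j (c j * Num.conj (c i)) *:
  (a i j + (if i == j then e * n%:R else 0)%:C *: idfun)).
Proof.
move=> x; rewrite form; last first.
  by move=> i j; apply: bopD => //; apply: bopZ; exact: bop_id.
have := pt c x; rewrite (form c x bt) => h.
have := @form_perturb _ _ _ t a e (fun j => c j *: x) (min_hermitian bt pt) ha e0 ta h.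
by rewrite card_ord.
Qed.
End Perturbation.
End MinimalSystems.

(** * Function systems have minimal order *)

Section ComplexTopology.
Variable R : realType.

Lemma cn_continuous : continuous (@cn R : R[i]^o -> R).
Proof.
move=> z; apply/(@cvgrPdist_le _ _ _ (nbhs (z : R[i]^o)) (nbhs_filter _)) => e e0.
have : nbhs (z : R[i]^o) (ball (z : R[i]^o) e%:C) by apply: nbhsx_ballx; rewrite ltcR.
apply: filterS => w; rewrite -ball_normE /= cnE ltcR => /ltW h; apply: le_trans h.
have tri (a b : R[i]) : cn a - cn b <= cn (a - b).
  by rewrite lerBlDr; have := cnD (a - b) b; rewrite subrK.
have := tri z w; have := tri w z.
have -> : cn (w - z) = cn (z - w) by rewrite -cnN opprB.
by rewrite ler_norml; lra.
Qed.
End ComplexTopology.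

Section FunctionSystems.
Variables (R : realType) (X : topologicalType) (F : set (funspace R X)).
Hypothesis fF : function_system F.

Let oF : operator_system F. Proof. by case: fF. Qed.

Lemma funspace_order_bounded : order_bounded F.
Proof.
move=> f Ff; have [cX _ [Fc sF F1 Fadj] _] := fF.
exists (fun x => Num.conj (f x : R[i]) : R[i]^o).
have cf : continuous f := Fc _ Ff.
have cg : continuous (fun x => cn (f x : R[i])).
  by move=> x; apply: continuous_comp; [exact: cf|exact: cn_continuous].
have : compact ((fun x => cn (f x : R[i])) @` setT).
  by apply: continuous_compact => //; exact: continuous_subspaceT.
move=> /compact_bounded[M [_ hM]].
pose k := `|M| + 1; have hk x : cn (f x : R[i]) <= k.
  have Mk : M < k by have := ler_norm M; rewrite /k; lra.
  have := hM _ Mk (cn (f x : R[i])); rewrite /= => /(_ (ex_intro2 _ _ x I erefl)).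
  by apply: le_trans; exact: ler_norm.
have k0 : 0 <= k by rewrite /k; have := normr_ge0 M; lra.
exists k; split=> //; first exact: Fadj Ff _.
move=> x z; rewrite !big_ord_recl !big_ord0 !mxE /= !addr0.
set a := z ord0; set b := z _; move: (f x : R[i]) (hk x) => w hw.
have -> : (k%:C *: (fun=> 1) : X -> R[i]^o) x = k%:C by exact: mulr1.
have ab : cn (w * b * Num.conj a) <= k * (cn a * cn b).
  rewrite !cnM cnJ -mulrA [cn b * _]mulrC ler_wpM2r //.
  by rewrite mulr_ge0 ?cn_ge0.
have -> : k%:C * a * Num.conj a + w * b * Num.conj a + (Num.conj w * a * Num.conj b + k%:C * b * Num.conj b)
  = (k * cn a ^+ 2 + k * cn b ^+ 2 + re (w * b * Num.conj a) *+ 2)%:C.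
  rewrite -!mulrA !mulJ; apply: ceqP; rewrite !cE; ring.
rewrite ler0c; have := re_geN_cn (w * b * Num.conj a).
by have := sqr_ge0 (cn a - cn b); nra.
Qed.

Variables (K : hilbert R) (psi : funspace R X -> opspace K).
Hypothesis upsi : ucoe F psi.
Let P : set (opspace K) := psi @` F.

Lemma function_system_image : operator_system P.
Proof. exact: ucoe_image_opsys oF funspace_order_bounded upsi. Qed.

(** A matrix over F is positive iff at each point its scalar compressions are nonnegative, and these
    compressions belong to F. To reach the closure, t is replaced by a shifted hermitian
    approximation over P. *)
Lemma function_system_min : minimal_order (opclosure P).
Proof.
move=> n t Tt pt; have oP := function_system_image; have [Pb sP P1 _] := oP.
have [_ sF F1 _] := oF.
have bt i j : bounded_op K K (t i j) by exact: (opclosure_bop (Tt i j)).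
have ht := min_hermitian bt pt.
apply: mpos_limit => e e0; have n0 : 0 < 1 + n%:R :> R by rewrite ltr_pwDl.
(* One d pays for the approximation, n of them for the diagonal shift. *)
pose d := e / (1 + n%:R); have d0 : 0 < d by rewrite divr_gt0.
have [a [Pa ha ta]] := opsys_hermitian_approx oP Tt ht d0.
pose h i j : K -> K := a i j + (if i == j then d * n%:R else 0)%:C *: idfun.
exists h; last first.
  move=> i j x; apply: (le_trans (nr_tri (a i j x) _ _)).
  have -> : nr (a i j x - h i j x) = `|if i == j then d * n%:R else 0| * nr x.
    by rewrite /h !opE opprD addrA subrr add0r nrN nrZ cn_real.
  have -> : e * nr x = d * nr x + d * n%:R * nr x by rewrite /d; field; rewrite gt_eqF.
  apply: lerD; first exact: ta.
  rewrite ler_wpM2r ?nr_ge0 //; have dn : 0 <= d * n%:R by rewrite mulr_ge0 ?(ltW d0).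
  by case: eqP => _; rewrite ger0_norm.
have Ph i j : P (h i j) by apply: (subspaceD sP) => //; exact: (subspaceZ sP).
pose f i j : funspace R X := xget 0 [set f | F f /\ psi f = h i j].
have fP i j : F (f i j) /\ psi (f i j) = h i j.
  by have [g Fg gh] := Ph i j; exact: (@xgetI _ 0 [set f | F f /\ psi f = h i j] g).
have [_ _ _ pos] := upsi.
have -> : h = fun i j => (map_mx psi (\matrix_(i, j) f i j)) i j.
  by apply/funext => i; apply/funext => j; rewrite !mxE (fP i j).2.
apply/(pos n (\matrix_(i, j) f i j)); first by move=> i j; rewrite mxE; exact: (fP i j).1.
move=> x z; pose p : funspace R X := \sum_i \sum_j (z j * Num.conj (z i)) *: f i j.
have lin (I : Type) (s : seq I) (g : I -> funspace R X) : (forall i, F (g i)) ->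
    F (\sum_(i <- s) g i) /\ psi (\sum_(i <- s) g i) = \sum_(i <- s) psi (g i).
  move=> Fg; elim: s => [|i s [IH1 IH2]].
    by rewrite !big_nil; split; [exact: sF.1|exact: (ucoe0 sF upsi)].
  rewrite !big_cons; split; last by rewrite (ucoeD upsi) ?IH2.
  by have := sF.2 1 _ _ (Fg i) IH1; rewrite scale1r.
have sc i j : F ((z j * Num.conj (z i)) *: f i j) by apply: sub_scale => //; exact: (fP i j).1.
have Fp : F p by apply: (lin _ _ _ _).1 => i; exact: (lin _ _ _ _).1.
have psip : psi p = \sum_i \sum_j (z j * Num.conj (z i)) *: h i j.
  rewrite (lin _ _ _ _).2; last by move=> i; exact: (lin _ _ _ _).1.
  apply: eq_bigr => i _; rewrite (lin _ _ _ _).2 //; apply: eq_bigr => j _.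
  by rewrite (ucoeZ sF upsi) ?(fP i j).2 //; exact: (fP i j).1.
have := min_perturb bt pt ha (fun i j => Pb _ (Pa i j)) (ltW d0) ta z.
rewrite -psip => ppos.
have : mo_pos (\matrix_(i < 1, j < 1) p : 'M[funspace R X]_1).
  apply/(pos 1%N); first by move=> ? ?; rewrite mxE.
  by move=> xi; rewrite !big_ord1 !mxE; exact: ppos.
move=> /(_ x (fun=> 1)); rewrite !big_ord1 mxE conjC1 !mulr1.
congr (0 <= _); rewrite /p fct_sumE; apply: eq_bigr => i _.
rewrite fct_sumE; apply: eq_bigr => j _; by rewrite mxE -mulrA [RHS]mulrC.
Qed.
End FunctionSystems.

(** * The faithful kernel given by multiplicative states *)

Section StateKernel.
Variables (R : realType) (K : hilbert R) (T : set (opspace K)).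
Hypotheses (oT : operator_system T) (Tcl : @opclosed R K K T).
Hypothesis minT : minimal_order T.

Let Tb : forall t, T t -> bounded_op K K t. Proof. by case: oT. Qed.
Let sT : @Defs.subspace _ (K -> K) T. Proof. by case: oT. Qed.

Definition mult_state (f : (K -> K) -> R[i]) := [/\
  forall a s t, T s -> T t -> f (a *: s + t) = a * f s + f t,
  forall t, T t -> posop t -> 0 <= f t, f idfun = 1 &
  forall d t, multiplier T d -> T t -> f (d \o t) = f d * f t].

(** A direct sum of one-dimensional spaces, one per state, on which t acts by f(t). The scalar
    attached to a point lets an element y act as a map from points to points, (f, c) |-> (f, f(y)
    c), as the criterion requires. *)
Definition state_kernel (t : K -> K) (p q : {f | mult_state f} * R[i]) : R[i] :=
  if `[< p.1 = q.1 >] then sval p.1 t * p.2 * Num.conj q.2 else 0.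

Lemma state_kernel_linear : kernel_linear T state_kernel.
Proof.
move=> a s t Ts Tt [f c] [g d]; rewrite /state_kernel /=.
case: ifP => _; last by rewrite mulr0 addr0.
by have [-> // _ _ _] := svalP f; rewrite !mulrDl !mulrA.
Qed.

Let f_sum f (I : Type) (s : seq I) (g : I -> K -> K) : mult_state f ->
  (forall i, T (g i)) -> f (\sum_(i <- s) g i) = \sum_(i <- s) f (g i).
Proof.
move=> [fl _ _ _] Tg; elim: s => [|i s IH].
  rewrite !big_nil; have := fl 1 0 0 (subspace0 sT) (subspace0 sT).
  rewrite scale1r mul1r addr0 => /eqP.
  by rewrite -subr_eq0 opprD addrA subrr add0r oppr_eq0 => /eqP.
rewrite !big_cons -[g i]scale1r fl ?mul1r ?IH ?scale1r //.
by apply: (subspace_sum sT).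
Qed.
Let fZ f a t : mult_state f -> T t -> f (a *: t) = a * f t.
Proof.
move=> mf Tt; have [fl _ _ _] := mf; have := fl a t 0 Tt (subspace0 sT).
have := @f_sum f unit [::] (fun=> 0) mf (fun=> subspace0 sT).
by rewrite !big_nil => ->; rewrite !addr0.
Qed.

Let weighted_pos (I J : finType) (x : I -> I -> K -> K) (tau : J -> I) (u : J -> R[i]) :
  (forall i j, T (x i j)) -> mpos x ->
  posop (\sum_b \sum_a (u a * Num.conj (u b)) *: x (tau b) (tau a)).
Proof.
move=> Tx px v; have := mpos_pull tau (fun i j => Tb (Tx i j)) px (fun a => u a *: v).
rewrite !opE dot_suml; congr (0 <= _); apply: eq_bigr => b _.
rewrite opE dot_suml; apply: eq_bigr => a _.
by rewrite opE dotZl (opZ (Tb (Tx _ _))) dotZl dotZr mulrA.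
Qed.

(* Only pairs of points carrying the same state contribute, so the form splits into
   one positive form for each state that occurs. *)
Let state_form_pos (I J : finType) (x : I -> I -> K -> K) (tau : J -> I)
    (f : J -> {f | mult_state f}) (w : J -> R[i]) :
  (forall i j, T (x i j)) -> mpos x ->
  0 <= \sum_b \sum_a
    if `[< f a = f b >] then sval (f a) (x (tau b) (tau a)) * w a * Num.conj (w b) else 0.
Proof.
(* [rep] picks one index for each state that occurs, so that the indices can be partitioned by state
   within a finite type. *)
move=> Tx px; pose rep a := odflt a [pick b | `[< f b = f a >]].
have frep a : f (rep a) = f a.
  by rewrite /rep; case: pickP => [b /asboolP //|/(_ a)]; rewrite asboolT.
have repE a b : `[< f a = f b >] = (rep a == rep b).
  apply/asboolP/eqP => [fab|rab]; last by rewrite -frep rab frep.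
  rewrite /rep (eq_pick (Q := fun c => `[< f c = f b >])); last by move=> c; rewrite fab.
  by case: pickP => // /(_ b); rewrite asboolT.
rewrite (partition_big rep predT) //=; apply: sumr_ge0 => r _.
set g := sval (f r); have mg : mult_state g := svalP (f r).
pose u a := if rep a == r then w a else 0.
have := weighted_pos tau u Tx px; set s := \sum_b _ => ps.
have Ts b : T (\sum_a (u a * Num.conj (u b)) *: x (tau b) (tau a)).
  by apply: (subspace_sum sT) => a _; apply: (subspaceZ sT).
have [_ gpos _ _] := mg.
have Tss : T s by apply: (subspace_sum sT) => b _; exact: Ts.
have := gpos _ Tss ps; rewrite /s f_sum //.
congr (0 <= _); rewrite [RHS]big_mkcond; apply: eq_bigr => b _ /=.
rewrite f_sum //; last by move=> a; apply: (subspaceZ sT).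
case: ifP => rb; last first.
  by rewrite big1 // => a _; rewrite /u rb conjC0 mulr0 (fZ _ mg) ?mul0r.
apply: eq_bigr => a _; rewrite repE (eqP rb) (fZ _ mg) // /u rb.
case: ifP => [ra|_]; last by rewrite !mul0r.
by rewrite -(frep a) (eqP ra) mulrC mulrA.
Qed.

Lemma state_kernel_faithful : kernel_faithful T state_kernel.
Proof.
move=> n x Tx; split=> [px l|h].
  pose e (a : {i : 'I_n & 'I_(size (l i))}) := tnth (in_tuple (l (tag a))) (tagged a).
  have := state_form_pos (fun a => tag a) (fun a => (e a).2.1) (fun a => (e a).1 * (e a).2.2) Tx px.
  congr (0 <= _).
  transitivity (\sum_i \sum_(q <- l i) \sum_j \sum_(p <- l j)
     p.1 * Num.conj q.1 * state_kernel (x i j) p.2 q.2); last first.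
    apply: eq_bigr => i _; rewrite exchange_big /=; apply: eq_bigr => j _.
    by rewrite exchange_big.
  rewrite sum_lists; apply: eq_bigr => b _; rewrite sum_lists; apply: eq_bigr => a _.
  rewrite /state_kernel -/(e a) -/(e b).
  by case: ifP => _; rewrite ?mulr0 // rmorphM; ring.
apply: minT => // c; apply: contrapT => np.
set t0 := \sum_i _ in np.
have sc i j : T ((c j * Num.conj (c i)) *: x i j) by exact: (subspaceZ sT).
have Tt0 : T t0 by do 2?[apply: (subspace_sum sT) => ? _].
have [f [f1 f2 f3 f4 nf]] :=
  multiplicative_state oT (multiplier_commutes oT Tcl minT) Tt0 np.
have mf : mult_state f by split.
apply: nf; have := h (fun i => [:: (c i, (exist _ f mf, 1))]); congr (0 <= _).
rewrite f_sum //; last by move=> i; exact: (subspace_sum sT).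
apply: eq_bigr => i _; rewrite f_sum //; apply: eq_bigr => j _.
rewrite fZ // /kform !big_seq1 /state_kernel asboolT //=.
by rewrite conjC1 !mulr1.
Qed.
End StateKernel.

(** * A linked system of minimal order is identified with the centre *)

Section MinimalLink.
Variables (R : realType) (H K : hilbert R) (N : set (H -> K)).
Variables (S : set (opspace H)) (T : set (opspace K)) (E : cstar_envelope S).
Hypothesis link : tro_linked N S T.
Hypothesis minT : minimal_order T.

Let Nb := tl_bop link.
Let oS := tl_S link.
Let oT := tl_T link.
Let N' : set (K -> H) := [set adj a | a in N].
Let link' : tro_linked N' T S := tro_linked_sym link.

Let mult_link a b : N' a -> N' b -> multiplier T (adj a \o b).
Proof.
move=> Na Nb'; split; first by have [bb _ _ _] := oT; apply: bb; exact: (linked_mul link').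
by move=> t Tt; split; [exact: (linked_mul_left link')|exact: (linked_mul_right link')].
Qed.

Let intertwined y : T y -> exists2 z, S z & intertwines N z y.
Proof.
move=> Ty; have [a b Na Nb' u|z Sz [h1 h2]] := intertwines_ex link' Ty.
  have := multiplier_commutes oT (tl_Tcl link) minT (mult_link Na Nb') Ty.
  by move=> /(congr1 (fun f => f u)).
exists z => //; split=> a Na u.
  have := h2 (adj a) (ex_intro2 _ _ a Na erefl) u.
  by rewrite adjK //; exact: Nb.
exact: (h1 (adj a) (ex_intro2 _ _ a Na erefl)).
Qed.

(** On the space induced from the states of T, z multiplies the weight at f by f(y). Products of N
    and N^* are multipliers, so f is multiplicative on them times y, which is what compatibility of
    z with this action needs. *)
Let central y z : T y -> S z -> intertwines N z y -> centre E z.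
Proof.
move=> Ty Sz izy; apply: commute_centre => // s Ss.
pose Az (p : {a | N' a} * ({f | mult_state T f} * R[i])) :=
  (p.1, (p.2.1, sval p.2.1 y * p.2.2)).
pose Az' (p : {a | N' a} * ({f | mult_state T f} * R[i])) :=
  (p.1, (p.2.1, Num.conj (sval p.2.1 y) * p.2.2)).
have kl := link_kernel_linear link' (@state_kernel_linear _ _ T).
have kf := link_kernel_faithful link' (state_kernel_faithful oT (tl_Tcl link) minT).
apply: (criterion_commute E oS kl kf (z := z) (Az := Az) (Az' := Az')) => //.
- move=> r Sr [[a Na] [f c]] [[b Nb'] [g d]]; rewrite /link_kernel /state_kernel /=.
  case: asboolP => // <-; rewrite [in RHS]rmorphM /= conjCK; ring.
- move=> [[a Na] [f c]] [[b Nb'] [g d]]; rewrite /link_kernel /state_kernel /=.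
  case: asboolP => // _; have [_ _ _ fm] := svalP f.
  have m := mult_link Nb' Na.
  have -> : adj b \o z \o a = (adj b \o a) \o y.
    apply/funext => u /=; have [a0 Na0 <-] := Na.
    by rewrite izy.2.
  by rewrite fm // mulrA.
Qed.

Lemma minimal_link_centre : uco_isomorphic (centre E) T.
Proof.
apply: (intertwined_iso link) => //; first by move=> ? [].
  move=> x cx; have [Sx _] := cx; apply: (intertwines_ex link) => // a b Na Nb0 u.
  have := centre_commutes oS cx (linked_mul link Na Nb0)
    (linked_mul_right link Na Nb0 Sx) (linked_mul_left link Na Nb0 Sx).
  exact: (congr1 (fun f => f u)).
by move=> y Ty; have [z Sz izy] := intertwined Ty; exists z => //; exact: central izy.
Qed.
End MinimalLink.

Lemma TRO_equivalent_closure (R : realType) (H K : hilbert R) (S : set (opspace H))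
    (T : set (opspace K)) : operator_system S -> operator_system T ->
  TRO_equivalent S T ->
  TRO_equivalent (opclosure S : set (opspace H)) (opclosure T : set (opspace K)).
Proof.
move=> [Sb _ _ _] [Tb _ _ _] [M [tM nM MT MS]]; exists M; have [Mb _ _] := tM.
have Mb' : adjset M `<=` bounded_op K H.
  by rewrite adjset_adj // => _ [a Ma <-]; exact/adj_bop/Mb.
have cl A : A `<=` bounded_op H H -> opclosure A `<=` opclosure (opclosure A).
  by move=> bA; apply: opclosureS; exact: sub_opclosure.
split=> //.
  move=> _ [_ [a Ma [t Tt <-]] [b Mb0 <-]]; apply: cl => //.
  apply: (@opclosure_mul3 _ _ _ _ _ (adjset M) T M S) => //.
  - by move=> a' t' b' Ma' Tt' Mb1; apply: MT; exists (a' \o t'); [exists a' => //; exists t'|exists b'].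
  - exact: sub_opclosure.
  - exact: sub_opclosure.
move=> _ [_ [a Ma [s Ss <-]] [b Mb0 <-]]; rewrite opclosure_idem.
apply: (@opclosure_mul3 _ _ _ _ _ M S (adjset M) T) => //.
- by move=> a' t' b' Ma' Tt' Mb1; apply: MS; exists (a' \o t'); [exists a' => //; exists t'|exists b'].
- exact: sub_opclosure.
- exact: sub_opclosure.
Qed.

(** The TRO is kept, with closures taken on both sides: the closed function system is the image of
    the centre under a unital complete order isomorphism, hence a legitimate embedding of the
    centre. *)
Lemma function_system_centre (R : realType) (H : hilbert R) (S : set (opspace H))
    (E : cstar_envelope (opclosure S)) (X : topologicalType) (F : set (funspace R X)) :
  operator_system S -> function_system F -> delta_equivalent S F ->
  delta_equivalent (opclosure S : set (opspace H)) (centre E).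
Proof.
move=> oS fF [H1 [K1 [phi [psi [uphi upsi tro]]]]].
have oS1 := ucoe_image_opsys oS (opspace_order_bounded oS) uphi.
have oT1 := function_system_image fF upsi.
have [N link] := tro_equivalent_linked oS1 oT1 tro.
have [phi' [E1 [uphi' im cE1]]] := envelope_extend E oS uphi.
have := minimal_link_centre E1 link (function_system_min fF upsi).
rewrite cE1 => -[theta utheta imtheta].
exists H1, K1, phi', (theta \o phi'); split => //.
  apply: ucoe_comp => //; apply: (ucoe_sub _ uphi') => x [] //.
by rewrite im image_comp in imtheta *; rewrite imtheta; exact: TRO_equivalent_closure.
Qed.

(** Completing the square: with b the pairing of row 0 with the other vectors, the form at xi is
    that of z_00 at xi_0 + g b plus that of the Schur complement. *)
Lemma mpos_schur (R : realType) (L : hilbert R) n (z : 'I_n.+1 -> 'I_n.+1 -> L -> L) (g : L -> L) :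
  (forall i j, bounded_op L L (z i j)) -> (forall i j, is_adjoint (z i j) (z j i)) ->
  posop (z ord0 ord0) -> bounded_op L L g -> (forall x, z ord0 ord0 (g x) = x) ->
  mpos (fun i j => z (lift ord0 i) (lift ord0 j) -
    (z (lift ord0 i) ord0 \o g \o z ord0 (lift ord0 j))) -> mpos z.
Proof.
move=> bz hz ph bg hg ps xi.
pose b := \sum_j z ord0 (lift ord0 j) (xi (lift ord0 j)).
pose eta := xi ord0 + g b; have := addr_ge0 (ph eta) (ps (fun i => xi (lift ord0 i))).
congr (0 <= _); rewrite big_ord_recl [in RHS]big_ord_recl -addrA.
have E1 : \sum_(i < n) hdot L (z ord0 (lift ord0 i) (xi (lift ord0 i))) (xi ord0) =
    hdot L b (xi ord0) by rewrite dot_suml.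
have E2 u : \sum_(i < n) hdot L (z (lift ord0 i) ord0 u) (xi (lift ord0 i)) = hdot L u b.
  by rewrite dot_sumr; apply: eq_bigr => i _; rewrite hz.
have E3 : \sum_i \sum_j hdot L ((z (lift ord0 i) (lift ord0 j) -
      (z (lift ord0 i) ord0 \o g \o z ord0 (lift ord0 j))) (xi (lift ord0 j))) (xi (lift ord0 i)) =
    \sum_i \sum_j hdot L (z (lift ord0 i) (lift ord0 j) (xi (lift ord0 j))) (xi (lift ord0 i))
    - hdot L (g b) b.
  rewrite -E2 -sumrB; apply: eq_bigr => i _.
  rewrite /b (op_sum bg) (op_sum (bz _ _)) dot_suml -sumrB; apply: eq_bigr => j _.
  by rewrite !opE dotBl.
rewrite E3 E1; have -> : \sum_(i < n) \sum_j hdot L (z (lift ord0 i) j (xi j)) (xi (lift ord0 i)) =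
  hdot L (xi ord0) b + \sum_(i < n) \sum_(j < n) hdot L (z (lift ord0 i) (lift ord0 j) (xi (lift ord0 j))) (xi (lift ord0 i)).
  rewrite -E2 -big_split; apply: eq_bigr => i _; exact: big_ord_recl.
rewrite /eta (opD (bz _ _)) hg !(dotDl, dotDr) (hz ord0 ord0 (xi ord0) (g b)) hg.
have := hz ord0 ord0 (g b) (g b); rewrite !hg => ->; ring.
Qed.

(** * Commuting families of operators *)

Section CommutingFamilies.
Variables (R : realType) (L : hilbert R) (Z : set (opspace L)).
Hypotheses (Zb : forall z, Z z -> bounded_op L L z) (Zadj : forall z, Z z -> Z (adj z)).
Hypothesis Zcomm : forall x y : L -> L, Z x -> Z y -> x \o y = y \o x.

Let commutant (y : L -> L) := bounded_op L L y /\ forall z : L -> L, Z z -> y \o z = z \o y.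
(** The bicommutant of Z: still commutative, but also closed under products and existing inverses,
    which Z need not be and which Schur complements demand. *)
Let C : set (opspace L) := [set x | bounded_op L L x /\
  forall y : L -> L, commutant y -> (x : L -> L) \o y = y \o x].

Let ZC z : Z z -> C z.
Proof. by move=> Zz; split; [exact: Zb|move=> y [_ h]; rewrite h]. Qed.
Let CC (x y : L -> L) : C x -> C y -> x \o y = y \o x.
Proof.
move=> [bx hx] [b_y hy]; apply: hx; split=> // z Zz; apply: hy; split; first exact: Zb.
by move=> z' Zz'; exact: Zcomm.
Qed.
Let C_comp (x y : L -> L) : C x -> C y -> C (x \o y).
Proof.
move=> [bx hx] [b_y hy]; split; first exact: bop_comp.
move=> w cw; have := hx _ cw; have := hy _ cw => h1 h2; apply/funext => u /=.
by rewrite [y (w u)](congr1 (fun f => f u) h1) [x (w _)](congr1 (fun f => f _) h2).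
Qed.
Let C_lin a (x y : L -> L) : C x -> C y -> C (a *: x + y).
Proof.
move=> [bx hx] [b_y hy]; split; first by apply: bopD => //; exact: bopZ.
move=> w cw; have [bw _] := cw; apply/funext => u; rewrite /= !opE (opD bw) (opZ bw).
by rewrite [x (w u)](congr1 (fun f => f u) (hx _ cw)) [y (w u)](congr1 (fun f => f u) (hy _ cw)).
Qed.
Let commutant_adj y : commutant y -> commutant (adj y).
Proof.
move=> [b_y hy]; split; first exact: adj_bop.
move=> z Zz; rewrite -[z in LHS](adjK (Zb Zz)) -[z in RHS](adjK (Zb Zz)).
have bz := Zb (Zadj Zz).
by rewrite -(adj_comp bz b_y) -(adj_comp b_y bz) hy //; exact: Zadj.
Qed.
Let oC : operator_system C.
Proof.
split; first by move=> x [].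
- split; last by move=> a x y; exact: C_lin.
  by split=> [|y [b_y _]]; [exact: bop0|apply/funext => u; rewrite /= opE (op0 b_y)].
- by split; [exact: bop_id|].
- move=> x y [bx hx] xy; have <- := adjE bx xy; split; first exact: adj_bop.
  move=> w cw; have [bw _] := cw; have bw' := adj_bop bw.
  have h := hx _ (commutant_adj cw).
  by rewrite -[w in LHS](adjK bw) -[w in RHS](adjK bw) -(adj_comp bw' bx) -(adj_comp bx bw') h.
Qed.
Let C1 : C idfun. Proof. by case: oC. Qed.
Let C_mult d : C d -> multiplier C d.
Proof. by move=> Cd; split; [case: Cd|move=> t Ct; split; exact: C_comp]. Qed.

Let character (f : (L -> L) -> R[i]) := [/\
  forall a s t, C s -> C t -> f (a *: s + t) = a * f s + f t,
  forall t, C t -> posop t -> 0 <= f t, f idfun = 1 &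
  forall s t, C s -> C t -> f (s \o t) = f s * f t].

(** Every element of the algebra C is a multiplier of C, so the states separating non-positive
    elements are multiplicative on all of C. *)
Let not_posop t : C t -> ~ posop t -> exists2 f, character f & ~ (0 <= f t).
Proof.
move=> Ct np; have mc d s : multiplier C d -> C s -> d \o s = s \o d.
  by move=> md Cs; apply: CC => //; have [_ /(_ _ C1)[]] := md.
have [f [f1 f2 f3 f4 nf]] := multiplicative_state oC mc Ct np; exists f => //.
by split=> // s t' Cs Ct'; apply: f4 => //; exact: C_mult.
Qed.

Let char0 f : character f -> f 0 = 0.
Proof.
move=> [fl _ _ _]; have [_ sC _ _] := oC; have := fl 1 0 0 sC.1 sC.1.
rewrite scale1r mul1r addr0 => /eqP.
by rewrite -subr_eq0 opprD addrA subrr add0r oppr_eq0 => /eqP.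
Qed.
Let charZ f a t : character f -> C t -> f (a *: t) = a * f t.
Proof.
move=> cf Ct; have [fl _ _ _] := cf; have [_ sC _ _] := oC.
by have := fl a t 0 Ct sC.1; rewrite (char0 cf) !addr0.
Qed.
Let charD f s t : character f -> C s -> C t -> f (s + t) = f s + f t.
Proof. by move=> [fl _ _ _] Cs Ct; have := fl 1 s t Cs Ct; rewrite scale1r mul1r. Qed.

Let C_inv (h g : L -> L) : C h -> bounded_op L L g -> (forall x, g (h x) = x) ->
  (forall x, h (g x) = x) -> C g.
Proof.
move=> [bh hh] bg gh hg; split=> // y cy; apply/funext => u /=.
by rewrite -[u in LHS]hg -[y (h _)](congr1 (fun f => f (g u)) (hh _ cy)) gh.
Qed.

(** Induction on the size by Schur complements. Adding e on the diagonal makes the corner invertible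
    in C, and a character sends the operator Schur complement to the scalar one. *)
Let character_pos n (z : 'I_n -> 'I_n -> L -> L) :
  (forall i j, C (z i j)) -> (forall i j, is_adjoint (z i j) (z j i)) ->
  (forall f (c : 'I_n -> R[i]), character f ->
     0 <= \sum_i \sum_j f (z i j) * (c j * Num.conj (c i))) -> mpos z.
Proof.
have [Cb sC _ _] := oC.
elim: n z => [|n IH] z Cz hz pz; first by move=> xi; rewrite big_ord0.
apply: mpos_limit => e e0.
pose y i j : L -> L := (if i == j then e else 0)%:C *: idfun + z i j.
exists y; last first.
  move=> i j x; have -> : z i j x - y i j x = - ((if i == j then e else 0)%:C *: x).
    by rewrite /y !opE opprD addrCA subrr addr0.
  rewrite nrN nrZ cn_real ler_wpM2r ?nr_ge0 //.
  by case: eqP => _; rewrite ?normr0 ?ger0_norm ?(ltW e0).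
have Cy i j : C (y i j) by exact: C_lin.
have fy f i j : character f -> f (y i j) = (if i == j then e else 0)%:C + f (z i j).
  by move=> cf; have [fl _ f1 _] := cf; rewrite /y fl // f1 mulr1.
have hy i j : is_adjoint (y i j) (y j i).
  have := is_adjoint_lin (if i == j then e else 0)%:C (@is_adjoint_id _ L) (hz i j).
  by rewrite conjC_real /y [j == i]eq_sym.
have py f (c : 'I_n.+1 -> R[i]) : character f ->
    0 <= \sum_i \sum_j f (y i j) * (c j * Num.conj (c i)).
  move=> cf; have -> : \sum_i \sum_j f (y i j) * (c j * Num.conj (c i)) =
      \sum_i e%:C * (c i * Num.conj (c i)) +
      \sum_i \sum_j f (z i j) * (c j * Num.conj (c i)).
    rewrite -big_split; apply: eq_bigr => i _ /=.
    transitivity (\sum_j ((if i == j then e else 0)%:C * (c j * Num.conj (c i)) +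
        f (z i j) * (c j * Num.conj (c i)))).
      by apply: eq_bigr => j _; rewrite fy // mulrDl.
    rewrite big_split /= (@sum_delta _ _ _ i) ?eqxx // => j.
    by rewrite eq_sym => /negPf ->; rewrite mul0r.
  apply: addr_ge0 (pz f c cf); apply: sumr_ge0 => i _.
  by rewrite mulJ -rmorphM ler0c mulr_ge0 ?(ltW e0) ?sqr_ge0.
have pz0 : posop (z ord0 ord0).
  apply: contrapT => np; have [f cf nf] := not_posop (Cz _ _) np; apply: nf.
  have := pz f (fun i => if i == ord0 then 1 else 0) cf.
  rewrite big_ord_recl [\sum_(i < n) _]big1 ?addr0; last first.
    by move=> i _; rewrite big1 // => j _; rewrite conjC0 !mulr0.
  rewrite big_ord_recl [\sum_(i < n) _]big1 ?addr0 ?eqxx ?conjC1 ?mulr1 //.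
  by move=> j _; rewrite mul0r mulr0.
have y0E x : y ord0 ord0 x = e%:C *: x + z ord0 ord0 x by rewrite /y eqxx.
have lb x : e * nr x ^+ 2 <= re (hdot L (y ord0 ord0 x) x).
  rewrite y0E dotDl dotZl dotxx !cE mul0r subr0 lerDl.
  exact/ge0_re/pz0.
have pos0 : posop (y ord0 ord0).
  move=> x; rewrite y0E dotDl dotZl; apply: addr_ge0 (pz0 x).
  by rewrite mulr_ge0 ?dotxx_ge0 // ler0c ltW.
have [g [bg _ gsa [gh hg] _]] := invertible_bounded_below (Cb _ (Cy _ _)) pos0 e0 lb.
have Cg : C g := C_inv (Cy _ _) bg gh hg.
apply: (mpos_schur (fun i j => Cb _ (Cy i j)) hy pos0 bg hg).
have Cs i j : C (y (lift ord0 i) ord0 \o g \o y ord0 (lift ord0 j)).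
  exact: C_comp (C_comp (Cy _ _) Cg) (Cy _ _).
apply: IH.
- by move=> i j; apply: (subspaceB sC).
- move=> i j; apply: is_adjointB => //.
  exact: (is_adjoint_comp (is_adjoint_comp (hy _ _) gsa) (hy _ _)).
move=> f c cf.
pose b := \sum_j f (y ord0 (lift ord0 j)) * c j.
(* The coordinate at 0 is chosen to annihilate row 0 of the scalar matrix, f(g) being the inverse of
   f(y_00); what remains is the form of the Schur complement at c. *)
pose c' i := if unlift ord0 i is Some j then c j else - (f g * b).
have := py f c' cf; congr (0 <= _).
have [_ _ f1 fM] := cf.
have c'0 : c' ord0 = - (f g * b) by rewrite /c' unlift_none.
have c'S i : c' (lift ord0 i) = c i by rewrite /c' liftK.
have fgh : f g * f (y ord0 ord0) = 1.
  by rewrite -fM // -f1; congr f; apply/funext => x /=; rewrite gh.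
have rows i : \sum_j f (y i j) * (c' j * Num.conj (c' i)) = (- (f (y i ord0) * f g * b) +
    \sum_j f (y i (lift ord0 j)) * c j) * Num.conj (c' i).
  rewrite big_ord_recl c'0 mulrDl mulr_suml; congr (_ + _); first by ring.
  by apply: eq_bigr => j _; rewrite c'S mulrA.
rewrite big_ord_recl rows [f _ * f g]mulrC fgh mul1r addNr mul0r add0r.
apply: eq_bigr => i _; rewrite rows c'S /b mulr_sumr -sumrN -big_split mulr_suml /=.
apply: eq_bigr => j _.
have -> : y (lift ord0 i) (lift ord0 j) - (y (lift ord0 i) ord0 \o g \o y ord0 (lift ord0 j)) =
   (-1) *: (y (lift ord0 i) ord0 \o g \o y ord0 (lift ord0 j)) + y (lift ord0 i) (lift ord0 j).
  by rewrite scaleN1r addrC.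
have [fl _ _ _] := cf; rewrite (fl (-1) _ _ (Cs i j) (Cy _ _)) (fM _ _ (C_comp (Cy _ _) Cg) (Cy _ _)).
rewrite (fM _ _ (Cy _ _) Cg); ring.
Qed.

(* Characters of the bicommutant reduce positivity to scalar matrices. *)
Lemma commuting_min : minimal_order Z.
Proof.
move=> n z Zz pz; have Cz i j : C (z i j) by exact: ZC.
have hz := min_hermitian (fun i j => Zb (Zz i j)) pz.
have [_ sC _ _] := oC.
have f_sum f (I : Type) (s : seq I) (g : I -> L -> L) : character f ->
    (forall i, C (g i)) -> f (\sum_(i <- s) g i) = \sum_(i <- s) f (g i).
  move=> cf Cg; elim: s => [|i s IH]; first by rewrite !big_nil char0.
  by rewrite !big_cons charD ?IH //; apply: (subspace_sum sC).
apply: character_pos => // f c cf.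
have Czc i j : C ((c j * Num.conj (c i)) *: z i j) by exact: (subspaceZ sC).
set t := \sum_i _; have -> : t = f (\sum_i \sum_j (c j * Num.conj (c i)) *: z i j).
  rewrite f_sum //; last by move=> i; exact: (subspace_sum sC).
  apply: eq_bigr => i _; rewrite f_sum //; apply: eq_bigr => j _.
  by rewrite charZ // mulrC.
have [_ fpos _ _] := cf; apply: fpos (pz c).
by apply: (subspace_sum sC) => i _; exact: (subspace_sum sC).
Qed.
End CommutingFamilies.

(** * The centre is an operator system of minimal order *)

Section CentreSystem.
Variables (R : realType) (H : hilbert R) (S : set (opspace H)) (E : cstar_envelope S).
Hypothesis oS : operator_system S.

Let L := env_space E.
Let Sb : forall s, S s -> bounded_op H H s. Proof. by case: oS. Qed.
Let sS : @Defs.subspace _ (opspace H) S. Proof. by case: oS. Qed.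
Let jb s : S s -> bounded_op L L (env_map E s). Proof. exact: (ucoe_bop (env_ucoe E)). Qed.

Let centre_comm z s : centre E z -> S s ->
  (env_map E z : L -> L) \o env_map E s = (env_map E s : L -> L) \o env_map E z.
Proof. by move=> [_ h] Ss; apply: h; exact: env_algebra_gen. Qed.

Let j_adj s : S s -> env_map E (adj s) = adj (env_map E s : L -> L) :> (L -> L).
Proof.
move=> Ss; apply/esym/adjE; first exact: jb.
by apply: (ucoe_adj oS (env_ucoe E) Ss); exact: adjP (Sb Ss).
Qed.

Lemma centre_opsys : operator_system (centre E).
Proof.
have jl := env_ucoe E; have [_ _ S1 _] := oS.
have lin a z z' : centre E z -> centre E z' -> centre E (a *: z + z').
  move=> cz cz'; have [[Sz _] [Sz' _]] := (cz, cz').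
  apply: commute_centre => //; first exact: sS.2.
  move=> s Ss; have [_ -> // _ _] := jl; apply/funext => u; rewrite /= !opE.
  rewrite (opD (jb Ss)) (opZ (jb Ss)).
  have := congr1 (fun f : L -> L => f u) (centre_comm cz Ss).
  by have := congr1 (fun f : L -> L => f u) (centre_comm cz' Ss) => /= -> ->.
have c1 : centre E idfun.
  by apply: commute_centre => // s Ss; have [_ _ -> _] := jl.
split; first by move=> z [/Sb].
- split; last exact: lin.
  by have := lin (-1) _ _ c1 c1; rewrite scaleN1r addNr.
- exact: c1.
move=> z z' cz zz'; have [Sz _] := cz; have <- := adjE (Sb Sz) zz'.
apply: commute_centre => //; first exact: opsys_adj.
move=> s Ss; rewrite (j_adj Sz).
have h := centre_comm cz (opsys_adj oS Ss); rewrite (j_adj Ss) in h.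
have bs := jb Ss; have bz := jb Sz; have bs' := adj_bop bs.
rewrite -[env_map E s](adjK bs).
by rewrite -(adj_comp bs' bz) -(adj_comp bz bs') h.
Qed.

(** The image of the centre in the envelope is a selfadjoint commuting family, and [env_map]
    preserves and reflects matrix positivity. *)
Lemma centre_min : minimal_order (centre E).
Proof.
move=> n z cz pz; have Sz i j : S (z i j) by case: (cz i j).
have jl := env_ucoe E; have [_ _ _ jpos] := jl.
apply: (iffRL (ucoe_mpos jl Sz)).
apply: (commuting_min (Z := [set env_map E x | x in centre E])).
- by move=> _ [x [Sx _] <-]; exact: jb.
- move=> _ [x cx <-]; have [Sx _] := cx; exists (adj x); last exact: j_adj.
  exact: (opsys_adj centre_opsys).
- by move=> _ _ [x cx <-] [y [Sy _] <-]; exact: centre_comm.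
- by move=> i j; exists (z i j).
move=> c.
have lin (I : Type) (s : seq I) (g : I -> H -> H) : (forall i, S (g i)) ->
    env_map E (\sum_(i <- s) g i) = \sum_(i <- s) env_map E (g i) :> (L -> L).
  move=> Sg; elim: s => [|i s IH].
    by rewrite !big_nil; exact: (ucoe0 sS jl).
  rewrite !big_cons -IH; apply: (ucoeD jl) => //.
  exact: (subspace_sum sS).
have Szc i j : S ((c j * Num.conj (c i)) *: z i j) by exact: (subspaceZ sS).
have -> : \sum_i \sum_j (c j * Num.conj (c i)) *: (env_map E (z i j) : L -> L) =
    env_map E (\sum_i \sum_j (c j * Num.conj (c i)) *: z i j).
  rewrite lin; last by move=> i; exact: (subspace_sum sS).
  apply: eq_bigr => i _; rewrite lin //; apply: eq_bigr => j _.
  by rewrite (ucoeZ sS jl).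
set t := \sum_i _.
have St : S t by apply: (subspace_sum sS) => i _; exact: (subspace_sum sS).
have : mpos (fun i j : 'I_1 => env_map E t : L -> L).
  apply: (iffLR (@ucoe_mpos _ _ _ _ _ jl 1%N (fun _ _ => t) _)) => //.
  by move=> xi; rewrite !big_ord1; exact: pz.
by move=> h x; have := h (fun=> x); rewrite !big_ord1.
Qed.
End CentreSystem.

(** * State spaces *)

Section PointwiseTopology.

Lemma compact_set_type (X : topologicalType) (A : set X) : compact A -> compact [set: A].
Proof.
move=> cA G PG _; have GA : (set_val @ G) A.
  by apply: (@filterS _ G _ setT) filterT => x _; exact: set_valP.
have [p [Ap clp]] := cA _ _ GA.
exists (exist _ p (mem_set Ap)); split=> // B C GB [_ [[V oV <-] Vp VC]].
have GB' : (set_val @ G) (set_val @` B).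
  by apply: (@filterS _ G _ B) => // x Bx; exists x.
have [_ [[x Bx <-] Vx]] := clp _ _ GB' (open_nbhs_nbhs (conj oV Vp)).
by exists x; split=> //; exact: VC.
Qed.

Lemma hausdorff_set_type (X : topologicalType) (A : set X) :
  hausdorff_space X -> hausdorff_space (set_type A).
Proof.
move=> hX p q clpq; apply/val_inj/hX => B C nB nC.
have [x [Bx Cx]] := clpq _ _ (@initial_continuous _ _ set_val p _ nB)
  (@initial_continuous _ _ set_val q _ nC).
by exists (set_val x).
Qed.

Lemma closure_nonneg (R : realType) (X : topologicalType) (A : set X) (g : X -> R) :
  continuous g -> (forall x, A x -> 0 <= g x) -> forall x, closure A x -> 0 <= g x.
Proof.
move=> cg Ag x clx; rewrite leNgt; apply/negP => gx.
have nx : nbhs x (g @^-1` [set r | r < 0]).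
  by apply: cg; apply: open_nbhs_nbhs; split; [exact: open_lt|].
by have [y [/Ag + ]] := clx _ nx; rewrite /= leNgt => /negP.
Qed.

Lemma closure_zero (R : realType) (X : topologicalType) (A : set X) (g : X -> R) :
  continuous g -> (forall x, A x -> g x = 0) -> forall x, closure A x -> g x = 0.
Proof.
move=> cg Ag x clx; apply/eqP; rewrite eq_le -oppr_ge0.
rewrite (closure_nonneg (g := fun x => - g x) _ _ clx) ?(closure_nonneg cg _ clx) //.
- by move=> y /Ag ->.
- by move=> y; apply: continuousN; exact: cg.
- by move=> y /Ag ->; rewrite oppr0.
Qed.

Section Ptws.
Variables (R : realType) (I : eqType).
Local Notation PT := {ptws I -> R}.

Lemma ptws_proj (i : I) : continuous (fun p : PT => p i).
Proof. exact: (@proj_continuous I (fun=> R) i). Qed.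

Lemma ptws_hausdorff : hausdorff_space PT.
Proof. by apply: (@hausdorff_product I (fun=> R)) => i; exact: Rhausdorff. Qed.

Lemma ptws_compact (A : set PT) : closed A ->
  (forall i, exists k : R, forall p, A p -> `|p i| <= k) -> compact A.
Proof.
move=> clA /choice[k hk].
have cB : compact ([set p | forall i, `[- k i, k i]%classic (p i)] : set PT).
  by apply: (@tychonoff I (fun=> R) (fun i => `[- k i, k i]%classic)) => i; exact: segment_compact.
apply: (subclosed_compact clA cB) => p Ap i; rewrite /= in_itv /= -ler_norml.
exact: hk.
Qed.
End Ptws.
End PointwiseTopology.

Section ComplexContinuity.
Variables (R : realType) (X : topologicalType).

Lemma complex_continuous (f g : X -> R) : continuous f -> continuous g ->
  continuous (fun x => (f x)%:C - 'i%C * (g x)%:C : R[i]^o).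
Proof.
move=> cf cg x; apply/(@cvgrPdist_le _ _ _ (nbhs x) (nbhs_filter _)) => e e0.
have eE : e = (re e)%:C by apply: ceqP; rewrite !cE //; exact: (ge0_im (ltW e0)).
have r0 : 0 < re e / 2 by move: e0; rewrite eE ltcR => e0; rewrite divr_gt0.
have /(@cvgrPdist_le _ _ _ (nbhs x) (nbhs_filter _))/(_ _ r0) hf := cf x.
have /(@cvgrPdist_le _ _ _ (nbhs x) (nbhs_filter _))/(_ _ r0) hg := cg x.
apply: filterS2 hf hg => y hf hg; rewrite eE cnE lecR.
apply: (le_trans (cn_le_reim _)); rewrite !cE.
have -> : f x - (0 * g x - 1 * 0) - (f y - (0 * g y - 1 * 0)) = f x - f y by ring.
have -> : 0 - (0 * 0 + 1 * g x) - (0 - (0 * 0 + 1 * g y)) = - (g x - g y) by ring.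
by rewrite normrN; lra.
Qed.

Lemma affine_continuous (f g h : X -> R) (a : R) : continuous f -> continuous g ->
  continuous h -> continuous (fun x => f x - (a * g x + h x)).
Proof.
move=> cf cg ch x; apply: cvgB; first exact: cf.
apply: cvgD; last exact: ch.
by apply: cvgM; [exact: cvg_cst|exact: cg].
Qed.

Lemma shift_continuous (f : X -> R) (a : R) : continuous f -> continuous (fun x => f x - a).
Proof. by move=> cf x; apply: cvgB; [exact: cf|exact: cvg_cst]. Qed.
End ComplexContinuity.

Section StateSpace.
Variables (R : realType) (H : hilbert R) (Z : set (opspace H)).
Hypothesis oZ : operator_system Z.

Let Zb : forall z, Z z -> bounded_op H H z. Proof. by case: oZ. Qed.
Let sZ : @Defs.subspace _ (H -> H) Z. Proof. by case: oZ. Qed.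
Let Z1 : Z idfun. Proof. by case: oZ. Qed.

Local Notation PT := {ptws {classic (H -> H)} -> R}.

(* The real part of a state, extended by 0 outside of Z; it determines the state. *)
Definition real_state (p : PT) := [/\
  forall (a : R) (s t : H -> H), Z s -> Z t -> p (a%:C *: s + t) = a * p s + p t,
  forall t : H -> H, Z t -> posop t -> 0 <= p t,
  forall t : H -> H, Z t -> posop t -> p ('i%C *: t) = 0,
  p (idfun : H -> H) = 1 & forall t : H -> H, ~ Z t -> p t = 0].

(** A complex linear functional f is recovered from its real part by f(t) = Re f(t) - i Re f(i
    t). *)
Definition state_value (p : PT) (t : H -> H) : R[i] :=
  (p t)%:C - 'i%C * (p ('i%C *: t))%:C.

(** Each condition involves only finitely many coordinates, so it survives pointwise limits; with
    the coordinatewise bounds this gives compactness by Tychonoff. *)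
Lemma real_state_closed : closed [set p | real_state p].
Proof.
have cp := @ptws_proj R {classic (H -> H)}.
move=> p clp; split.
- move=> a s t Zs Zt; apply/eqP; rewrite -subr_eq0; apply/eqP.
  apply: (closure_zero (g := fun q : PT => q (a%:C *: s + t) - (a * q s + q t)) _ _ clp).
    exact: (@affine_continuous R PT (fun q => q (a%:C *: s + t)) (fun q => q s) (fun q => q t)
      a (cp _) (cp _) (cp _)).
  by move=> q [-> // _ _ _ _]; rewrite subrr.
- move=> t Zt pt; apply: (closure_nonneg (g := fun q : PT => q t) _ _ clp); first exact: cp.
  by move=> q [_ h _ _ _]; exact: h.
- move=> t Zt pt; apply: (closure_zero (g := fun q : PT => q ('i%C *: t)) _ _ clp).
    exact: cp.
  by move=> q [_ _ h _ _]; exact: h.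
- apply/eqP; rewrite -subr_eq0; apply/eqP.
  apply: (closure_zero (g := fun q : PT => q idfun - 1) _ _ clp).
    exact: (@shift_continuous R PT (fun q => q (idfun : H -> H)) 1 (cp _)).
  by move=> q [_ _ _ -> _]; rewrite subrr.
- move=> t nt; apply: (closure_zero (g := fun q : PT => q t) _ _ clp); first exact: cp.
  by move=> q [_ _ _ _ h]; exact: h.
Qed.

Section OneState.
Variable p : PT.
Hypothesis hp : real_state p.

Let Ti t : Z t -> Z ('i%C *: t). Proof. exact: (subspaceZ sZ). Qed.
Let p_lin (a : R) (s t : H -> H) : Z s -> Z t -> p (a%:C *: s + t) = a * p s + p t.
Proof. by case: hp => h _ _ _ _; exact: h. Qed.
Let p0 : p (0 : H -> H) = 0.
Proof.
have := p_lin 1 (subspace0 sZ) (subspace0 sZ); rewrite scale1r addr0 mul1r => /eqP.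
by rewrite -subr_eq0 opprD addrA subrr add0r oppr_eq0 => /eqP.
Qed.
Let pZ (a : R) (t : H -> H) : Z t -> p (a%:C *: t) = a * p t.
Proof. by move=> Zt; have := p_lin a Zt (subspace0 sZ); rewrite !addr0 p0 addr0. Qed.
Let p_im (t : H -> H) : Z t -> is_adjoint t t -> p ('i%C *: t) = 0.
Proof.
move=> Zt ht; have [k k0 [pk _]] := sa_bounded (Zb Zt) ht.
have [_ _ h3 _ _] := hp; have := h3 _ (sZ.2 k%:C _ _ Z1 Zt) pk.
have -> : 'i%C *: (k%:C *: idfun + t) = k%:C *: ('i%C *: (idfun : H -> H)) + 'i%C *: t.
  by rewrite scalerDr !scalerA mulrC.
have p1 : posop (idfun : H -> H) by move=> x; exact: dotxx_ge0.
by rewrite (p_lin _ (Ti Z1) (Ti Zt)) (h3 _ Z1 p1) mulr0 add0r.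
Qed.

Lemma state_value_lin a (s t : H -> H) : Z s -> Z t ->
  state_value p (a *: s + t) = a * state_value p s + state_value p t.
Proof.
move=> Zs Zt; rewrite /state_value.
have -> : a *: s + t = (re a)%:C *: s + ((im a)%:C *: ('i%C *: s) + t).
  rewrite addrA scalerA -scalerDl; congr (_ *: _ + _).
  by apply: ceqP; rewrite !cE; ring.
have -> : 'i%C *: ((re a)%:C *: s + ((im a)%:C *: ('i%C *: s) + t)) =
    (re a)%:C *: ('i%C *: s) + ((- im a)%:C *: s + 'i%C *: t).
  rewrite !scalerDr !scalerA; congr (_ *: _ + (_ *: _ + _)); apply: ceqP; rewrite !cE; ring.
have Zs' := Ti Zs; have Zt' := Ti Zt.
rewrite !p_lin //; [|exact: sZ.2|exact: sZ.2].
by apply: ceqP; rewrite !cE; ring.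
Qed.
Lemma state_value_sa (t : H -> H) : Z t -> is_adjoint t t -> state_value p t = (p t)%:C.
Proof. by move=> Zt ht; rewrite /state_value p_im // mulr0 subr0. Qed.
Lemma state_value_pos (t : H -> H) : Z t -> posop t -> 0 <= state_value p t.
Proof.
move=> Zt pt; rewrite state_value_sa //; last exact: posop_sa (Zb Zt) pt.
by case: hp => _ h _ _ _; rewrite ler0c; exact: h.
Qed.
Lemma state_value_id : state_value p idfun = 1.
Proof. by rewrite state_value_sa //; case: hp => _ _ _ -> _. Qed.
Lemma state_value_adj (t : H -> H) : Z t -> state_value p (adj t) = Num.conj (state_value p t).
Proof.
move=> Zt; have [a [b [Za ha Zb' hb ->]]] := sa_decompose oZ Zt.
have -> : adj ('i%C *: a + b) = (- 'i%C) *: a + b.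
  rewrite (adj_lin _ (Zb Za) (Zb Zb')) (adjE (Zb Za) ha) (adjE (Zb Zb') hb).
  by congr (_ *: _ + _); apply: ceqP; rewrite !cE ?oppr0.
rewrite !state_value_lin // !state_value_sa //.
by apply: ceqP; rewrite !cE; ring.
Qed.
Lemma state_value_re (t : H -> H) : re (state_value p t) = p t.
Proof. by rewrite /state_value !cE; ring. Qed.
Lemma state_value_sum (I : Type) (r : seq I) (g : I -> H -> H) : (forall i, Z (g i)) ->
  state_value p (\sum_(i <- r) g i) = \sum_(i <- r) state_value p (g i).
Proof.
move=> Zg; elim: r => [|i r IH]; first by rewrite !big_nil /state_value scaler0 p0 mulr0 subr0.
rewrite !big_cons -[g i]scale1r state_value_lin //; last exact: (subspace_sum sZ).
by rewrite mul1r IH scale1r.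
Qed.
Lemma state_valueZ a (t : H -> H) : Z t -> state_value p (a *: t) = a * state_value p t.
Proof.
move=> Zt; have := state_value_lin a Zt (subspace0 sZ).
by rewrite addr0 => ->; rewrite /state_value scaler0 p0 mulr0 subr0 addr0.
Qed.

Lemma real_state_le (b : H -> H) (k : R) : Z b -> posop (k%:C *: idfun + b) -> posop (k%:C *: idfun - b) ->
  `|p b| <= k.
Proof.
move=> Zb0 pk1 pk2; have [_ h2 _ h4 _] := hp.
have := h2 _ (sZ.2 k%:C _ _ Z1 Zb0) pk1; rewrite p_lin // h4 mulr1 => e1.
have ZN : Z (- b) := subspaceN sZ Zb0.
have := h2 _ (sZ.2 k%:C _ _ Z1 ZN) pk2; rewrite p_lin // h4 mulr1.
have -> : - b = (-1)%:C *: b by rewrite rmorphN rmorph1 scaleN1r.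
by rewrite pZ // mulN1r ler_norml => e2; apply/andP; split; lra.
Qed.
End OneState.

Lemma real_state_bounded (t : H -> H) : exists k : R, forall p : PT, real_state p -> `|p t| <= k.
Proof.
have [Zt|nt] := pselect (Z t); last first.
  by exists 0 => p [_ _ _ _ h]; rewrite h // normr0.
have [a [b [Za ha Zb0 hb tE]]] := sa_decompose oZ Zt.
have [k k0 [pk1 pk2]] := sa_bounded (Zb Zb0) hb.
exists k => p hp; suff -> : p t = p b by exact: (real_state_le hp Zb0 pk1 pk2).
rewrite -(state_value_re p t) tE state_value_lin // !state_value_sa // !cE; ring.
Qed.

Lemma vector_state (x : H) : nr x = 1 ->
  exists2 p : PT, real_state p & forall t, Z t -> state_value p t = hdot H (t x) x.
Proof.
move=> x1.
pose p : PT := fun t => if `[< Z t >] then re (hdot H ((t : H -> H) x) x) else 0.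
have pE (t : H -> H) : Z t -> p t = re (hdot H (t x) x) by move=> Zt; rewrite /p asboolT.
exists p; last first.
  move=> t Zt; rewrite /state_value !pE //; last exact: (subspaceZ sZ).
  by rewrite opE dotZl; apply: ceqP; rewrite !cE; ring.
split.
- move=> a s t Zs Zt; rewrite !pE //; last exact: sZ.2.
  by rewrite !opE dotDl dotZl !cE; ring.
- by move=> t Zt pt; rewrite pE //; exact/ge0_re/pt.
- move=> t Zt pt; rewrite pE; last exact: (subspaceZ sZ).
  by rewrite opE dotZl !cE (ge0_im (pt x)); ring.
- by rewrite pE //= dotxx x1 expr1n.
- by move=> t nt; rewrite /p asboolF.
Qed.
End StateSpace.

(** * A system of minimal order as functions on its state space *)

Section StateFunctions.
Variables (R : realType) (H : hilbert R) (Z : set (opspace H)).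
Hypothesis oZ : operator_system Z.
Hypothesis minZ : minimal_order Z.

Let Zb : forall z, Z z -> bounded_op H H z. Proof. by case: oZ. Qed.
Let sZ : @Defs.subspace _ (H -> H) Z. Proof. by case: oZ. Qed.
Let Z1 : Z idfun. Proof. by case: oZ. Qed.

Local Notation PT := {ptws {classic (H -> H)} -> R}.
Let X : topologicalType := set_type ([set p | real_state Z p] : set PT).
Let state_ofP (x : X) : real_state Z (set_val x : PT). Proof. exact: set_valP x. Qed.
Let ev (t : H -> H) : funspace R X := fun x => state_value (set_val x : PT) t.
Let F : set (funspace R X) := ev @` (Z : set (H -> H)).

(** Vector states already detect positivity, after rescaling the vector to norm one. *)
Let norming (t : H -> H) : Z t -> (forall x, 0 <= (ev t x : R[i])) -> posop t.
Proof.
move=> Zt h v; have [->|v0] := eqVneq v 0; first by rewrite dot0r.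
have n0 : 0 < nr v.
  by rewrite lt_def nr_ge0 andbT; apply: contra_neq v0; exact: nr_eq0.
pose w := (nr v)^-1%:C *: v.
have w1 : nr w = 1 by rewrite nrZ cn_real gtr0_norm ?invr_gt0 // mulVf ?gt_eqF.
have [p hp pE] := vector_state oZ w1.
have := h (exist _ p (mem_set hp) : X); rewrite /ev /= pE // => hw.
have -> : v = (nr v)%:C *: w by rewrite /w scalerA -rmorphM mulfV ?gt_eqF // scale1r.
by rewrite (opZ (Zb Zt)) dotZl dotZr conjC_real !mulr_ge0 // ler0c ltW.
Qed.

Let ev_inj (s t : H -> H) : Z s -> Z t -> ev s = ev t -> s = t.
Proof.
move=> Zs Zt st; have Zst : Z (s - t) by exact: (subspaceB sZ).
have Zts : Z (t - s) by exact: (subspaceB sZ).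
have lin (a b : H -> H) x : Z a -> Z b -> ev (a - b) x = (ev a x : R[i]) - ev b x.
  move=> Za Zb'; rewrite /ev -[- b]scaleN1r addrC.
  by rewrite (state_value_lin oZ (state_ofP x)) // mulN1r addrC.
apply/eqP; rewrite -subr_eq0; apply/eqP/zero_form; first exact: Zb.
move=> v; have p1 : posop (s - t) by apply: norming => // x; rewrite lin // st subrr.
have p2 : posop (t - s) by apply: norming => // x; rewrite lin // st subrr.
have := p2 v; have := p1 v; rewrite !opE !(dotDl, dotNl) => e1 e2.
by apply/eqP; rewrite eq_le e1 andbT -oppr_ge0 opprB.
Qed.

Let fF : function_system F.
Proof.
split.
- apply: compact_set_type; apply: ptws_compact; first exact: real_state_closed.
  by move=> t; have [k hk] := real_state_bounded oZ t; exists k => p; exact: hk.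
- by apply: hausdorff_set_type; exact: ptws_hausdorff.
- split.
  + move=> _ [t Zt <-]; rewrite /mo_dom /= /ev /state_value.
    have cv (s : H -> H) : continuous (fun x : X => (set_val x : PT) s).
      move=> x; apply: (@continuous_comp X PT R set_val (fun p : PT => p s) x).
        exact: (@initial_continuous _ PT set_val x).
      exact: ptws_proj.
    exact: (complex_continuous (cv t) (cv ('i%C *: t))).
  + split.
      exists 0; first exact: (subspace0 sZ).
      apply/funext => x; rewrite /ev; have := @state_value_sum _ _ _ oZ _ (state_ofP x) unit [::] (fun=> 0).
      by rewrite !big_nil; apply=> _; exact: (subspace0 sZ).
    move=> a _ _ [s Zs <-] [t Zt <-]; exists (a *: s + t); first exact: sZ.2.
    by apply/funext => x; rewrite /ev (state_value_lin oZ (state_ofP x)).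
  + by exists idfun => //; apply/funext => x; rewrite /ev (state_value_id oZ (state_ofP x)).
  + move=> _ g [t Zt <-] hg; exists (adj t); first exact: (opsys_adj oZ).
    by apply/funext => x; rewrite hg /ev (state_value_adj oZ (state_ofP x)).
move=> x y xy; have [t xyt] : exists t : H -> H, (set_val x : PT) t <> (set_val y : PT) t.
  apply: contrapT => h; apply: xy; apply/val_inj/funext => t.
  by apply: contrapT => ht; apply: h; exists t.
(* Both points vanish outside Z, so they can only differ at an element of Z; this is why real states
   are extended by 0. *)
have Zt : Z t.
  apply: contrapT => nt; apply: xyt; have [_ _ _ _ ->//] := state_ofP x.
  by have [_ _ _ _ ->] := state_ofP y.
exists (ev t); first by exists t.
by move=> h; apply: xyt; rewrite -!(state_value_re _ t); congr re; exact: h.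
Qed.

Lemma state_function_system : exists (Y : topologicalType) (G : set (funspace R Y)),
  function_system G /\ uco_isomorphic G Z.
Proof.
exists X, F; split; first exact: fF.
pose chi (f : funspace R X) : opspace H := xget 0 [set t | Z t /\ ev t = f].
have chiK t : Z t -> chi (ev t) = t.
  move=> Zt; have [Zs st] := @xgetI _ 0 [set s | Z s /\ ev s = ev t] t (conj Zt erefl).
  exact: ev_inj.
exists chi; last first.
  apply/seteqP; split; first by move=> _ [_ [t Zt <-] <-]; rewrite chiK.
  by move=> t Zt; exists (ev t); [exists t|exact: chiK].
have evl a s t : Z s -> Z t -> a *: ev s + ev t = ev (a *: s + t).
  by move=> Zs Zt; apply/funext => x; rewrite /ev (state_value_lin oZ (state_ofP x)).
have ev1 : ev idfun = fun=> 1.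
  by apply/funext => x; rewrite /ev (state_value_id oZ (state_ofP x)).
split.
- by move=> _ [t Zt <-]; rewrite chiK //; exact: Zb.
- by move=> a _ _ [s Zs <-] [t Zt <-]; rewrite evl // !chiK //; exact: sZ.2.
- by rewrite /= -ev1 chiK.
move=> n M FM; have FM' i j : Z (chi (M i j)) /\ ev (chi (M i j)) = M i j.
  by have [t Zt <-] := FM i j; rewrite chiK.
pose z i j : H -> H := chi (M i j).
have Zz i j : Z (z i j) by exact: (FM' i j).1.
have Zc (c : 'I_n -> R[i]) i j : Z ((c j * Num.conj (c i)) *: z i j) by exact: (subspaceZ sZ).
have Zs c i : Z (\sum_j (c j * Num.conj (c i)) *: z i j) by exact: (subspace_sum sZ).
have formE c x : ev (\sum_i \sum_j (c j * Num.conj (c i)) *: z i j) x =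
    \sum_i \sum_j (M i j x : R[i]) * c j * Num.conj (c i).
  rewrite /ev (state_value_sum oZ (state_ofP x)) //; apply: eq_bigr => i _.
  rewrite (state_value_sum oZ (state_ofP x)) //; apply: eq_bigr => j _.
  rewrite (state_valueZ oZ (state_ofP x)) // -(FM' i j).2 /ev -/(z i j).
  by rewrite mulrC mulrA.
have zE : z = fun i j => (map_mx chi M) i j.
  by apply/funext => i; apply/funext => j; rewrite mxE.
have posE : mo_pos (map_mx chi M) <-> mpos z by rewrite zE.
apply: iff_trans _ (iff_sym posE); split=> h.
  apply: minZ => // c; apply: norming; first exact: (subspace_sum sZ).
  by move=> x; rewrite formE; exact: h.
move=> x c; rewrite -formE; apply: (state_value_pos oZ (state_ofP x)).
  exact: (subspace_sum sZ).
move=> v; have := h (fun i => c i *: v).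
rewrite !opE dot_suml; congr (0 <= _); apply: eq_bigr => i _.
rewrite opE dot_suml; apply: eq_bigr => j _.
by rewrite opE dotZl dotZr (opZ (Zb (Zz i j))) dotZl mulrA [c j * _]mulrC.
Qed.
End StateFunctions.

(** The centre is replaced by a function system on its state space without changing the represented
    image. Passing from the closure of S back to S costs nothing, as TRO-equivalence only asks for
    inclusions into closures. *)
Lemma centre_function_system (R : realType) (H : hilbert R) (S : set (opspace H))
    (E : cstar_envelope (opclosure S)) : operator_system S ->
  delta_equivalent (opclosure S : set (opspace H)) (centre E) ->
  exists (X : topologicalType) (F : set (funspace R X)),
    function_system F /\ delta_equivalent S F.
Proof.
move=> oS [H1 [K1 [phi [psi [uphi upsi [M [tM nM MT MS]]]]]]].
have oS' := opsys_closure oS; have [Sb' _ _ _] := oS'; have [Sb _ _ _] := oS.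
have [X [F [fF [chi uchi imchi]]]] :=
  state_function_system (centre_opsys E oS') (centre_min oS').
exists X, F; split=> //; exists H1, K1, phi, (psi \o chi); split.
- by apply: ucoe_sub uphi; exact: sub_opclosure.
- by apply: ucoe_comp => //; rewrite imchi.
have im : (psi \o chi) @` F = psi @` centre E by rewrite -imchi image_comp.
rewrite im; exists M; split=> //.
  apply: (subset_trans MT); rewrite -[X in _ `<=` X]opclosure_idem; apply: opclosureS.
  move=> _ [s Ss <-]; apply/opclosureP; split; first exact: (ucoe_bop uphi).
  move=> e e0; have /opclosureP[_ /(_ e e0)[a Sa sa]] := Ss.
  exists (phi a); first by exists a.
  by apply/(ucoe_odist oS' uphi Ss _ (ltW e0)) => //; exact: sub_opclosure.
apply: subset_trans MS => _ [_ [a Ma [_ [s Ss <-] <-]] [b Mb <-]].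
exists (a \o phi s); last by exists b.
by exists a => //; exists (phi s) => //; exists s => //; exact: sub_opclosure.
Qed.

Theorem corollary6p2 (R : realType) :
  (forall (H K : hilbert R) (S : set (opspace H)) (T : set (opspace K))
          (ES : cstar_envelope (opclosure S)) (ET : cstar_envelope (opclosure T)),
     operator_system S -> operator_system T ->
     delta_equivalent S T -> uco_isomorphic (centre ES) (centre ET))
  /\
  (forall (H : hilbert R) (S : set (opspace H))
          (ES : cstar_envelope (opclosure S)),
     operator_system S ->
     ((exists (X : topologicalType) (F : set (funspace R X)),
         function_system F /\ delta_equivalent S F) <->
      delta_equivalent (opclosure S : set (opspace H)) (centre ES))).
Proof.
split; first by move=> H K S T ES ET; exact: delta_centres.
move=> H S ES oS; split; last exact: centre_function_system.
by move=> [X [F [fF dSF]]]; exact: (function_system_centre ES oS fF dSF).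
Qed.
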